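(* Let $\alpha\in[0,1)$ and set $\kappa_\alpha:=\frac{2-\alpha}{2}$, $\nu_\alpha:=\frac{1-\alpha}{2-\alpha}$. Let $J_{-\nu_\alpha}$ be the Bessel function of the first kind of negative order $-\nu_\alpha$ and let $(j_{-\nu_\alpha+1,n})_{n\ge1}$ be the increasing sequence of positive zeros of the Bessel function $J_{-\nu_\alpha+1}$. Consider the eigenvalue problem of finding $\lambda\in\mathbb R$ and $\Phi\in H^2_\alpha(0,1)$, $\Phi\not\equiv0$, such that $$-(x^\alpha\Phi')'=\lambda\Phi \ \text{ in }(0,1),\qquad (x^\alpha\Phi')(0)=0,\qquad \Phi'(1)=0. \qquad ( * )$$ Then the set of solutions $(\lambda,\Phi)$ of $( * )$ is $$\{(\lambda_{\alpha,n},\rho\,\Phi_{\alpha,n}) : n\in\mathbb N=\{0,1,2,\dots\},\ \rho\in\mathbb R\setminus\{0\}\},$$ where $\lambda_{\alpha,0}=0$, $\Phi_{\alpha,0}(x)=1$, and for $n\ge1$ $$\lambda_{\alpha,n}=\kappa_\alpha^2\,j_{-\nu_\alpha+1,n}^2,\qquad \Phi_{\alpha,n}(x)=K_{\alpha,n}\,x^{\frac{1-\alpha}{2}}\,J_{-\nu_\alpha}\bigl(j_{-\nu_\alpha+1,n}\,x^{\frac{2-\alpha}{2}}\bigr),$$ the positive constant $K_{\alpha,n}$ being chosen so that $\|\Phi_{\alpha,n}\|_{L^2(0,1)}=1$. Moreover, the sequence $(\Phi_{\alpha,n})_{n\ge0}$ forms an orthonormal basis of $L^2(0,1)$. Additionally,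 the sequence $\bigl(\sqrt{\lambda_{\alpha,n+1}}-\sqrt{\lambda_{\alpha,n}}\bigr)_{n\ge1}$ is decreasing and $$\sqrt{\lambda_{\alpha,n+1}}-\sqrt{\lambda_{\alpha,n}}\to\frac{2-\alpha}{2}\,\pi\quad\text{as }n\to\infty.$$
   Context: All function spaces consist of real-valued functions. For $\alpha\in[0,1)$, $H^1_\alpha(0,1)$ is the space of $u\in L^2(0,1)$ that are absolutely continuous on $[0,1]$ and satisfy $x^{\alpha/2}u_x\in L^2(0,1)$; $H^2_\alpha(0,1):=\{u\in H^1_\alpha(0,1): x^\alpha u_x\in H^1(0,1)\}$. For $u\in H^2_\alpha(0,1)$ the function $x^\alpha u_x$ is continuous on $[0,1]$, so its values at $0$ and $1$ make sense. The Bessel function of order $\nu$ of the first kind is $J_\nu(y)=\sum_{m\ge0}\frac{(-1)^m}{m!\,\Gamma(m+\nu+1)}(y/2)^{2m+\nu}$, $y>0$.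
   Formalization: ''Decreasing'' is taken as non-increasing for all α in [0,1) and as strictly decreasing only for α in (0,1), since for α = 0 the zeros of J_{1/2} are nπ and all the gaps equal π. *)

(* Defs.v *)
From HB Require Import structures.
From mathcomp Require Import all_boot all_order all_algebra.
From mathcomp Require Import all_classical all_reals all_analysis.

Set Implicit Arguments.
Unset Strict Implicit.
Unset Printing Implicit Defensive.

Import Order.TTheory GRing.Theory Num.Theory.
Import numFieldNormedType.Exports.

Local Open Scope classical_set_scope.
Local Open Scope ring_scope.

Section Definitions.
Context {R : realType}.
Implicit Types (u v g Phi : R -> R) (alpha lam : R).

Local Notation mu := (@lebesgue_measure R).

Definition I01 : set R := `]0, 1[.

(* The elements of L^2(0,1) are functions on R, of which only the values on
   (0,1) matter, and which are identified when equal a.e. on (0,1) *)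
Definition L2 : set (R -> R) := [set u | u \_ I01 \in Lfun mu 2%:E].

Definition L2dot u v : R := \int[mu]_(x in I01) (u x * v x).

Definition L2norm u : R := Num.sqrt (L2dot u u).

Definition orthonormal_basis (e : nat -> R -> R) : Prop :=
  [/\ forall n, L2 (e n),
      forall m n, L2dot (e m) (e n) = (m == n)%:R &
      forall u, L2 u ->
        L2norm (fun x => u x - \sum_(k < n) L2dot u (e k) * e k x)
          @[n --> \oo] --> 0].

Definition abs_continuous (a b : R) v : Prop :=
  forall eps, 0 < eps -> exists2 delta, 0 < delta &
    forall n (s t : 'I_n -> R),
      (forall i, [/\ a <= s i, s i <= t i & t i <= b]) ->
      trivIset setT (fun i => `]s i, t i[%classic) ->
      \sum_i (t i - s i) < delta ->
      \sum_i `|v (t i) - v (s i)| < eps.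

(* v is the absolutely continuous representative of the class of u; its values
   on [0,1], hence the values of (the class of) u at 0 and 1, are determined by
   continuity *)
Definition ac_repr u v : Prop := abs_continuous 0 1 v /\ ae_eq mu I01 u v.

(* u is absolutely continuous on [0,1] with u_x = g a.e. on (0,1) *)
Definition has_deriv u g : Prop :=
  exists2 v, ac_repr u v &
    {ae mu, forall x, I01 x -> is_derive x (1 : R) v (g x)}.

Definition H1 alpha : set (R -> R) :=
  [set u | L2 u /\
    exists2 g, has_deriv u g & L2 (fun x => x `^ (alpha / 2) * g x)].

(* H1 0 is the usual H^1(0,1) *)
Definition H2 alpha : set (R -> R) :=
  [set u | H1 alpha u /\
    exists2 g, has_deriv u g & H1 0 (fun x => x `^ alpha * g x)].

(* -(x^alpha Phi')' = lam Phi in (0,1), with Phi' = g and (x^alpha Phi')' = r *)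
Definition eigen_eq alpha lam Phi : Prop :=
  exists g r, [/\ has_deriv Phi g,
    has_deriv (fun x => x `^ alpha * g x) r &
    ae_eq mu I01 (fun x => - r x) (fun x => lam * Phi x)].

(* (x^alpha Phi')(0) = 0 *)
Definition flux0 alpha Phi : Prop :=
  exists g w, [/\ has_deriv Phi g,
    ac_repr (fun x => x `^ alpha * g x) w & w 0 = 0].

(* Phi'(1) = 0, a left derivative since Phi lives on [0,1] *)
Definition neumann1 Phi : Prop :=
  exists2 v, ac_repr Phi v & h^-1 * (v (1 + h) - v 1) @[h --> 0^'-] --> 0.

Definition eigenpair alpha lam Phi : Prop :=
  [/\ H2 alpha Phi, ~ ae_eq mu I01 Phi (cst 0), eigen_eq alpha lam Phi,
      flux0 alpha Phi & neumann1 Phi].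

(* Euler's integral, meaningful for s > 0 only *)
Definition Gamma (s : R) : R :=
  \int[mu]_(t in `]0, +oo[) (t `^ (s - 1) * expR (- t)).

(* Meant for nu > -1 and y > 0, where all the arguments of Gamma are > 0 *)
Definition besselJ (nu y : R) : R :=
  limn (series (fun m =>
    (-1) ^+ m / (m`!%:R * Gamma (m%:R + nu + 1)) *
    (y / 2) `^ (2 * m%:R + nu))).

Definition is_positive_zeros (f : R -> R) (j : nat -> R) : Prop :=
  increasing_seq j /\ range j = [set y | 0 < y /\ f y = 0].

(* The increasing sequence of the positive zeros of f, numbered from 0; the
   default value 0 is returned if there is no such sequence *)
Definition positive_zeros (f : R -> R) : nat -> R :=
  xget (cst 0) [set j | is_positive_zeros f j].

Definition kappa alpha : R := (2 - alpha) / 2.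

Definition nu alpha : R := (1 - alpha) / (2 - alpha).

(* The n-th positive zero of J_(1-nu_alpha) for n >= 1; not used for n = 0 *)
Definition jzero alpha (n : nat) : R :=
  positive_zeros (besselJ (- nu alpha + 1)) n.-1.

Definition lambda alpha (n : nat) : R :=
  if n is 0%N then 0 else kappa alpha ^+ 2 * jzero alpha n ^+ 2.

Definition phi alpha (n : nat) (x : R) : R :=
  x `^ ((1 - alpha) / 2) *
  besselJ (- nu alpha) (jzero alpha n * x `^ ((2 - alpha) / 2)).

Definition Phi_ alpha (n : nat) (x : R) : R :=
  if n is 0%N then 1 else (L2norm (phi alpha n))^-1 * phi alpha n x.

Definition gap alpha (n : nat) : R :=
  Num.sqrt (lambda alpha n.+1) - Num.sqrt (lambda alpha n).

End Definitions.

(* Main.v *)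
Require Import Defs.
From mathcomp Require Import all_boot all_order all_algebra.
From mathcomp Require Import all_classical all_reals all_analysis.
From mathcomp Require Import measurable_realfun.
From mathcomp Require Import ring lra.
Import Order.TTheory GRing.Theory Num.Theory.
Import numFieldNormedType.Exports.
Local Open Scope classical_set_scope.
Local Open Scope ring_scope.
Set Implicit Arguments.
Unset Strict Implicit.
Unset Printing Implicit Defensive.

(** With m := 1 / (2 - alpha), which is 1 - nu_alpha and lies in [1/2, 1[, the
substitution s = lam m^2 x^(2 - alpha) turns the equation
-(x^alpha v')' = lam v into the equation of the entire series
hyp m s = sum_k (-s)^k / (k! m (m+1) ... (m+k-1)): the solution which is
regular at 0 with v 0 = 1 is v = hyp m s, and its flux x^alpha v' is
-lam x (hyp (m + 1) s). Up to constants and powers, hyp m and hyp (m + 1) at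
y^2/4 are J_(-nu) and J_(1-nu) ([besselJ_hyp]). So, for lam > 0, the flux
vanishes at 1 exactly if sqrt lam / kappa is a zero of J_(1-nu).

Zeros. The function y^(1/2) J_m(y) solves Y'' + q Y = 0, where
q = 1 - (m^2 - 1/4) / y^2 is nondecreasing with limit 1. Sturm's comparison
theorem ([sturm], [sturm_lt]) with sine functions shows that there are zeros,
that their gaps are at least pi ([gap_ge_pi]) and tend to pi ([zgap_cvg]); the
comparison of Y with its own translate by a gap shows that the gaps decrease
([gap_mono], strictly in [gap_mono_lt] if m > 1/2, that is alpha > 0). The
zeros are simple, as hyp m and hyp (m + 1) have no common positive zero
([no_common_zero]).

Eigenpairs. The equation is given almost everywhere, for absolutely continuous
representatives. An absolutely continuous function whose derivative is 0 a.e.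
is constant ([abs_continuous_der0]), so the weak equation integrates to a
classical first-order system for v and its flux w ([eigenpair_classical]),
with w 0 = w 1 = 0. The singular initial value problem at 0 has only one
solution ([ivp_zero]), hence v is a multiple of hyp m s ([classical_ef]). A
negative lam is impossible, since v w would increase strictly although it
vanishes at both ends ([classical_lam_ge0]); the condition w 1 = 0 then
selects the eigenvalues ([classical_eigenvalue]).

Completeness. Orthogonality is Green's formula ([green]). The expansion
converges because of an inequality that replaces the compactness of the
resolvent: if r is the remainder of a C^1 function p after its projection on
the first n + 1 eigenfunctions, then
lam_(n+1) |r|^2 <= int x^alpha p'^2 ([tail_estimate]). The flux of the
eigenfunction of index n + 1 cuts [0, 1] into n + 1 pieces, and a function
with mean zero on each piece satisfies the Poincare inequality with the
constant lam_(n+1) ([nodal_poincare]: the difference of the two sides is the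
integral of a sum of squares). By linear algebra some nonzero combination of
the first n + 1 eigenfunctions and r has these vanishing means, and the
inequality for it gives the one for r. As lam_n tends to infinity, expansions
of C^1 functions converge, and such functions are dense ([L2_dense]). *)

Notation der f x d := (is_derive x 1%R f d) (only parsing).

(** * Differential calculus on the real line *)
Section Calculus.
Context {R : realType}.
Implicit Types (f g F : R -> R) (x a b : R).

Lemma der_near f g x a : (\near x, f x = g x) -> der f x a -> der g x a.
Proof.
move=> fg df; exact: (near_eq_is_derive fg).
Qed.

Lemma derD f g x a b : der f x a -> der g x b ->
  der (fun y => f y + g y) x (a + b).
Proof. by move=> df dg; apply: is_deriveD. Qed.

Lemma derN f x a : der f x a -> der (fun y => - f y) x (- a).
Proof. by move=> df; apply: is_deriveN. Qed.

Lemma derB f g x a b : der f x a -> der g x b ->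
  der (fun y => f y - g y) x (a - b).
Proof. by move=> df dg; apply: is_deriveB. Qed.

Lemma derM f g x a b : der f x a -> der g x b ->
  der (fun y => f y * g y) x (a * g x + f x * b).
Proof.
move=> df dg; have h := is_deriveM df dg; apply: (is_derive_eq h).
by rewrite /GRing.scale /= addrC [g x * a]mulrC.
Qed.

Lemma derZ k f x a : der f x a -> der (fun y => k * f y) x (k * a).
Proof. by move=> df; apply: (@is_deriveZ _ _ _ f k). Qed.

Lemma der_cst k x : der (fun=> k : R) x (0 : R).
Proof. exact: is_derive_cst. Qed.

Lemma der_id x : der (fun y => y : R) x (1 : R).
Proof. exact: is_derive_id. Qed.

Lemma derV f x a : f x != 0 -> der f x a ->
  der (fun y => (f y)^-1) x (- a / f x ^+ 2).
Proof.
move=> fx df; apply: (is_derive_eq (is_deriveV fx df)).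
by rewrite /GRing.scale /= mulrC mulNr mulrN.
Qed.

Lemma derX n f x a : der f x a -> der (fun y => f y ^+ n) x (n%:R * f x ^+ n.-1 * a).
Proof.
move=> df; have h := is_deriveX n df; apply: (der_near _ (is_derive_eq h _)).
  by near=> y; rewrite exprfctE.
by rewrite /GRing.scale /=.
Unshelve. all: by end_near. Qed.

Lemma der_comp f g x a b : der f (g x) a -> der g x b ->
  der (fun y => f (g y)) x (a * b).
Proof. by move=> df dg; apply: (@is_derive1_comp _ f g). Qed.

Lemma der_powR p x : 0 < x -> der (fun y => y `^ p) x (p * x `^ (p - 1)).
Proof. by move=> x0; exact: is_derive1_powR. Qed.

Lemma der_cvg f x a : der f x a -> {for x, continuous f}.
Proof.
by move=> df; apply/differentiable_continuous; rewrite -derivable1_diffP; case: df.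
Qed.

Lemma within_cont (A : set R) f : {in A, continuous f} -> {within A, continuous f}.
Proof. by move=> h; exact: continuous_in_subspaceT. Qed.

Lemma der_ge0_le f df a b : a <= b -> {within `[a, b], continuous f} ->
  (forall x, a < x < b -> der f x (df x)) ->
  (forall x, a < x < b -> 0 <= df x) -> f a <= f b.
Proof.
rewrite le_eqVlt => /orP[/eqP->//|ab] cf hd h0.
have h1 x : x \in `]a, b[%R -> der f x (df x) by rewrite in_itv/= => /hd.
have [c] := MVT ab h1 cf.
rewrite in_itv/= => cab e; rewrite -subr_ge0 e mulr_ge0 ?h0// subr_ge0 ltW//.
Qed.

Lemma der_gt0_lt f df a b : a < b -> {within `[a, b], continuous f} ->
  (forall x, a < x < b -> der f x (df x)) ->
  (forall x, a < x < b -> 0 < df x) -> f a < f b.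
Proof.
move=> ab cf hd h0.
have h1 x : x \in `]a, b[%R -> der f x (df x) by rewrite in_itv/= => /hd.
have [c] := MVT ab h1 cf.
by rewrite in_itv/= => cab e; rewrite -subr_gt0 e mulr_gt0 ?h0// subr_gt0.
Qed.

Lemma der_eq0 f a b : a <= b -> {within `[a, b], continuous f} ->
  (forall x, a < x < b -> der f x 0) -> f a = f b.
Proof.
rewrite le_eqVlt => /orP[/eqP->//|ab] cf hd.
have h1 x : x \in `]a, b[%R -> der f x ((fun=> 0) x) by rewrite in_itv/= => /hd.
have [c] := MVT ab h1 cf.
by rewrite in_itv/= mul0r; move=> _ /eqP; rewrite subr_eq0 => /eqP.
Qed.

Lemma der_bound f df a b M : a <= b -> {within `[a, b], continuous f} ->
  (forall x, a < x < b -> der f x (df x)) ->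
  (forall x, a < x < b -> `|df x| <= M) -> `|f b - f a| <= M * (b - a).
Proof.
rewrite le_eqVlt => /orP[/eqP->|ab] cf hd hM.
  by rewrite !subrr normr0 mulr0.
have h1 x : x \in `]a, b[%R -> der f x (df x) by rewrite in_itv/= => /hd.
have [c] := MVT ab h1 cf.
have ab0 : 0 <= b - a by rewrite subr_ge0 ltW.
by rewrite in_itv/= => cab ->; rewrite normrM (ger0_norm ab0) ler_wpM2r// hM.
Qed.

Local Notation mu := (@lebesgue_measure R).

Lemma cont_integrable f a b : {within `[a, b], continuous f} ->
  mu.-integrable `[a, b] (EFin \o f).
Proof. by move=> cf; apply: continuous_compact_integrable => //; exact: segment_compact. Qed.

Lemma FTC F f a b : a <= b -> {within `[a, b], continuous f} ->
  {within `[a, b], continuous F} ->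
  (forall x, a < x < b -> der F x (f x)) ->
  \int[mu]_(x in `]a, b[) f x = F b - F a.
Proof.
rewrite le_eqVlt => /orP[/eqP<-|ab] cf cF hd.
  rewrite subrr set_itvoo0 Rintegral_set0//.
have fi := cont_integrable cf.
have -> : \int[mu]_(x in `]a, b[) f x = \int[mu]_(x in `[a, b]) f x.
  rewrite Rintegral_itv_bndo_bndc; last first.
    by apply: integrableS fi => //; exact: subset_itv_oo_cc.
  rewrite Rintegral_itv_obnd_cbnd//.
  by apply: integrableS fi => //; exact: subset_itv_oc_cc.
have [cF1 cF2 cF3] := (continuous_within_itvP _ ab).1 cF.
rewrite /Rintegral (@continuous_FTC2 _ f F)//.
  split => // x; rewrite in_itv/= => /hd xd; by case: xd.
by move=> x; rewrite in_itv/= => /hd xd; rewrite derive1E; case: xd.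
Qed.

(** The lower limit -1 makes the primitive differentiable at 0 on both sides. *)
Lemma primitive f : continuous f ->
  exists F, F 0 = 0 /\ forall x, -1 < x -> der F x (f x).
Proof.
move=> cf; pose G x := \int[mu]_(t in `[-1, x]) f t.
exists (fun x => G x - G 0); split; first by rewrite subrr.
move=> x x1; suff dG : der G x (f x).
  by have := derB dG (der_cst (G 0) x); rewrite subr0.
have [] := @continuous_FTC1_closed _ f (-1) x (x + 1) _ _ x1 (cf x).
- by rewrite ltrDl.
- by apply: cont_integrable; apply: within_cont => y _; exact: cf.
move=> dG e; split; first exact: dG.
rewrite -derive1E; exact: e.
Qed.

End Calculus.

(** * The confluent limit series 0F1 *)
Section HypergeometricSeries.
Context {R : realType}.
Implicit Types (a s : R) (m : nat).

Definition poch a m : R := \prod_(i < m) (a + i%:R).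

Lemma poch0 a : poch a 0 = 1.
Proof. by rewrite /poch big_ord0. Qed.

Lemma pochS a m : poch a m.+1 = poch a m * (a + m%:R).
Proof. by rewrite /poch big_ord_recr. Qed.

Lemma pochSl a m : poch a m.+1 = a * poch (a + 1) m.
Proof.
rewrite /poch big_ord_recl addr0; congr (_ * _); apply: eq_bigr => i _.
by rewrite /= /bump add1n -natr1 addrA addrAC.
Qed.

Lemma poch_gt0 a m : 0 < a -> 0 < poch a m.
Proof. by move=> a0; apply: prodr_gt0 => i _; rewrite ltr_wpDr. Qed.

Definition hcoef a m : R := (-1) ^+ m / (m`!%:R * poch a m).

Definition hyp a s : R := limn (pseries (hcoef a) s).

(** A bound that is uniform in [m], so that the exponential series dominates. *)
Lemma pochV_le a m : 0 < a -> (poch a m)^-1 <= a^-1 + 1.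
Proof.
move=> a0; case: m => [|m]; first by rewrite poch0 invr1 lerDr invr_ge0 ltW.
apply: (@le_trans _ _ a^-1); last by rewrite lerDl.
rewrite lef_pV2 ?posrE ?poch_gt0//.
elim: m => [|m IH]; first by rewrite pochSl poch0 mulr1.
apply: le_trans IH _; rewrite [leRHS]pochS ler_peMr//; first by rewrite ltW ?poch_gt0.
by rewrite -natr1 addrA lerDr addr_ge0// ltW.
Qed.

Lemma is_cvg_hyp a s : 0 < a -> cvgn (pseries (hcoef a) s).
Proof.
move=> a0; rewrite /pseries; apply: normed_cvg.
apply: (@series_le_cvg _ _ (fun m => (a^-1 + 1) * (`|s| ^+ m / m`!%:R))) => //.
- by move=> m /=; exact: normr_ge0.
- by move=> m /=; apply: mulr_ge0; rewrite ?divr_ge0 ?exprn_ge0// addr_ge0// invr_ge0 ltW.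
- move=> m /=; rewrite /hcoef normrM normrM normrX normrN1 expr1n mul1r normrX invfM normrM.
  have p0 : 0 <= (poch a m)^-1 by rewrite invr_ge0 ltW// poch_gt0.
  have f0 : 0 <= m`!%:R^-1 :> R by rewrite invr_ge0.
  rewrite (ger0_norm p0) (ger0_norm f0) [leLHS](_ : _ = (poch a m)^-1 * (`|s| ^+ m / m`!%:R)); last by ring.
  by rewrite ler_wpM2r ?pochV_le// mulr_ge0 ?exprn_ge0.
have -> : series (fun m => (a^-1 + 1) * (`|s| ^+ m / m`!%:R)) =
    fun n => (a^-1 + 1) * series (exp_coeff `|s|) n.
  by apply/funext => n; rewrite /series /= mulr_sumr.
by apply: is_cvgM; [exact: is_cvg_cst|exact: is_cvg_series_exp_coeff].
Qed.

Lemma hcoef_diffs a : 0 < a ->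
  pseries_diffs (hcoef a) = (fun m => - a^-1 * hcoef (a + 1) m).
Proof.
move=> a0; apply/funext => m; rewrite /pseries_diffs /hcoef pochSl factS natrM exprS.
have p0 : poch (a + 1) m != 0 by rewrite gt_eqF// poch_gt0// addr_gt0.
have f0 : m`!%:R != 0 :> R by rewrite pnatr_eq0 -lt0n fact_gt0.
have m0 : m.+1%:R != 0 :> R by rewrite pnatr_eq0.
by rewrite -natr1 in m0 *; field; rewrite p0 f0 m0 gt_eqF.
Qed.

Lemma hyp_cvg a s : 0 < a -> pseries (hcoef a) s @ \oo --> hyp a s.
Proof. by move=> /is_cvg_hyp; exact. Qed.

Lemma pseriesZ k (c : R^nat) s : pseries (fun m => k * c m) s = (fun n => k * pseries c s n).
Proof.
apply/funext => n; rewrite /pseries /series /= mulr_sumr.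
by apply: eq_bigr => i _; rewrite mulrA.
Qed.

Lemma hyp_der a s : 0 < a -> der (hyp a) s (- a^-1 * hyp (a + 1) s).
Proof.
move=> a0; have a1 : 0 < a + 1 by rewrite addr_gt0.
have a2 : 0 < a + 1 + 1 by rewrite addr_gt0.
have Cz k b x : 0 < b -> cvgn (pseries (fun m => k * hcoef b m) x).
  move=> b0; rewrite pseriesZ; apply: is_cvgM; [exact: is_cvg_cst|exact: is_cvg_hyp].
have E : limn (pseries (pseries_diffs (hcoef a)) s) = - a^-1 * hyp (a + 1) s.
  rewrite hcoef_diffs// pseriesZ; apply/cvg_lim => //.
  by apply: cvgM; [exact: cvg_cst|exact: hyp_cvg].
rewrite -E; apply: (@pseries_snd_diffs _ _ (`|s| + 1)).
- exact: is_cvg_hyp.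
- by rewrite hcoef_diffs//; exact: Cz.
- have -> : pseries_diffs (pseries_diffs (hcoef a)) =
     fun m => - a^-1 * pseries_diffs (hcoef (a + 1)) m.
    by rewrite hcoef_diffs//; apply/funext => m; rewrite /pseries_diffs mulrCA.
  rewrite pseriesZ hcoef_diffs//; apply: is_cvgM; first exact: is_cvg_cst.
  exact: Cz.
- by rewrite (@ger0_norm _ (`|s| + 1)) ?addr_ge0// ltrDl.
Qed.

(** Compared coefficient by coefficient. Together with [hyp_der] it expresses the
derivative of hyp (a + 1) by hyp a and hyp (a + 1), so that this pair solves a
first-order system. *)
Lemma hyp_contig a s : 0 < a ->
  hyp a s - hyp (a + 1) s = - s / (a * (a + 1)) * hyp (a + 1 + 1) s.
Proof.
move=> a0; have a1 : 0 < a + 1 by rewrite addr_gt0.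
have a2 : 0 < a + 1 + 1 by rewrite addr_gt0.
have H1 : (pseries (hcoef a) s n - pseries (hcoef (a + 1)) s n) @[n --> \oo] -->
   hyp a s - hyp (a + 1) s by apply: cvgB; exact: hyp_cvg.
have H2 : (- s / (a * (a + 1)) * pseries (hcoef (a + 1 + 1)) s n) @[n --> \oo] -->
   - s / (a * (a + 1)) * hyp (a + 1 + 1) s.
  by apply: cvgM; [exact: cvg_cst|exact: hyp_cvg].
move: H1; rewrite -cvg_shiftS => H1.
apply: (cvg_unique _ H1); rewrite // in H2 *.
rewrite [X in X @ _](_ : _ =
   (fun n => - s / (a * (a + 1)) * pseries (hcoef (a + 1 + 1)) s n))//.
apply/funext => n; rewrite /pseries /series /= -sumrB big_nat_recl//.
rewrite /hcoef !poch0 subrr add0r mulr_sumr; apply: eq_bigr => k _.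
rewrite factS !natrM !exprS; rewrite [poch (a+1) k.+1]pochSl pochSl.
have p0 : poch (a + 1 + 1) k != 0 by rewrite gt_eqF// poch_gt0.
have E : (a + 1) * poch (a + 1 + 1) k = poch (a + 1) k * (a + 1 + k%:R).
  by rewrite -pochSl pochS.
have q0 : poch (a + 1) k != 0 by rewrite gt_eqF// poch_gt0.
have f0 : k`!%:R != 0 :> R by rewrite pnatr_eq0 -lt0n fact_gt0.
have k0 : a + 1 + k%:R != 0 by rewrite gt_eqF// ltr_wpDr.
have -> : poch (a + 1 + 1) k = poch (a + 1) k * (a + 1 + k%:R) / (a + 1).
  by rewrite -E mulrC mulKf// gt_eqF.
field; rewrite q0 f0 k0 !gt_eqF// addrC -natr1 addrA; split=>//.
Qed.

End HypergeometricSeries.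

Lemma powR_subr1 (R : realType) (p y : R) : 0 < y -> y `^ p = y `^ (p - 1) * y.
Proof.
by move=> y0; rewrite -{3}(powRr1 (ltW y0)) -powRD ?subrK// (gt_eqF y0) implybT.
Qed.

(** * The first-order system and its Sturm normal form *)
Section BesselSystem.
Context {R : realType}.
Context (m : R) (m_ge : 2^-1 <= m).

Let m0 : 0 < m. Proof. by apply: lt_le_trans m_ge; rewrite invr_gt0. Qed.
Let m1 : 0 < m + 1. Proof. by rewrite addr_gt0. Qed.

Lemma hyp0 (a : R) : hyp a 0 = 1.
Proof.
apply: lim_near_cst => //; near=> n.
have -> : n = n.-1.+1 by rewrite prednK//; near: n; exact: nbhs_infty_gt.
rewrite /pseries /series /= big_nat_recl//= big1 => [|i _].
  by rewrite !expr0 addr0 mulr1 /hcoef poch0 expr0 fact0 mulr1 mulr1n divr1.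
by rewrite expr0n mulr0.
Unshelve. all: by end_near. Qed.

Lemma f_der (s : R) : der (hyp m) s (- hyp (m + 1) s / m).
Proof. by apply: (is_derive_eq (hyp_der s m0)); rewrite mulNr mulrC mulNr. Qed.

Lemma g_der (s : R) : 0 < s -> der (hyp (m + 1)) s (m * (hyp m s - hyp (m + 1) s) / s).
Proof.
move=> s0; apply: (is_derive_eq (hyp_der s m1)); rewrite (hyp_contig s m0).
by field; rewrite !gt_eqF// addrC.
Qed.

Lemma hyp_cont (a : R) : 0 < a -> continuous (hyp a).
Proof. by move=> a0 s; exact: (der_cvg (hyp_der s a0)). Qed.

(** For f = hyp m and g = hyp (m + 1), the energy
P t = t^(2m-1) (f^2 + t g^2 / m^2) has the derivative
(2m-1) t^(2m-2) f^2 >= 0. If f and g vanish at [s], then P s = 0; as P >= 0, it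
vanishes on ]0, s], and so does f, which contradicts f 0 = 1. *)
Lemma no_common_zero (s : R) : 0 < s -> hyp m s = 0 -> hyp (m + 1) s = 0 -> False.
Proof.
move=> s0 fs gs.
pose f := hyp m; pose g := hyp (m + 1).
pose P t := t `^ (2 * m - 1) * (f t ^+ 2 + t * g t ^+ 2 / m ^+ 2).
have dP (t : R) : 0 < t -> der P t ((2 * m - 1) * t `^ (2 * m - 1 - 1) * f t ^+ 2).
  move=> t0; have h := derM (der_powR (2 * m - 1) t0)
    (derD (derX 2 (f_der t)) (derM (derM (der_id t) (derX 2 (g_der t0))) (der_cst (m ^+ 2)^-1 t))).
  apply: (is_derive_eq h); rewrite -/f -/g /=.
  rewrite (powR_subr1 (2 * m - 1) t0).
  by field; rewrite !gt_eqF.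
have P0 (t : R) : 0 < t -> t <= s -> P t <= 0.
  move=> t0 ts; have -> : 0 = P s by rewrite /P /f /g fs gs expr0n /= mulr0 mul0r addr0 mulr0.
  apply: (der_ge0_le (df := fun t => (2 * m - 1) * t `^ (2 * m - 1 - 1) * f t ^+ 2)) => //.
  - apply: within_cont => x; rewrite inE/= in_itv/= => /andP[tx _].
    exact: (der_cvg (dP _ (lt_le_trans t0 tx))).
  - by move=> x /andP[tx _]; apply: dP; exact: lt_trans tx.
  - move=> x /andP[tx _]; apply: mulr_ge0; last exact: sqr_ge0.
    apply: mulr_ge0; last exact: powR_ge0.
    by rewrite subr_ge0 mulrC -ler_pdivrMr// div1r.
have f0 (t : R) : 0 < t -> t <= s -> f t = 0.
  move=> t0 ts; have := P0 _ t0 ts; rewrite /P pmulr_rle0 ?powR_gt0// => h.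
  have h2 : 0 <= t * g t ^+ 2 / m ^+ 2 by rewrite divr_ge0 ?sqr_ge0// mulr_ge0 ?sqr_ge0// ltW.
  have h3 := sqr_ge0 (f t); apply/eqP; rewrite -sqrf_eq0; apply/eqP; lra.
have := hyp_cont m0 (x := 0).
move/cvgrPdist_lt => /(_ 1 ltr01) [e /= e0] he.
have t0 : 0 < Num.min (e / 2) s by rewrite lt_min s0 divr_gt0.
have ts : Num.min (e / 2) s <= s by rewrite ge_min lexx orbT.
have := he (Num.min (e / 2) s).
rewrite hyp0 -/(f _) f0// subr0 normr1 ltxx /ball_ /= => h.
have //: false by apply: h; rewrite sub0r normrN gtr0_norm// gt_min ltr_pdivrMr// ltr_pMr// ltr1n.
Qed.

(** Up to constant factors, y^m besG y is the Bessel function J_m and besY y is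
y^(1/2) J_m y. The factor y^(1/2) removes the first-order term of Bessel's
equation; besq is the potential of the resulting equation Y'' = - q Y. *)
Definition besG (y : R) : R := hyp (m + 1) (y ^+ 2 / 4).
Definition besY (y : R) : R := y `^ (m + 2^-1) * besG y.
Definition besY' (y : R) : R := y `^ (m - 2^-1) *
  (2 * m * hyp m (y ^+ 2 / 4) + (2^-1 - m) * hyp (m + 1) (y ^+ 2 / 4)).
Definition besq (y : R) : R := 1 - (m ^+ 2 - 4^-1) / y ^+ 2.

Lemma sq4_der (y : R) : der (fun y => y ^+ 2 / 4) y (y / 2).
Proof.
apply: (is_derive_eq (derM (derX 2 (der_id y)) (der_cst 4^-1 y))) => /=.
by field.
Qed.

Lemma sq4_gt0 (y : R) : 0 < y -> 0 < y ^+ 2 / 4.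
Proof. by move=> y0; rewrite divr_gt0 ?exprn_gt0. Qed.

Lemma besG_der (y : R) : 0 < y ->
  der besG y (2 * m * (hyp m (y ^+ 2 / 4) - besG y) / y).
Proof.
move=> y0; have h := @der_comp _ (hyp (m + 1)) (fun y => y ^+ 2 / 4) y _ _ (g_der (sq4_gt0 y0)) (sq4_der y).
by apply: (is_derive_eq h); rewrite /besG; field; rewrite gt_eqF.
Qed.

Lemma besG_cont : continuous besG.
Proof. by move=> y; exact: (der_cvg (@der_comp _ (hyp (m + 1)) (fun y => y ^+ 2 / 4) y _ _ (hyp_der _ m1) (sq4_der y))). Qed.

Lemma besY_der (y : R) : 0 < y -> der besY y (besY' y).
Proof.
move=> y0; have h := derM (der_powR (m + 2^-1) y0) (besG_der y0).
apply: (is_derive_eq h).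
rewrite /besY' -/(besG y).
have -> : y `^ (m + 2^-1) = y `^ (m - 2^-1) * y.
  by rewrite (powR_subr1 _ y0); congr (_ `^ _ * _); field.
have -> : m + 2^-1 - 1 = m - 2^-1 by field.
by field; rewrite gt_eqF.
Qed.

Lemma besY'_der (y : R) : 0 < y -> der besY' y (- besq y * besY y).
Proof.
move=> y0; have h := derM (der_powR (m - 2^-1) y0)
 (derD (derZ (2 * m) (@der_comp _ (hyp m) (fun y => y ^+ 2 / 4) y _ _ (f_der _) (sq4_der y))) (derZ (2^-1 - m) (besG_der y0))).
apply: (is_derive_eq h); rewrite /besq /besY -/(besG y).
have e1 : y `^ (m + 2^-1) = y `^ (m - 2^-1 - 1) * y ^+ 2.
  rewrite (powR_subr1 _ y0) (powR_subr1 (_ - 1) y0) expr2 mulrA.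
  by congr (_ `^ _ * _ * _); field.
have e2 : y `^ (m - 2^-1) = y `^ (m - 2^-1 - 1) * y by rewrite (powR_subr1 _ y0).
by rewrite e1 e2; field; rewrite !gt_eqF.
Qed.

Lemma besY_eq0 (y : R) : 0 < y -> (besY y = 0) <-> (besG y = 0).
Proof.
move=> y0; rewrite /besY; split=> [/eqP|->]; last by rewrite mulr0.
by rewrite mulf_eq0 gt_eqF ?powR_gt0//= => /eqP.
Qed.

Lemma besY'_neq0 (y : R) : 0 < y -> besG y = 0 -> besY' y != 0.
Proof.
move=> y0 G0; rewrite /besY' -/(besG y) G0 mulr0 addr0.
apply: mulf_neq0; first by rewrite gt_eqF// powR_gt0.
apply: mulf_neq0; first by rewrite gt_eqF// mulr_gt0.
apply/eqP => f0; exact: (no_common_zero (sq4_gt0 y0) f0 G0).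
Qed.

Lemma besq_le1 (y : R) : besq y <= 1.
Proof.
rewrite /besq gerBl divr_ge0 ?sqr_ge0// subr_ge0.
have -> : 4^-1 = 2^-1 ^+ 2 :> R by field.
by rewrite lerXn2r ?nnegrE ?invr_ge0// ltW.
Qed.

Lemma besq_mono (x y : R) : 0 < x -> x <= y -> besq x <= besq y.
Proof.
move=> x0 xy; have y0 := lt_le_trans x0 xy.
have h : 0 <= m ^+ 2 - 4^-1.
  have -> : 4^-1 = 2^-1 ^+ 2 :> R by field.
  by rewrite subr_ge0 lerXn2r ?nnegrE ?invr_ge0// ltW.
rewrite /besq lerD2l lerN2 ler_wpM2l// lef_pV2 ?posrE ?exprn_gt0//.
by rewrite lerXn2r ?nnegrE ?(ltW x0) ?(ltW y0).
Qed.

Lemma besq_mono_lt (x y : R) : 2^-1 < m -> 0 < x -> x < y -> besq x < besq y.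
Proof.
move=> mm x0 xy; have y0 := lt_trans x0 xy.
have h : 0 < m ^+ 2 - 4^-1.
  have -> : 4^-1 = 2^-1 ^+ 2 :> R by field.
  by rewrite subr_gt0 ltrXn2r ?nnegrE ?invr_ge0// ltW.
rewrite /besq ltrD2l ltrN2 ltr_pM2l// ltf_pV2 ?posrE ?exprn_gt0//.
by rewrite ltrXn2r ?nnegrE ?(ltW x0) ?(ltW y0).
Qed.

End BesselSystem.

(** * Sturm comparison *)
Section Sturm.
Context {R : realType}.
Implicit Types (f y z : R -> R) (x a b : R).

Lemma derP f x d : der f x d -> forall e, 0 < e ->
  exists2 r, 0 < r & forall t, `|t - x| < r ->
    `|f t - f x - d * (t - x)| <= e * `|t - x|.
Proof.
move=> [df dfE] e e0.
have := df; rewrite /derivable => /cvg_ex [l hl].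
have El : l = d by rewrite -dfE; apply/esym/cvg_lim.
rewrite El in hl.
move/cvgrPdist_le: hl => /(_ e e0) [r /= r0 hr]; exists r => // t tr.
have [->|tx] := eqVneq t x; first by rewrite !subrr mulr0 subr0 normr0 mulr0.
have tx0 : t - x != 0 by rewrite subr_eq0.
have := hr (t - x); rewrite /ball_ /= sub0r normrN => /(_ tr tx0).
rewrite /GRing.scale /= mulr1 subrK => h.
have -> : f t - f x - d * (t - x) = - (d - (t - x)^-1 * (f t - f x)) * (t - x).
  by field.
by rewrite normrM normrN ler_wpM2r.
Qed.

Lemma der_ge0_right f a b d : a < b -> der f a d -> f a = 0 ->
  (forall x, a < x < b -> 0 < f x) -> 0 <= d.
Proof.
move=> ab df fa fp; rewrite leNgt; apply/negP => d0.
have e0 : 0 < - d / 2 by lra.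
have [r r0 hr] := derP df e0.
pose t := a + Num.min (r / 2) ((b - a) / 2).
have m0 : 0 < Num.min (r / 2) ((b - a) / 2) by rewrite lt_min; apply/andP; split; lra.
have m1 : Num.min (r / 2) ((b - a) / 2) <= r / 2 by rewrite ge_min lexx.
have m2 : Num.min (r / 2) ((b - a) / 2) <= (b - a) / 2 by rewrite ge_min lexx orbT.
have := hr t; rewrite /t addrAC subrr add0r fa subr0 (gtr0_norm m0) => /(_ _).
have := fp t; rewrite /t; set u := Num.min _ _ in m0 m1 m2 * => h1 h2.
have {}h1 : 0 < f (a + u) by apply: h1; apply/andP; split; lra.
have {}h2 : `|f (a + u) - d * u| <= - d / 2 * u by apply: h2; lra.
move: h2; rewrite ler_norml => /andP[_ h2].
have h3 : 0 < - d * u by rewrite mulr_gt0// oppr_gt0.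
lra.
Qed.

Lemma der_le0_left f a b d : a < b -> der f b d -> f b = 0 ->
  (forall x, a < x < b -> 0 < f x) -> d <= 0.
Proof.
move=> ab df fb fp; rewrite -oppr_ge0.
have h : der (fun x => f (- x)) (- b) (- d).
  have hN : der (fun x : R => - x) (- b) (- 1) by apply: derN; exact: der_id.
  have df' : der f (- - b) d by rewrite opprK.
  by apply: (is_derive_eq (@der_comp _ f (fun x => - x) (- b) _ _ df' hN)); rewrite mulrN1.
apply: (@der_ge0_right (fun x => f (- x)) (- b) (- a) (- d)) => //.
- by rewrite ltrN2.
- by rewrite opprK.
- by move=> x /andP[h1 h2]; apply: fp; apply/andP; split; lra.
Qed.

Lemma const_sign f a b : a < b -> (forall x, a < x < b -> {for x, continuous f}) ->
  (forall x, a < x < b -> f x != 0) ->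
  exists e, (e = 1 \/ e = -1) /\ forall x, a < x < b -> 0 < e * f x.
Proof.
move=> ab cf f0; pose c := (a + b) / 2.
have cab : a < c < b by apply/andP; rewrite /c; split; lra.
have key x t : a < x < b -> a < t < b -> f x < 0 -> 0 < f t -> False.
  move=> xab tab fx ft.
  have cont u v : a < u < b -> a < v < b -> {within `[u, v], continuous f}.
    move=> /andP[au ub] /andP[av vb]; apply: within_cont => s.
    rewrite inE/= in_itv/= => /andP[us sv]; apply: cf; apply/andP; split.
      exact: lt_le_trans us.
    exact: le_lt_trans vb.
  have zero u v : a < u < b -> a < v < b -> u <= v ->
      Num.min (f u) (f v) <= 0 <= Num.max (f u) (f v) -> False.
    move=> uab vab uv hh; have [s] := IVT uv (cont _ _ uab vab) hh.
    rewrite in_itv/= => /andP[us sv] fs.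
    have : f s != 0.
      apply: f0; apply/andP; split.
        by case/andP: uab => h _; exact: lt_le_trans us.
      by case/andP: vab => _ h; exact: le_lt_trans h.
    by rewrite fs eqxx.
  have [xt|tx] := leP x t.
    by apply: (zero x t) => //; rewrite ge_min le_max (ltW fx) (ltW ft) orbT.
  by apply: (zero t x) => //; [exact: ltW|rewrite ge_min le_max (ltW fx) (ltW ft) orbT].
have [fc|fc] := ltP 0 (f c).
- exists 1; split; first by left.
  move=> x xab; rewrite mul1r ltNge le_eqVlt negb_or f0//=.
  by apply/negP => h; exact: (key x c).
- exists (-1); split; first by right.
  have {}fc : f c < 0 by rewrite lt_neqAle f0.
  move=> x xab; rewrite mulN1r oppr_gt0 ltNge le_eqVlt negb_or eq_sym f0//=.
  by apply/negP => h; exact: (key c x).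
Qed.

Lemma cont_ge0_right f a b : a < b -> {for a, continuous f} ->
  (forall x, a < x < b -> 0 < f x) -> 0 <= f a.
Proof.
move=> ab cf fp; rewrite leNgt; apply/negP => fa.
move/cvgrPdist_lt: cf => /(_ (- f a)); rewrite oppr_gt0 => /(_ fa) [r /= r0 hr].
pose u := Num.min (r / 2) ((b - a) / 2).
have m0 : 0 < u by rewrite lt_min; apply/andP; split; lra.
have m1 : u <= r / 2 by rewrite ge_min lexx.
have m2 : u <= (b - a) / 2 by rewrite ge_min lexx orbT.
have := hr (a + u); rewrite /ball_ /= opprD addrA subrr sub0r normrN (gtr0_norm m0) => h.
have {}h : `|f a - f (a + u)| < - f a by apply: h; lra.
have h2 : 0 < f (a + u) by apply: fp; apply/andP; split; lra.
by move: h; rewrite ltr_norml => /andP[h3 h4]; lra.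
Qed.

Lemma cont_ge0_left f a b : a < b -> {for b, continuous f} ->
  (forall x, a < x < b -> 0 < f x) -> 0 <= f b.
Proof.
move=> ab cf fp; rewrite leNgt; apply/negP => fa.
move/cvgrPdist_lt: cf => /(_ (- f b)); rewrite oppr_gt0 => /(_ fa) [r /= r0 hr].
pose u := Num.min (r / 2) ((b - a) / 2).
have m0 : 0 < u by rewrite lt_min; apply/andP; split; lra.
have m1 : u <= r / 2 by rewrite ge_min lexx.
have m2 : u <= (b - a) / 2 by rewrite ge_min lexx orbT.
have := hr (b - u); rewrite /ball_ /= opprB addrCA subrr addr0 (gtr0_norm m0) => h.
have {}h : `|f b - f (b - u)| < - f b by apply: h; lra.
have h2 : 0 < f (b - u) by apply: fp; apply/andP; split; lra.
by move: h; rewrite ltr_norml => /andP[h3 h4]; lra.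
Qed.

Section Comparison.
Context (y dy z dz q Q : R -> R) (a b : R).
Context (ab : a < b).
Context (hy : forall x, a <= x <= b -> der y x (dy x)).
Context (hdy : forall x, a <= x <= b -> der dy x (- q x * y x)).
Context (hz : forall x, a <= x <= b -> der z x (dz x)).
Context (hdz : forall x, a <= x <= b -> der dz x (- Q x * z x)).
Context (ya : y a = 0) (yb : y b = 0).
Context (y0 : forall x, a < x < b -> y x != 0).

Let oc x : a < x < b -> a <= x <= b.
Proof. by move=> /andP[/ltW-> /ltW->]. Qed.

(** If both y and z keep their signs, the Wronskian W = e (y' z - y z'), with
the sign e that makes e y z positive, satisfies W' = e (Q - q) y z and
W a >= 0 >= W b. *)
Lemma sturm_core (z0 : forall x, a < x < b -> z x != 0) :
  exists e W, [/\ e = 1 \/ e = -1, 0 <= W a, W b <= 0, W b = e * (dy b * z b) &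
   [/\ {within `[a, b], continuous W}, (forall x, a < x < b ->
    der W x (e * (Q x - q x) * (y x * z x))) &
    (forall x, a < x < b -> 0 < e * (y x * z x))]].
Proof.
have [e1 [he1 p1]] := const_sign ab (fun x h => der_cvg (hy (oc h))) y0.
have [e2 [he2 p2]] := const_sign ab (fun x h => der_cvg (hz (oc h))) z0.
have aab : a <= a <= b by rewrite lexx ltW.
have bab : a <= b <= b by rewrite lexx ltW.
have ce (k : R) : continuous (fun x : R => k * x).
  by move=> x; exact: (der_cvg (derZ k (der_id x))).
have da : 0 <= e1 * dy a.
  apply: (der_ge0_right ab (derZ e1 (hy aab))) => //; by rewrite ya mulr0.
have db : e1 * dy b <= 0.
  apply: (der_le0_left ab (derZ e1 (hy bab))) => //; by rewrite yb mulr0.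
have za : 0 <= e2 * z a.
  exact: (@cont_ge0_right (fun x => e2 * z x) _ _ ab (der_cvg (derZ e2 (hz aab)))).
have zb : 0 <= e2 * z b.
  exact: (@cont_ge0_left (fun x => e2 * z x) _ _ ab (der_cvg (derZ e2 (hz bab)))).
pose W x := e1 * e2 * (dy x * z x - y x * dz x).
have dW x : a <= x <= b -> der W x (e1 * e2 * (Q x - q x) * (y x * z x)).
  move=> h; have h1 := derZ (e1 * e2) (derB (derM (hdy h) (hz h)) (derM (hy h) (hdz h))).
  by apply: (is_derive_eq h1); ring.
exists (e1 * e2), W; split.
- by case: he1 => ->; case: he2 => ->; rewrite ?mulr1 ?mul1r ?mulrN1 ?opprK; auto.
- rewrite /W ya mul0r subr0 [X in 0 <= X](_ : _ = (e1 * dy a) * (e2 * z a)); last by ring.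
  exact: mulr_ge0.
- rewrite /W yb mul0r subr0 [X in X <= 0](_ : _ = (e1 * dy b) * (e2 * z b)); last by ring.
  exact: mulr_le0_ge0.
- by rewrite /W yb mul0r subr0.
split.
- apply: within_cont => x; rewrite inE/= in_itv/= => h; exact: der_cvg (dW _ h).
- by move=> x h; apply: dW; exact: oc.
- move=> x h; rewrite [X in 0 < X](_ : _ = (e1 * y x) * (e2 * z x)); last by ring.
  by rewrite mulr_gt0 ?p1 ?p2.
Qed.

(** W is nondecreasing with W a >= 0 >= W b, so W b = 0; but W b is
e y'(b) z(b), which is nonzero unless z b = 0. *)
Lemma sturm (qQ : forall x, a < x < b -> q x <= Q x) : dy b != 0 ->
  exists2 x, a < x <= b & z x = 0.
Proof.
move=> db; apply: contrapT => nz.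
have z0 x : a < x <= b -> z x != 0.
  by move=> h; apply/eqP => zx; apply: nz; exists x.
have [x /andP[ax xb]|e [W [he Wa Wb Wbe [cW dW p]]]] := sturm_core.
  by apply: z0; rewrite ax ltW.
have : W a <= W b.
  apply: (der_ge0_le (ltW ab) cW dW) => x h.
  rewrite -mulrA mulrCA; apply: mulr_ge0; last exact: ltW (p _ h).
  by rewrite subr_ge0 qQ.
move=> WW; have W0 : W b = 0 by apply/eqP; rewrite eq_le Wb (le_trans Wa WW).
have : e * (dy b * z b) != 0.
  rewrite !mulf_neq0// ?z0 ?ab ?lexx//.
  by case: he => ->; rewrite ?oppr_eq0 oner_eq0.
by rewrite -Wbe W0 eqxx.
Qed.

(** With a strict inequality W a < W b is already a contradiction, so the zero is
interior. *)
Lemma sturm_lt (qQ : forall x, a < x < b -> q x < Q x) :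
  exists2 x, a < x < b & z x = 0.
Proof.
apply: contrapT => nz.
have z0 x : a < x < b -> z x != 0.
  by move=> h; apply/eqP => zx; apply: nz; exists x.
have [//|e [W [he Wa Wb Wbe [cW dW p]]]] := sturm_core.
have : W a < W b.
  apply: (der_gt0_lt ab cW dW) => x h.
  by rewrite -mulrA mulrCA; apply: mulr_gt0; rewrite ?p// subr_gt0 qQ.
by move=> WW; have := lt_le_trans (le_lt_trans Wa WW) Wb; rewrite ltxx.
Qed.

End Comparison.
End Sturm.

(** * Zeros and their gaps *)
Section Zeros.
Context {R : realType}.
Context (m : R) (m_ge : 2^-1 <= m).
Implicit Types (x a b : R).

Let m0 : 0 < m. Proof. by apply: lt_le_trans m_ge; rewrite invr_gt0. Qed.

Definition pzero x := 0 < x /\ besG m x = 0.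

Definition consec a b := [/\ pzero a, pzero b, a < b &
  forall x, a < x < b -> besG m x != 0].

Lemma lin_der k a x : der (fun t => k * (t - a)) x k.
Proof.
by apply: (is_derive_eq (derZ k (derB (der_id x) (der_cst a x)))); rewrite subr0 mulr1.
Qed.

Lemma sinl_der k a x : der (fun t => sin (k * (t - a))) x (k * cos (k * (x - a))).
Proof.
apply: (is_derive_eq (@der_comp _ (@sin R) (fun t => k * (t - a)) x _ _
  (is_derive_sin _) (lin_der k a x))).
by rewrite mulrC.
Qed.

Lemma cosl_der k a x : der (fun t => k * cos (k * (t - a))) x (- (k ^+ 2) * sin (k * (x - a))).
Proof.
apply: (is_derive_eq (derZ k (@der_comp _ (@cos R) (fun t => k * (t - a)) x _ _
  (is_derive_cos _) (lin_der k a x)))).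
by ring.
Qed.

(** Comparison with sin (t - a), whose potential 1 dominates [besq]: the sine has
a zero in ]a, b]. *)
Lemma gap_ge_pi a b : consec a b -> pi <= b - a.
Proof.
move=> [[a0 Ga] [b0 Gb] ab nz].
have pos x : a <= x <= b -> 0 < x by move=> /andP[h _]; exact: lt_le_trans h.
have [|||||||||x] := @sturm R (besY m) (besY' m) (fun t => sin (1 * (t - a)))
  (fun t => 1 * cos (1 * (t - a))) (besq m) (fun=> 1) a b ab.
- by move=> x /pos x0; apply: besY_der.
- by move=> x /pos x0; exact: besY'_der.
- by move=> x _; apply: sinl_der.
- by move=> x _; apply: (is_derive_eq (cosl_der 1 a x)); rewrite expr1n.
- by apply/besY_eq0.
- by apply/besY_eq0.
- move=> x /andP[ax xb]; apply/eqP => /besY_eq0 h.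
  have := nz x; rewrite ax xb h ?eqxx//; last by apply: lt_trans ax.
  by move=> /(_ isT).
- by move=> x _; exact: besq_le1.
- exact: besY'_neq0.
move=> /andP[ax xb]; rewrite mul1r => s0.
rewrite leNgt; apply/negP => bpi.
have : 0 < sin (x - a).
  by apply: sin_gt0_pi; rewrite subr_gt0 ax /=; apply: le_lt_trans bpi; rewrite lerD2r.
by rewrite s0 ltxx.
Qed.

(** Comparison with sin (k (t - a)) as the more slowly oscillating function;
[besq] is nondecreasing, so the bound at [a] holds to the right of it. *)
Lemma zero_after a k : 0 < a -> 0 < k -> k ^+ 2 <= besq m a ->
  exists2 x, a < x <= a + pi / k & besG m x = 0.
Proof.
move=> a0 k0 kq.
have ab : a < a + pi / k by rewrite ltrDl divr_gt0// pi_gt0.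
have pos x : a <= x <= a + pi / k -> 0 < x by move=> /andP[h _]; exact: lt_le_trans h.
have kb : k * (a + pi / k - a) = pi by rewrite addrAC subrr add0r mulrC divfK// gt_eqF.
have [|||||||||x xab zx] := @sturm R (fun t => sin (k * (t - a)))
  (fun t => k * cos (k * (t - a))) (besY m) (besY' m) (fun=> k ^+ 2) (besq m) a _ ab.
- by move=> x _; apply: sinl_der.
- by move=> x _; exact: cosl_der.
- by move=> x /pos x0; apply: besY_der.
- by move=> x /pos x0; exact: besY'_der.
- by rewrite subrr mulr0 sin0.
- by rewrite kb sinpi.
- move=> x /andP[ax xb]; rewrite gt_eqF//; apply: sin_gt0_pi; apply/andP; split.
    by rewrite mulr_gt0// subr_gt0.
  by rewrite -kb ltr_pM2l// ltrD2r.
- by move=> x /andP[ax _]; apply: le_trans kq _; apply: besq_mono => //; exact: ltW.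
- by rewrite kb cospi mulrN1 oppr_eq0 gt_eqF.
exists x => //; apply/besY_eq0 => //.
by case/andP: xab => ax _; exact: lt_trans ax.
Qed.

Lemma shift_der (f : R -> R) (h x d : R) : der f (x + h) d -> der (fun t => f (t + h)) x d.
Proof.
move=> df; have hl : der (fun t : R => t + h) x (1 : R).
  by apply: (is_derive_eq (derD (der_id x) (der_cst h x))); rewrite addr0.
by apply: (is_derive_eq (@der_comp _ f (fun t => t + h) x _ _ df hl)); rewrite mulr1.
Qed.

(** The translate t |-> besY (t + (b - a)) has the larger potential, hence a zero
in ]a, b]. *)
Lemma gap_mono a b : consec a b -> exists2 x, b < x <= b + (b - a) & besG m x = 0.
Proof.
move=> [[a0 Ga] [b0 Gb] ab nz].
have pos x : a <= x <= b -> 0 < x by move=> /andP[h _]; exact: lt_le_trans h.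
have h0 : 0 < b - a by rewrite subr_gt0.
have [|||||||||x /andP[ax xb] zx] := @sturm R (besY m) (besY' m)
   (fun t => besY m (t + (b - a)))
  (fun t => besY' m (t + (b - a))) (besq m) (fun t => besq m (t + (b - a))) a b ab.
- by move=> x /pos x0; apply: besY_der.
- by move=> x /pos x0; exact: besY'_der.
- by move=> x /pos x0; apply: shift_der; apply: besY_der => //; rewrite addr_gt0.
- by move=> x /pos x0; apply: shift_der; apply: besY'_der => //; rewrite addr_gt0.
- by apply/besY_eq0.
- by apply/besY_eq0.
- move=> x /andP[ax xb]; apply/eqP => /besY_eq0 h.
  have := nz x; rewrite ax xb h ?eqxx//; last by apply: lt_trans ax.
  by move=> /(_ isT).
- move=> x /andP[ax _]; apply: besq_mono => //; first exact: lt_trans ax.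
  by rewrite lerDl ltW.
- exact: besY'_neq0.
exists (x + (b - a)); first by apply/andP; split; lra.
by apply/besY_eq0 => //; rewrite addr_gt0// (lt_trans a0).
Qed.

Lemma gap_mono_lt a b : 2^-1 < m -> consec a b ->
  exists2 x, b < x < b + (b - a) & besG m x = 0.
Proof.
move=> mm [[a0 Ga] [b0 Gb] ab nz].
have pos x : a <= x <= b -> 0 < x by move=> /andP[h _]; exact: lt_le_trans h.
have h0 : 0 < b - a by rewrite subr_gt0.
have [||||||||x /andP[ax xb] zx] := @sturm_lt R (besY m) (besY' m)
   (fun t => besY m (t + (b - a)))
  (fun t => besY' m (t + (b - a))) (besq m) (fun t => besq m (t + (b - a))) a b ab.
- by move=> x /pos x0; apply: besY_der.
- by move=> x /pos x0; exact: besY'_der.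
- by move=> x /pos x0; apply: shift_der; apply: besY_der => //; rewrite addr_gt0.
- by move=> x /pos x0; apply: shift_der; apply: besY'_der => //; rewrite addr_gt0.
- by apply/besY_eq0.
- by apply/besY_eq0.
- move=> x /andP[ax xb]; apply/eqP => /besY_eq0 h.
  have := nz x; rewrite ax xb h ?eqxx//; last by apply: lt_trans ax.
  by move=> /(_ isT).
- move=> x /andP[ax _]; apply: besq_mono_lt => //; first exact: lt_trans ax.
  by rewrite ltrDl.
exists (x + (b - a)); first by apply/andP; split; lra.
by apply/besY_eq0 => //; rewrite addr_gt0// (lt_trans a0).
Qed.

Lemma besq_ge a k : 0 < k -> k < 1 -> 0 < a -> m ^+ 2 / (1 - k) <= a ^+ 2 -> k <= besq m a.
Proof.
move=> k0 k1 a0 h; rewrite /besq lerBrDr addrC -lerBrDr.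
rewrite ler_pdivrMr ?exprn_gt0//.
have k2 : 0 < 1 - k by rewrite subr_gt0.
move: h; rewrite ler_pdivrMr// mulrC; lra.
Qed.

Lemma exists_zero_after a : 0 <= a -> exists2 x, a < x & besG m x = 0.
Proof.
have mp := m0; move=> a0; pose c := a + 2 * m + 1.
have c0 : 0 < c by rewrite /c; lra.
have [//||x /andP[cx _] zx] := @zero_after c 2^-1 c0.
- apply: besq_ge => //; first by lra.
  have -> : m ^+ 2 / (1 - 2^-1 ^+ 2) = m ^+ 2 * 4 / 3 by field.
  have h1 : 2 * m <= c by rewrite /c; lra.
  have h2 : (2 * m) ^+ 2 <= c ^+ 2 by rewrite lerXn2r ?nnegrE//; lra.
  have h3 := sqr_ge0 m; rewrite exprMn in h2; lra.
by exists x => //; apply: lt_trans cx; rewrite /c; lra.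
Qed.

(** The zeros are simple, so they do not accumulate. *)
Lemma no_zero_right a : 0 <= a -> exists2 r, 0 < r &
  forall x, a < x < a + r -> besG m x != 0.
Proof.
move=> a0; have [Ga|Ga] := eqVneq (besG m a) 0.
- have {}a0 : 0 < a.
    rewrite lt_neqAle a0 andbT; apply/eqP => ae; move: Ga.
    by rewrite -ae /besG expr0n /= mul0r hyp0 => /eqP; rewrite oner_eq0.
  have Ya : besY m a = 0 by apply/besY_eq0.
  have d0 := besY'_neq0 m_ge a0 Ga.
  have e0 : 0 < `|besY' m a| / 2 by rewrite divr_gt0// normr_gt0.
  have [r r0 hr] := derP (besY_der m_ge a0) e0.
  exists r => // x /andP[ax xr]; apply/eqP => Gx.
  have x0 : 0 < x by exact: lt_trans ax.
  have Yx : besY m x = 0 by apply/besY_eq0.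
  have := hr x; rewrite Ya Yx subrr sub0r normrN normrM.
  have xa : 0 < x - a by rewrite subr_gt0.
  rewrite (gtr0_norm xa) => /(_ _); rewrite ler_pM2r// => h.
  have {}h : `|besY' m a| <= `|besY' m a| / 2 by apply: h; lra.
  lra.
- have := @besG_cont _ m m_ge a.
  have n0 : 0 < `|besG m a| by rewrite normr_gt0.
  move/cvgrPdist_lt => /(_ _ n0) [r /= r0 hr]; exists r => // x /andP[ax xr].
  apply/eqP => Gx; have := hr x; rewrite /ball_ /= Gx subr0 ltxx => h.
  have //: false by apply: h; rewrite distrC gtr0_norm; lra.
Qed.

Lemma next_zero a : 0 <= a -> exists b, [/\ a < b, besG m b = 0 &
  forall x, a < x < b -> besG m x != 0].
Proof.
move=> a0; have [r r0 hr] := no_zero_right a0.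
have [c ac Gc] := exists_zero_after a0.
pose S := [set x | a < x /\ besG m x = 0].
have Sr x : S x -> a + r <= x.
  move=> [ax Gx]; rewrite leNgt; apply/negP => xr.
  by have := hr x; rewrite ax xr Gx eqxx => /(_ isT).
have S0 : S !=set0 by exists c.
have hS : has_inf S by split => //; exists (a + r).
have ri : a + r <= inf S by exact: lb_le_inf.
have ai : a < inf S by apply: lt_le_trans ri; rewrite ltrDl.
exists (inf S); split => //; last first.
  move=> x /andP[ax xi]; apply/eqP => Gx.
  have : inf S <= x by apply: ge_inf => //; exists (a + r).
  by rewrite leNgt xi.
apply/eqP; apply: contrapT => /negP Gi.
have := @besG_cont _ m m_ge (inf S).
have n0 : 0 < `|besG m (inf S)| by rewrite normr_gt0.
move/cvgrPdist_lt => /(_ _ n0) [e /= e0 he].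
have [x Sx xe] := inf_adherent e0 hS.
have ix : inf S <= x by apply: ge_inf => //; exists (a + r).
have := he x; rewrite /ball_ /=; case: Sx => _ ->; rewrite subr0 ltxx => h.
have //: false by apply: h; rewrite distrC ger0_norm; lra.
Qed.

(** Zeros are enumerated by iterating [next_zero] from 0; all are reached because
the gaps are at least pi. *)
Lemma exists_zeros : exists j : nat -> R, is_positive_zeros (besG m) j.
Proof.
have H a : exists b, 0 <= a -> [/\ a < b, besG m b = 0 &
    forall x, a < x < b -> besG m x != 0].
  by have [a0|a0] := leP 0 a; [have [b hb] := next_zero a0; exists b|exists 0].
have [nx hnx] := choice H.
pose j n := iter n.+1 nx 0.
have jS n : 0 < j n /\ besG m (j n) = 0.
  elim: n => [|n [jn Gn]].
    by have [] := hnx 0 (lexx 0).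
  have [h1 h2 _] := hnx (j n) (ltW jn); split; last exact: h2.
  exact: lt_trans h1.
have jlt n : j n < j n.+1.
  by have [jn _] := jS n; have [] := hnx (j n) (ltW jn).
have jcons n : consec (j n) (j n.+1).
  split; [exact: jS|exact: jS|exact: jlt|].
  by have [jn _] := jS n; have [] := hnx (j n) (ltW jn).
have jbig n : n%:R * pi <= j n.
  elim: n => [|n IH]; first by rewrite mul0r ltW//; case: (jS 0%N).
  have := gap_ge_pi (jcons n); rewrite -natr1; lra.
have inc : increasing_seq j by apply/increasing_seqP.
exists j; split => //; apply/seteqP; split => [_ [n _ <-]|t [t0 Gt]]; first exact: jS.
have ex : exists n, t <= j n.
  exists (Num.truncn (t / pi)).+1; apply: le_trans (jbig _).
  rewrite -ler_pdivrMr ?pi_gt0//; apply: ltW.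
  by case/andP: (truncn_itv (divr_ge0 (ltW t0) (ltW (pi_gt0 R)))).
have [n tn nmin] := ex_minnP ex.
exists n => //; apply/eqP; rewrite eq_le tn andbT leNgt; apply/negP => tjn.
case: n => [|n] in tn nmin tjn *.
  have [_ _ /(_ t)] := hnx 0 (lexx 0); rewrite t0 tjn Gt eqxx => /(_ isT) //.
have [_ _ _ /(_ t)] := jcons n; rewrite tjn Gt eqxx andbT => h.
have jt : t <= j n by rewrite leNgt; apply/negP => /h.
by have := nmin _ jt; rewrite ltnn.
Qed.

Context (j : nat -> R) (hj : is_positive_zeros (besG m) j).

Lemma zeros_pzero n : pzero (j n).
Proof. by have [_ e] := hj; have : range j (j n) by [exists n]; rewrite e. Qed.

Lemma zeros_lt k n : (j k < j n) = (k < n)%N.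
Proof. by have [i _] := hj; rewrite (leW_mono i). Qed.

Lemma zeros_surj t : pzero t -> exists n, j n = t.
Proof. by have [_ e] := hj => h; have : range j t by [rewrite e]; case=> n _ <-; exists n. Qed.

Lemma zeros_consec n : consec (j n) (j n.+1).
Proof.
split; [exact: zeros_pzero|exact: zeros_pzero|by rewrite zeros_lt|].
move=> x /andP[ax xb]; apply/eqP => Gx.
have [|k jk] := @zeros_surj x; first by split => //; apply: lt_trans ax; case: (zeros_pzero n).
by move: ax xb; rewrite -jk !zeros_lt ltnS => h1 h2; have := leq_trans h1 h2; rewrite ltnn.
Qed.

Lemma zeros_first x : 0 < x -> x < j 0 -> besG m x != 0.
Proof.
move=> x0 xj; apply/eqP => Gx; have [|k jk] := @zeros_surj x; first by [].
by move: xj; rewrite -jk zeros_lt.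
Qed.

Lemma zeros_next n x : besG m x = 0 -> j n < x -> j n.+1 <= x.
Proof.
move=> Gx nx; rewrite leNgt; apply/negP => xn.
by have [_ _ _ /(_ x)] := zeros_consec n; rewrite nx xn Gx eqxx => /(_ isT).
Qed.

Lemma zgap_ge_pi n : pi <= j n.+1 - j n.
Proof. exact: gap_ge_pi (zeros_consec n). Qed.

Lemma zgap_mono n : j n.+2 - j n.+1 <= j n.+1 - j n.
Proof.
have [x /andP[h1 h2] Gx] := gap_mono (zeros_consec n).
by have := zeros_next Gx h1; lra.
Qed.

Lemma zgap_mono_lt n : 2^-1 < m -> j n.+2 - j n.+1 < j n.+1 - j n.
Proof.
move=> mm; have [x /andP[h1 h2] Gx] := gap_mono_lt mm (zeros_consec n).
by have := zeros_next Gx h1; lra.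
Qed.

Lemma zeros_big n : n%:R * pi <= j n.
Proof.
elim: n => [|n IH]; first by rewrite mul0r ltW//; case: (zeros_pzero 0).
by have := zgap_ge_pi n; rewrite -natr1; lra.
Qed.

(** For k = pi / (pi + e) < 1 the potential exceeds k^2 far out, so [zero_after]
bounds the gap by pi / k = pi + e. *)
Lemma zgap_cvg : (fun n => j n.+1 - j n) @ \oo --> (pi : R).
Proof.
apply/cvgrPdist_le => e e0.
pose k := pi / (pi + e).
have pi0 := pi_gt0 R.
have k0 : 0 < k by rewrite /k divr_gt0// addr_gt0.
have pe : 0 < pi + e by exact: addr_gt0.
have k1 : k < 1 by rewrite /k (ltr_pdivrMr _ _ pe) mul1r ltrDl.
have kk : k ^+ 2 < 1 by rewrite expr_lt1// ltW.
pose N := (Num.truncn (m ^+ 2 / (1 - k ^+ 2) / pi)).+1.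
have k2 : 0 < 1 - k ^+ 2 by rewrite subr_gt0.
exists N.+1 => // n /= Nn.
have jn0 : 0 < j n by case: (zeros_pzero n).
have hN : m ^+ 2 / (1 - k ^+ 2) <= N%:R * pi.
  rewrite -ler_pdivrMr//; apply: ltW.
  have h : 0 <= m ^+ 2 / (1 - k ^+ 2) / pi.
    by rewrite divr_ge0// ?divr_ge0 ?sqr_ge0// ltW.
  by case/andP: (truncn_itv h).
have jn : m ^+ 2 / (1 - k ^+ 2) <= j n ^+ 2.
  have h1 : N%:R * pi <= n%:R * pi :> R by rewrite ler_wpM2r ?ler_nat ?ltW// (leq_trans _ Nn).
  have h2 := zeros_big n.
  have h3 : 1 <= j n.
    apply: le_trans h2; have h4 : 1 <= n%:R :> R by rewrite ler1n (leq_trans _ Nn).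
    have h5 : 2 <= pi :> R by exact: pi_ge2.
    by rewrite -[1]mulr1 ler_pM//; lra.
  have h4 : j n <= j n ^+ 2 by rewrite expr2 ler_pMr.
  lra.
have [x /andP[h1 h2] Gx] := zero_after jn0 k0 (besq_ge (exprn_gt0 2 k0) kk jn0 jn).
have h3 := zeros_next Gx h1; have h4 := zgap_ge_pi n.
have -> : pi - (j n.+1 - j n) = - (j n.+1 - j n - pi) by ring.
rewrite normrN ger0_norm ?subr_ge0//.
have : pi / k = pi + e by rewrite /k invf_div mulrCA divff ?mulr1// gt_eqF.
lra.
Qed.

End Zeros.

(** * The Gamma function *)
Section GammaFunction.
Context {R : realType}.
Local Notation mu := (@lebesgue_measure R).
Implicit Types (s t : R).

Let h s t : R := t `^ (s - 1) * expR (- t).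
(** The integral over ]0, +oo[ is the increasing limit of the integrals over the
intervals K n, where the integrand is continuous. *)
Let K (n : nat) : set R := `]n.+1%:R^-1, n.+1%:R[.

Let der_expN t : der (fun t => expR (- t)) t (- expR (- t)).
Proof.
apply: (is_derive_eq (@der_comp _ (@expR R) (fun t => - t) t _ _ (is_derive_expR _) (derN (der_id t)))).
by rewrite mulrN1.
Qed.

Let h_cont s t : 0 < t -> {for t, continuous (h s)}.
Proof. by move=> t0; apply: (der_cvg (derM (der_powR _ t0) (der_expN t))). Qed.

Let h_ge0 s t : 0 <= h s t.
Proof. by rewrite mulr_ge0 ?powR_ge0 ?expR_ge0. Qed.

Let h_within s a b : 0 < a -> {within `[a, b], continuous (h s)}.
Proof.
move=> a0; apply: within_cont => x; rewrite inE/= in_itv/= => /andP[ax _].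
by apply: h_cont; exact: lt_le_trans ax.
Qed.

Let h_int s a b : 0 < a -> mu.-integrable `]a, b[ (EFin \o h s).
Proof.
move=> a0; apply: integrableS (cont_integrable (@h_within s a b a0)) => //.
exact: subset_itv_oo_cc.
Qed.

Let K_int s n : mu.-integrable (K n) (EFin \o h s).
Proof. by apply: h_int; rewrite invr_gt0. Qed.

Let K_mono : nondecreasing_seq K.
Proof.
move=> i j ij; apply/subsetPset => x; rewrite /K /= !in_itv/= => /andP[h1 h2].
rewrite (le_lt_trans _ h1) ?(lt_le_trans h2) ?ler_nat//.
by rewrite lef_pV2 ?posrE// ler_nat.
Qed.

Let K_bigcup : \bigcup_n K n = `]0, +oo[%classic.
Proof.
apply/seteqP; split => [x [n _]|x].
  by rewrite /K /= !in_itv/= andbT => /andP[h1 _]; apply: lt_trans h1; rewrite invr_gt0.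
rewrite /= in_itv/= andbT => x0.
pose n := maxn (Num.truncn x) (Num.truncn x^-1); exists n => //.
rewrite /K /= in_itv/=; apply/andP; split.
  rewrite -[x]invrK ltf_pV2 ?posrE ?invr_gt0//.
  have xi : 0 < x^-1 by rewrite invr_gt0.
  have /andP[_ xt] := truncn_itv (ltW xi).
  apply: lt_le_trans xt _.
  by rewrite ler_nat ltnS leq_maxr.
have /andP[_ xt] := truncn_itv (ltW x0).
by apply: lt_le_trans xt _; rewrite ler_nat ltnS leq_maxl.
Qed.

Let GammaE s : \bar R := (\int[mu]_(t in `]0%R, +oo[) (h s t)%:E)%E.

Let Gamma_cvg s : (\int[mu]_(t in K n) (h s t)%:E)%E @[n --> \oo] --> GammaE s.
Proof.
rewrite /GammaE -K_bigcup; apply: ge0_nondecreasing_set_cvg_integral => //.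
- by move=> i; exact: measurable_itv.
- by move=> i; exact: (measurable_int mu (K_int s i)).
- by move=> i x _; rewrite lee_fin.
Qed.

Let K_fin s n : (\int[mu]_(t in K n) (h s t)%:E)%E = (\int[mu]_(t in K n) h s t)%:E.
Proof.
rewrite /Rintegral fineK// integrable_fin_num//; first exact: measurable_itv.
exact: K_int.
Qed.

(** The boundary term t^s e^(-t) of the integration by parts. *)
Let B s t : R := t `^ s * expR (- t).

Let B_der s t : 0 < t -> der (B s) t (s * h s t - h (s + 1) t).
Proof.
move=> t0; apply: (is_derive_eq (derM (der_powR s t0) (der_expN t))).
by rewrite /h addrK mulrN mulrA.
Qed.

Let B_lim_inf s : B s n.+1%:R @[n --> \oo] --> 0.
Proof.
pose N := (Num.truncn `|s|).+1.
have sN : s <= N%:R.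
  by apply: le_trans (ler_norm s) _; apply: ltW; case/andP: (truncn_itv (normr_ge0 s)).
apply: (@squeeze_cvgr _ _ _ _ (fun=> 0) (fun n => N.+1`!%:R * n.+1%:R^-1)).
- near=> n; rewrite mulr_ge0 ?powR_ge0 ?expR_ge0//=.
  have n1 : 1 <= n.+1%:R :> R by rewrite ler1n.
  have n0 : 0 < n.+1%:R :> R by [].
  apply: (@le_trans _ _ (n.+1%:R ^+ N * expR (- n.+1%:R))).
    rewrite ler_wpM2r ?expR_ge0// -powR_mulrn//; exact: ler_powR.
  rewrite expRN ler_pdivrMr ?expR_gt0//.
  apply: (@le_trans _ _ (N.+1`!%:R / n.+1%:R * (n.+1%:R ^+ N.+1 / N.+1`!%:R))).
    rewrite exprS [leRHS](_ : _ = n.+1%:R ^+ N)//.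
    have F0 : N.+1`!%:R != 0 :> R by rewrite pnatr_eq0 -lt0n fact_gt0.
    have a0 := lt0r_neq0 n0; move: F0 a0.
    by move: (N.+1`!%:R) (n.+1%:R : R) => F a F0 a0; field; rewrite F0 a0.
  rewrite ler_wpM2l ?divr_ge0//.
  by apply: le_trans (expR_ge1Dxn N (ltW n0)); rewrite lerDr.
- exact: cvg_cst.
- rewrite -(mulr0 N.+1`!%:R); apply: cvgM; [exact: cvg_cst|exact: cvg_harmonic].
Unshelve. all: by end_near. Qed.

Let B_lim_0 s : 0 < s -> B s n.+1%:R^-1 @[n --> \oo] --> 0.
Proof.
move=> s0.
have h1 : (n.+1%:R^-1 : R) `^ s @[n --> \oo] --> 0.
  have := powR_cvg0 s0; move/cvg_at_rightP; apply; split => //.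
  exact: cvg_harmonic.
apply: (@squeeze_cvgr _ _ _ _ (fun=> 0) (fun n => n.+1%:R^-1 `^ s)) => //; last exact: cvg_cst.
near=> n; rewrite mulr_ge0 ?powR_ge0 ?expR_ge0//=.
by rewrite ler_piMr ?powR_ge0// -expR0 ler_expR oppr_le0 invr_ge0.
Unshelve. all: by end_near. Qed.

(** Integration by parts on K n, in the extended reals since the limit could a
priori be infinite. *)
Let GammaE_rec s : 0 < s -> GammaE (s + 1) = (s%:E * GammaE s)%E.
Proof.
move=> s0.
have e n : (\int[mu]_(t in K n) (h (s + 1) t)%:E +
   (B s n.+1%:R - B s n.+1%:R^-1)%:E = s%:E * \int[mu]_(t in K n) (h s t)%:E)%E.
  rewrite !K_fin -EFinD -EFinM; congr EFin.
  have n0 : 0 < n.+1%:R^-1 :> R by rewrite invr_gt0.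
  have nn : n.+1%:R^-1 <= n.+1%:R :> R by rewrite (@le_trans _ _ 1)// ?invf_le1 ?ler1n.
  have ci : {within `[n.+1%:R^-1, n.+1%:R], continuous (fun t => s * h s t - h (s + 1) t)}.
    apply: within_cont => x; rewrite inE/= in_itv/= => /andP[nx _].
    have x0 := lt_le_trans n0 nx.
    apply: cvgB; last exact: h_cont.
    by apply: cvgM; [exact: cvg_cst|exact: h_cont].
  have cB : {within `[n.+1%:R^-1, n.+1%:R], continuous (B s)}.
    apply: within_cont => x; rewrite inE/= in_itv/= => /andP[nx _].
    exact: (der_cvg (B_der s (lt_le_trans n0 nx))).
  have dB (x : R) : n.+1%:R^-1 < x < n.+1%:R -> der (B s) x (s * h s x - h (s + 1) x).
    by move=> /andP[nx _]; apply: B_der; exact: lt_trans nx.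
  rewrite -(FTC nn ci cB dB) RintegralB//; [| |exact: K_int].
    rewrite addrCA subrr addr0 RintegralZl//; exact: K_int.
  have csh : {within `[n.+1%:R^-1, n.+1%:R], continuous (fun t => s * h s t)}.
    apply: within_cont => x; rewrite inE/= in_itv/= => /andP[nx _].
    by apply: cvgM; [exact: cvg_cst|exact: h_cont (lt_le_trans n0 nx)].
  by apply: integrableS (cont_integrable csh) => //; exact: subset_itv_oo_cc.
have c1 : (\int[mu]_(t in K n) (h (s + 1) t)%:E +
   (B s n.+1%:R - B s n.+1%:R^-1)%:E)%E @[n --> \oo] --> (GammaE (s + 1) + 0%:E)%E.
  apply: cvgeD; [by rewrite fin_num_adde_defl|exact: Gamma_cvg|].
  apply/cvg_EFin; first by near=> n.
  rewrite -[X in _ --> X](subr0 0); apply: cvgB; [exact: B_lim_inf|exact: B_lim_0].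
have c2 : (s%:E * \int[mu]_(t in K n) (h s t)%:E)%E @[n --> \oo] --> (s%:E * GammaE s)%E.
  by apply: cvgeZl => //; exact: Gamma_cvg.
rewrite adde0 in c1; apply: (cvg_unique _ c1) => //.
by rewrite /= (eq_cvg _ _ e).
Unshelve. all: by end_near. Qed.

Lemma Gamma_rec s : 0 < s -> Gamma (s + 1) = s * Gamma s.
Proof.
move=> s0; rewrite /Gamma /Rintegral -/(GammaE (s + 1)) -/(GammaE s) GammaE_rec//.
have : (0 <= GammaE s)%E by apply: integral_ge0 => t _; rewrite lee_fin.
case: (GammaE s) => [r||] _ //=; by rewrite gt0_muley ?lte_fin// mulr0.
Qed.

(** The real integral is 0 if the extended one is infinite, so finiteness has to
be shown. Since (1 + t^s)^2 <= (2 + t)^2 <= 4 e^t, the integrand is at most the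
derivative of b t = - (4/s) / (1 + t^s), which takes values in [-4/s, 0]. *)
Lemma Gamma_gt0 s : 0 < s -> s <= 1 -> 0 < Gamma s.
Proof.
move=> s0 s1.
pose b (t : R) : R := - (4 / s) / (1 + t `^ s).
have ts t : 0 < 1 + t `^ s by rewrite ltr_pwDl// powR_ge0.
pose b' (t : R) : R := 4 * t `^ (s - 1) / (1 + t `^ s) ^+ 2.
have db (t : R) : 0 < t -> der b t (b' t).
  move=> t0; have hv := @derV _ (fun t => 1 + t `^ s) t _ (lt0r_neq0 (ts t))
    (derD (der_cst 1 t) (der_powR s t0)).
  apply: (is_derive_eq (derZ (- (4 / s)) hv)); rewrite /b'.
  by field; rewrite (gt_eqF s0) (gt_eqF (ts t)).
have hb t : 0 < t -> h s t <= b' t.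
  move=> t0; rewrite /h /b' mulrC [leRHS]mulrAC ler_wpM2r ?powR_ge0//.
  rewrite expRN ler_pdivlMr ?exprn_gt0// mulrC ler_pdivrMr ?expR_gt0//.
  have p1 : t `^ s <= 1 + t.
    have [t1|t1] := leP 1 t; first by apply: le_trans (ler1_powR t1 s1) _; rewrite lerDr.
    apply: (@le_trans _ _ 1); last by rewrite lerDl ltW.
    have <- : 1 `^ s = 1 :> R by rewrite powR1.
    by apply: ge0_ler_powR; rewrite ?nnegrE//; exact: ltW.
  apply: (@le_trans _ _ ((2 + t) ^+ 2)).
    rewrite lerXn2r ?nnegrE//; [exact: ltW (ts t)|lra|lra].
  have := expR_ge1Dxn 1 (ltW t0).
  have := expR_ge1Dx (t / 2).
  have := expR_ge1Dx t.
  have -> : expR t = expR (t / 2) ^+ 2 by rewrite -expRM_natl; congr expR; field.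
  move=> _ e1 _.
  have e2 : (1 + t / 2) ^+ 2 <= expR (t / 2) ^+ 2.
    by rewrite lerXn2r ?nnegrE ?expR_ge0// addr_ge0// divr_ge0// ltW.
  have -> : (2 + t) ^+ 2 = 4 * (1 + t / 2) ^+ 2 by field.
  lra.
have bK n : (\int[mu]_(t in K n) h s t) <= 4 / s.
  have n0 : 0 < n.+1%:R^-1 :> R by rewrite invr_gt0.
  have nn : n.+1%:R^-1 <= n.+1%:R :> R by rewrite (@le_trans _ _ 1)// ?invf_le1 ?ler1n.
  have cb' : {within `[n.+1%:R^-1, n.+1%:R], continuous b'}.
    apply: within_cont => x; rewrite inE/= in_itv/= => /andP[nx _].
    have x0 := lt_le_trans n0 nx.
    apply: cvgM.
      apply: cvgM; [exact: cvg_cst|exact: (der_cvg (der_powR (s - 1) x0))].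
    apply: cvgV; first by rewrite expf_neq0// lt0r_neq0.
    exact: (der_cvg (derX 2 (derD (der_cst 1 x) (der_powR s x0)))).
  apply: (@le_trans _ _ (\int[mu]_(t in K n) b' t)).
    apply: le_Rintegral; [exact: measurable_itv|exact: K_int| |].
      rewrite /K; apply: integrableS (cont_integrable cb') => //.
      exact: subset_itv_oo_cc.
    by move=> x; rewrite /K /= in_itv/= => /andP[nx _]; apply: hb; exact: lt_trans nx.
  have cb : {within `[n.+1%:R^-1, n.+1%:R], continuous b}.
    apply: within_cont => x; rewrite inE/= in_itv/= => /andP[nx _].
    exact: (der_cvg (db _ (lt_le_trans n0 nx))).
  have dbx (x : R) : n.+1%:R^-1 < x < n.+1%:R -> der b x (b' x).
    by move=> /andP[nx _]; apply: db; exact: lt_trans nx.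
  rewrite (FTC nn cb' cb dbx).
  have p1 : 0 <= (4 / s) / (1 + n.+1%:R `^ s) by rewrite divr_ge0 ?divr_ge0 ?(ltW (ts _))// ltW.
  have p2 : (4 / s) / (1 + n.+1%:R^-1 `^ s) <= 4 / s.
    rewrite ler_pdivrMr// ler_peMr ?divr_ge0 ?(ltW s0)//.
    by rewrite lerDl powR_ge0.
  rewrite /b !mulNr; lra.
have GE : (GammaE s <= (4 / s)%:E)%E.
  apply: (cvge_to_le (@Gamma_cvg s)).
  by near=> n; rewrite K_fin lee_fin.
have G0 : (0 < GammaE s)%E.
  apply: (@lt_le_trans _ _ (\int[mu]_(t in `]1%R, 2%R[) (h s t)%:E)%E).
    have i12 := @h_int s 1 2 ltr01.
    rewrite -[X in (_ < X)%E]fineK ?integrable_fin_num// lte_fin -/(Rintegral _ _ _).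
    have c12 : {within `[1 : R, 2], continuous (fun=> 2^-1 * expR (- 2) : R)}.
      by apply: within_cont => x _; exact: cvg_cst.
    apply: (@lt_le_trans _ _ (\int[mu]_(t in `]1%R, 2%R[) (2^-1 * expR (- 2)))).
      pose F (t : R) : R := 2^-1 * expR (- 2) * t.
      have dF (x : R) : 1 < x < 2 -> der F x (2^-1 * expR (- 2)).
        by move=> _; apply: (is_derive_eq (derZ _ (der_id x))); rewrite mulr1.
      have cF : {within `[1 : R, 2], continuous F}.
        by apply: within_cont => x _; exact: (der_cvg (derZ _ (der_id x))).
      have l12 : 1 <= 2 :> R by lra.
      rewrite (FTC l12 c12 cF dF) /F -mulrBr mulr_gt0 ?mulr_gt0 ?expR_gt0 ?invr_gt0//; lra.
    apply: le_Rintegral => //.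
      apply: integrableS (cont_integrable c12) => //; exact: subset_itv_oo_cc.
    move=> x; rewrite /= in_itv/= => /andP[x1 x2].
    have x0 : 0 < x by exact: lt_trans x1.
    apply: ler_pM; rewrite ?invr_ge0 ?expR_ge0//; last by rewrite ler_expR lerN2 ltW.
    apply: (@le_trans _ _ (x `^ (-1))); last by apply: ler_powR; [exact: ltW|lra].
    by rewrite powR_inv1 ?(ltW x0)// lef_pV2 ?posrE// ltW.
  apply: ge0_subset_integral => //.
  - rewrite -K_bigcup; apply/measurable_fun_bigcup.
      by move=> n; exact: measurable_itv.
    by move=> n; exact: (measurable_int mu (K_int s n)).
  - by move=> x _; rewrite lee_fin.
  - by move=> x; rewrite /= !in_itv/= andbT => /andP[x1 _]; exact: lt_trans x1.
rewrite /Gamma /Rintegral -/(GammaE s) fine_gt0// G0 /=.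
by apply: le_lt_trans GE _; exact: ltry.
Unshelve. all: by end_near. Qed.

Lemma Gamma_poch (a : R) (m : nat) : 0 < a -> Gamma (m%:R + a) = poch a m * Gamma a.
Proof.
move=> a0; elim: m => [|m IH]; first by rewrite poch0 mul1r add0r.
have am : 0 < m%:R + a by rewrite ltr_wpDl.
have -> : m.+1%:R + a = m%:R + a + 1 by rewrite -natr1 addrAC.
by rewrite (Gamma_rec am) IH pochS (addrC a) mulrCA mulrA.
Qed.

End GammaFunction.

(** * Bessel functions *)
Section BesselFunctions.
Context {R : realType}.

Lemma besselJ_hyp (p y : R) : 0 < p + 1 -> 0 < y ->
  besselJ p y = (y / 2) `^ p / Gamma (p + 1) * hyp (p + 1) (y ^+ 2 / 4).
Proof.
move=> p1 y0; rewrite /besselJ.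
have y2 : 0 < y / 2 by rewrite divr_gt0.
have -> : (fun m => (-1) ^+ m / (m`!%:R * Gamma (m%:R + p + 1)) * (y / 2) `^ (2 * m%:R + p)) =
  (fun m => (y / 2) `^ p / Gamma (p + 1) * (hcoef (p + 1) m * (y ^+ 2 / 4) ^+ m)).
  apply/funext => m; rewrite -addrA Gamma_poch// /hcoef.
  rewrite powRD; last by rewrite (gt_eqF y2) implybT.
  have -> : (y / 2) `^ (2 * m%:R) = (y ^+ 2 / 4) ^+ m.
    rewrite powRrM powR_mulrn ?powR_ge0//; congr (_ ^+ m).
    by rewrite powR_mulrn ?ltW// expr_div_n; congr (_ / _); rewrite -natrX.
  rewrite !invfM; ring.
rewrite -[X in limn X](_ : (fun n => (y / 2) `^ p / Gamma (p + 1) *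
    pseries (hcoef (p + 1)) (y ^+ 2 / 4) n) = _); last first.
  by apply/funext => n; rewrite /pseries /series /= mulr_sumr.
apply/cvg_lim => //; apply: cvgM; [exact: cvg_cst|exact: hyp_cvg].
Qed.

Context (alpha : R) (halpha : 0 <= alpha < 1).

(** The order 1 - nu_alpha of the Bessel function that gives the eigenvalues. *)
Definition ord : R := (2 - alpha)^-1.
Local Notation m := ord.

Let a0 : 0 <= alpha. Proof. by case/andP: halpha. Qed.
Let a1 : alpha < 1. Proof. by case/andP: halpha. Qed.
Let a2 : 0 < 2 - alpha. Proof. by have := a1; lra. Qed.

Lemma ord_ge : 2^-1 <= m.
Proof. by rewrite /ord lef_pV2 ?posrE//; have := a0; lra. Qed.

Lemma ord_gt : 0 < alpha -> 2^-1 < m.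
Proof. by move=> h; rewrite /ord ltf_pV2 ?posrE//; lra. Qed.

Lemma ord_gt0 : 0 < m. Proof. by rewrite invr_gt0. Qed.

Lemma ord_le1 : m <= 1.
Proof. by rewrite /ord invf_le1//; have := a1; lra. Qed.

Lemma nu_ord : - nu alpha + 1 = m.
Proof. by rewrite /nu /ord; field; rewrite gt_eqF. Qed.

Lemma Gamma_ord_gt0 : 0 < Gamma m.
Proof. exact: Gamma_gt0 ord_gt0 ord_le1. Qed.

Lemma zeros_besselJ j :
  is_positive_zeros (besselJ (- nu alpha + 1)) j <-> is_positive_zeros (besG m) j.
Proof.
rewrite /is_positive_zeros.
suff -> : [set y | 0 < y /\ besselJ (- nu alpha + 1) y = 0] = [set y | 0 < y /\ besG m y = 0] by [].
apply/seteqP; split => y /= [y0 h]; split => //; move: h; rewrite nu_ord besselJ_hyp//;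
  rewrite -/(besG m y) ?addr_gt0 ?ord_gt0//.
  move/eqP; rewrite !mulf_eq0 gt_eqF ?powR_gt0 ?divr_gt0//= invr_eq0.
  by rewrite Gamma_rec ?ord_gt0// gt_eqF ?mulr_gt0 ?ord_gt0 ?Gamma_ord_gt0//= => /eqP.
by move=> ->; rewrite mulr0.
Qed.

Lemma jzero_zeros : is_positive_zeros (besG m) (fun n => jzero alpha n.+1).
Proof.
rewrite -zeros_besselJ /jzero /positive_zeros /=.
have [j hj] := exists_zeros ord_ge.
have : [set j | is_positive_zeros (besselJ (- nu alpha + 1)) j] j by apply/zeros_besselJ.
by move=> hj'; apply: (@xgetPex _ (cst 0) [set j | is_positive_zeros (besselJ (- nu alpha + 1)) j]); exists j.
Qed.

End BesselFunctions.

(** * Regular solutions of the degenerate equation *)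
Section RadialSolutions.
Context {R : realType} (alpha : R) (halpha : 0 <= alpha < 1).
Local Notation m := (ord alpha).
Implicit Types (lam x : R).

Let a0 : 0 <= alpha. Proof. by case/andP: halpha. Qed.
Let a1 : alpha < 1. Proof. by case/andP: halpha. Qed.
Let a2 : 0 < 2 - alpha. Proof. by have := a1; lra. Qed.
Let m0 : 0 < m := ord_gt0 halpha.
Let m1 : 0 < m + 1. Proof. by rewrite addr_gt0. Qed.
Let mE : m * (2 - alpha) = 1. Proof. by rewrite mulVf// gt_eqF. Qed.

(** The regular solution [ef] of the equation, normalized by the value 1 at 0,
its flux [ew] = x^alpha ef' and its derivative [ed]. The absolute value makes
them continuous on the whole line, which avoids one-sided limits at 0. *)
Definition es lam x : R := lam * m ^+ 2 * `|x| `^ (2 - alpha).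
Definition ef lam x : R := hyp m (es lam x).
Definition eg lam x : R := hyp (m + 1) (es lam x).
Definition ew lam x : R := - lam * x * eg lam x.
Definition ed lam x : R := - lam * `|x| `^ (1 - alpha) * eg lam x.

Lemma norm_powR_cont p : 0 < p -> continuous (fun x : R => `|x| `^ p).
Proof.
move=> p0 x; have [x0|x0] := eqVneq x 0.
  rewrite {}x0; apply/cvgrPdist_lt => e e0; rewrite normr0 powR0 ?gt_eqF//.
  have ep : 0 < e `^ p^-1 by rewrite powR_gt0.
  exists (e `^ p^-1) => //= t; rewrite /ball_ /= !sub0r !normrN => te.
  rewrite ger0_norm ?powR_ge0//.
  have -> : e = (e `^ p^-1) `^ p by rewrite -powRrM mulVf ?gt_eqF// powRr1// ltW.
  by apply: gt0_ltr_powR; rewrite ?nnegrE ?powR_ge0.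
apply: (@cvg_comp _ _ _ (fun t : R => `|t|) (fun t => t `^ p) _ (nbhs `|x|)).
  exact: norm_continuous.
by apply: der_cvg (der_powR p _); rewrite normr_gt0.
Qed.

Lemma es_cont lam : continuous (es lam).
Proof.
by move=> x; apply: cvgM; [exact: cvg_cst|apply: norm_powR_cont].
Qed.

Lemma ef_cont lam : continuous (ef lam).
Proof.
move=> x; apply: (@cvg_comp _ _ _ (es lam) (hyp m) _ (nbhs (es lam x))).
  exact: es_cont.
exact: hyp_cont.
Qed.

Lemma eg_cont lam : continuous (eg lam).
Proof.
move=> x; apply: (@cvg_comp _ _ _ (es lam) (hyp (m + 1)) _ (nbhs (es lam x))).
  exact: es_cont.
exact: hyp_cont.
Qed.

Lemma ew_cont lam : continuous (ew lam).
Proof.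
move=> x; apply: cvgM; last exact: eg_cont.
by apply: cvgM; [exact: cvg_cst|exact: cvg_id].
Qed.

Lemma ed_cont lam : continuous (ed lam).
Proof.
move=> x; apply: cvgM; last exact: eg_cont.
by apply: cvgM; [exact: cvg_cst|apply: norm_powR_cont; rewrite subr_gt0].
Qed.

Lemma es_der lam x : 0 < x -> der (es lam) x (lam * m * x `^ (1 - alpha)).
Proof.
move=> x0; apply: (@der_near _ (fun x => lam * m ^+ 2 * x `^ (2 - alpha))).
  near=> y; rewrite /es gtr0_norm//; near: y; exact: lt_nbhsr.
apply: (is_derive_eq (derZ _ (der_powR (2 - alpha) x0))).
have -> : 2 - alpha - 1 = 1 - alpha by ring.
rewrite mulrA -(mulrA lam) expr2 -(mulrA m) -/m mE mulr1 //.
Unshelve. all: by end_near. Qed.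

Lemma ef_der lam x : 0 < x -> der (ef lam) x (ed lam x).
Proof.
move=> x0; have h := @der_comp _ (hyp m) (es lam) x _ _ (hyp_der _ m0) (es_der lam x0).
apply: (is_derive_eq h); rewrite /ed /eg gtr0_norm//.
by field; rewrite gt_eqF.
Qed.

Lemma ew_der lam x : 0 < x -> der (ew lam) x (- lam * ef lam x).
Proof.
move=> x0; have h := @der_comp _ (hyp (m + 1)) (es lam) x _ _ (hyp_der _ m1) (es_der lam x0).
have h2 := derM (derZ (- lam) (der_id x)) h.
apply: (is_derive_eq h2); rewrite mulr1 -/(eg lam x).
have -> : ef lam x = eg lam x - es lam x / (m * (m + 1)) * hyp (m + 1 + 1) (es lam x).
  by have := hyp_contig (es lam x) m0; rewrite -/(ef lam x) -/(eg lam x) mulNr mulNr => <-; ring.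
have -> : es lam x = lam * m ^+ 2 * (x `^ (1 - alpha) * x).
  rewrite /es gtr0_norm// (powR_subr1 _ x0); congr (_ * (_ `^ _ * _)); ring.
by field; rewrite !gt_eqF.
Qed.

(** The chain rule does not reach 0, but the difference quotient of [ew] there
is -lam eg, which is continuous. *)
Lemma ew_der0 lam : der (ew lam) (0 : R) (- lam * ef lam 0).
Proof.
have e0 : ef lam 0 = eg lam 0.
  by rewrite /ef /eg /es normr0 powR0 ?gt_eqF// mulr0 !hyp0.
rewrite e0.
have H : h^-1 *: ((ew lam \o shift (0 : R)) (h *: (1 : R)) - ew lam 0) @[h --> (0 : R)^'] --> - lam * eg lam 0.
  apply: (@cvg_trans _ ((- lam * eg lam h) @[h --> 0^'])).
    apply: near_eq_cvg; near=> h; rewrite /GRing.scale /= addr0 mulr1 /ew mulr0 mul0r subr0.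
    have h0 : h != 0 by near: h; exact: nbhs_dnbhs_neq.
    by rewrite !mulrA -mulrA; field.
  apply: cvgM; first exact: cvg_cst.
  by apply: cvg_within_filter; exact: eg_cont.
by split; [apply/cvg_ex; eexists; exact: H|exact/cvg_lim].
Unshelve. all: by end_near. Qed.

Lemma ed_ew lam x : 0 <= x -> x `^ alpha * ed lam x = ew lam x.
Proof.
rewrite le_eqVlt => /predU1P[<-|x0].
  have e0 : 0 `^ (1 - alpha) = 0 :> R by rewrite powR0// subr_eq0 gt_eqF.
  by rewrite /ed /ew normr0 e0 !(mulr0, mul0r).
rewrite /ed /ew gtr0_norm// mulrA mulrCA -powRD ?(gt_eqF x0) ?implybT//.
by rewrite addrC subrK powRr1 ?ltW.
Qed.

Lemma ef0 lam : ef lam 0 = 1.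
Proof. by rewrite /ef /es normr0 powR0 ?gt_eqF// mulr0 hyp0. Qed.

Lemma ef_lam0 x : ef 0 x = 1.
Proof. by rewrite /ef /es mul0r mul0r hyp0. Qed.

Lemma lambda_gt0 n : 0 < lambda alpha n.+1.
Proof.
have [j0 _] := zeros_pzero (jzero_zeros halpha) n.
by rewrite /lambda mulr_gt0 ?exprn_gt0// /kappa divr_gt0.
Qed.

Lemma es_lambda n x : es (lambda alpha n.+1) x =
  (jzero alpha n.+1 * `|x| `^ kappa alpha) ^+ 2 / 4.
Proof.
rewrite /es /lambda [(jzero _ _ * _) ^+ 2]exprMn -(powR_mulrn 2 (powR_ge0 `|x| (kappa alpha))) -powRrM.
have -> : kappa alpha * 2%:R = 2 - alpha by rewrite /kappa; field.
rewrite /kappa; have e : m = (2 - alpha)^-1 by [].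
by rewrite e; field; rewrite gt_eqF.
Qed.

Definition phi_const n : R := (jzero alpha n.+1 / 2) `^ (- nu alpha) / Gamma m.

Lemma phi_const_gt0 n : 0 < phi_const n.
Proof.
have [j0 _] := zeros_pzero (jzero_zeros halpha) n.
by rewrite divr_gt0 ?(Gamma_ord_gt0 halpha)// powR_gt0// divr_gt0.
Qed.

(** The power x^((1-alpha)/2) cancels the factor x^(-kappa nu) of the Bessel
function, because kappa nu = (1 - alpha) / 2. *)
Lemma phi_ef n x : 0 < x -> phi alpha n.+1 x = phi_const n * ef (lambda alpha n.+1) x.
Proof.
move=> x0; have [j0 _] := zeros_pzero (jzero_zeros halpha) n.
have xk : 0 < x `^ ((2 - alpha) / 2) by exact: powR_gt0.
rewrite /phi besselJ_hyp ?nu_ord ?mulr_gt0//.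
rewrite /ef es_lambda gtr0_norm// -/(kappa alpha) mulrA; congr (_ * _).
have -> : jzero alpha n.+1 * x `^ kappa alpha / 2 = jzero alpha n.+1 / 2 * x `^ kappa alpha.
  by rewrite mulrAC.
rewrite powRM ?powR_ge0 ?divr_ge0 ?ltW// -[(x `^ _) `^ _]powRrM.
have -> : kappa alpha * - nu alpha = - ((1 - alpha) / 2).
  by rewrite /kappa /nu; field; rewrite gt_eqF.
rewrite [x `^ (- _)]powRN /phi_const; field.
by rewrite !gt_eqF ?powR_gt0 ?(Gamma_ord_gt0 halpha).
Qed.

End RadialSolutions.

(** * Absolute continuity *)
Section AbsoluteContinuity.
Context {R : realType}.
Local Notation mu := (@lebesgue_measure R).
Implicit Types (v : R -> R) (a b c x : R).

Lemma abs_continuousS v a b c d : a <= c -> d <= b ->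
  abs_continuous a b v -> abs_continuous c d v.
Proof.
move=> ac db h e e0; have [r r0 hr] := h e e0; exists r => // n s t hst.
apply: hr => i; have [h1 h2 h3] := hst i; split => //; [exact: le_trans h1|exact: le_trans db].
Qed.

Lemma abs_continuousB v w a b : abs_continuous a b v -> abs_continuous a b w ->
  abs_continuous a b (fun x => v x - w x).
Proof.
move=> hv hw e e0; have e2 : 0 < e / 2 by rewrite divr_gt0.
have [r r0 hr] := hv _ e2; have [q q0 hq] := hw _ e2.
exists (Num.min r q); first by rewrite lt_min r0.
move=> n s t hst tI; rewrite lt_min => /andP[/(hr _ _ _ hst tI) h1 /(hq _ _ _ hst tI) h2].
apply: (@le_lt_trans _ _ (\sum_(i < n) (`|v (t i) - v (s i)| + `|w (t i) - w (s i)|))).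
  apply: ler_sum => i _; apply: le_trans (ler_normB _ _); rewrite le_eqVlt; apply/orP; left.
  by apply/eqP; congr (`|_|); ring.
rewrite big_split /=; lra.
Qed.

Lemma lipschitz_abs_continuous v a b K : 0 <= K ->
  (forall s t, a <= s -> s <= t -> t <= b -> `|v t - v s| <= K * (t - s)) ->
  abs_continuous a b v.
Proof.
move=> K0 hv e e0; have K1 : 0 < K + 1 by rewrite ltr_wpDl.
exists (e / (K + 1)); first exact: divr_gt0.
move=> n s t hst _; rewrite ltr_pdivlMr// => h.
apply: le_lt_trans h; rewrite mulr_suml; apply: ler_sum => i _.
have [h1 h2 h3] := hst i; apply: le_trans (hv _ _ h1 h2 h3) _.
by rewrite mulrC ler_wpM2l ?subr_ge0// lerDl.
Qed.

Lemma abs_continuous_cvg v a b x : abs_continuous a b v -> a <= x <= b ->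
  forall e, 0 < e -> exists2 r, 0 < r & forall y, a <= y <= b -> `|y - x| < r ->
    `|v y - v x| < e.
Proof.
move=> hv /andP[ax xb] e e0; have [r r0 hr] := hv e e0; exists r => // y /andP[ay yb] yx.
have H s t : a <= s -> s <= t -> t <= b -> t - s < r -> `|v t - v s| < e.
  move=> h1 h2 h3 h4; have := hr 1%N (fun=> s) (fun=> t); rewrite !big_ord1; apply => //.
  by move=> i j _ _ _; rewrite !ord1.
have [xy|yx'] := leP x y.
  by apply: H => //; move: yx; rewrite ger0_norm// subr_ge0.
by rewrite distrC; apply: H => //; [exact: ltW|move: yx; rewrite ltr0_norm ?subr_lt0// opprB].
Qed.

(** Short intervals around such a point either lie in the open set [U] or
make [v] vary at most [e] times their length. *)
Let local_step v U e x : 0 < e -> open U -> (U x \/ der v x 0) ->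
  exists2 r, 0 < r & forall u w, x - r < u -> u <= x -> x <= w -> w < x + r ->
    (`]u, w] `<=` U) \/ `|v w - v u| <= e * (w - u).
Proof.
move=> e0 oU [Ux|dv].
  have /nbhs_ballP [r /= r0 hr] : nbhs x U by exact: open_nbhs_nbhs.
  exists r => // u w h1 h2 h3 h4; left => y; rewrite /= in_itv/= => /andP[uy yw].
  by apply: hr; rewrite /ball /= ltr_norml; apply/andP; split; lra.
have [r r0 hr] := derP dv e0; exists r => // u w h1 h2 h3 h4; right.
have H1 : `|v w - v x| <= e * (w - x).
  have := hr w; rewrite mul0r subr0 ger0_norm ?subr_ge0// => h; apply: h; lra.
have H2 : `|v u - v x| <= e * (x - u).
  have xu : 0 <= x - u by rewrite subr_ge0.
  have := hr u; rewrite mul0r subr0 [`|u - x|]distrC (ger0_norm xu) => h; apply: h; lra.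
have -> : v w - v u = (v w - v x) - (v u - v x) by ring.
apply: le_trans (ler_normB _ _) _; lra.
Qed.

(** The interval from a to c is divided into steps of these two kinds; the s i
and t i are the ends of the steps inside [U]. Half-open intervals make the
measures of consecutive steps add up. *)
Let chain v U e a c := exists (n : nat) (s t : nat -> R),
  [/\ forall i, (i < n)%N -> [/\ a <= s i, s i <= t i & t i <= c],
      forall i j, (i < j)%N -> (j < n)%N -> t i <= s j,
      ((\sum_(i < n) (t i - s i))%:E <= mu (U `&` `]a, c]))%E &
      `|v c - v a| <= e * (c - a) + \sum_(i < n) `|v (t i) - v (s i)|].

Let chain_step v U e a u w : 0 < e -> open U -> a <= u -> u <= w ->
  (`]u, w] `<=` U) \/ `|v w - v u| <= e * (w - u) ->
  chain v U e a u -> chain v U e a w.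
Proof.
move=> e0 oU au uw hh [n [s [t [h1 h2 h3 h4]]]].
have mU : measurable U by exact: open_measurable.
have mUI c d : measurable (U `&` `]c, d]) by apply: measurableI.
have tri : `|v w - v a| <= `|v w - v u| + `|v u - v a|.
  have -> : v w - v a = (v w - v u) + (v u - v a) by ring.
  exact: ler_normD.
case: hh => [uU|vuw]; last first.
  exists n, s, t; split => //.
  - by move=> i /h1 [? ? ?]; split => //; exact: le_trans uw.
  - apply: (le_trans h3); apply: le_measure; rewrite ?inE; [exact: mUI|exact: mUI|].
    by apply: setIS; apply: subset_itvl; rewrite bnd_simp.
  - apply: (le_trans tri); have -> : e * (w - a) = e * (w - u) + e * (u - a) by ring.
    by rewrite -addrA lerD.
exists n.+1, (fun i => if i == n then u else s i), (fun i => if i == n then w else t i).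
have sumE (F : R -> R -> R) :
   \sum_(i < n.+1) F (if i == n :> nat then w else t i) (if i == n :> nat then u else s i) =
   \sum_(i < n) F (t i) (s i) + F w u.
  rewrite big_ord_recr /= eqxx; congr (_ + _); apply: eq_bigr => i _.
  by rewrite (ltn_eqF (ltn_ord i)).
split.
- move=> i; rewrite ltnS leq_eqVlt => /orP[/eqP->|ij]; first by rewrite eqxx.
  rewrite (ltn_eqF ij); have [? ? ?] := h1 i ij; split => //; exact: le_trans uw.
- move=> i j ij; rewrite ltnS leq_eqVlt => /orP[/eqP jn|jn].
    rewrite jn eqxx; rewrite jn in ij; rewrite (ltn_eqF ij).
    by have [_ _ ?] := h1 i ij.
  by rewrite (ltn_eqF jn) (ltn_eqF (ltn_trans ij jn)); exact: h2.
- rewrite (sumE (fun p q => p - q)) EFinD.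
  apply: (@le_trans _ _ (mu (U `&` `]a, u]) + mu (`]u, w]))%E).
    apply: leeD => //; rewrite lebesgue_measure_itv /= lte_fin -EFinB.
    by case: ltP => // wu; rewrite lee_fin subr_le0.
  have dis : U `&` `]a, u] `&` `]u, w] = set0.
    by apply/seteqP; split => // y [[_]]; rewrite /= !in_itv/= => /andP[_ yu] /andP[]; rewrite ltNge yu.
  rewrite -measureU//; last exact: mUI.
    apply: le_measure; rewrite ?inE; [apply: measurableU; [exact: mUI|exact: measurable_itv]|exact: mUI|].
    move=> y [[Uy]|]; rewrite /= in_itv/= => /andP[y1 y2].
      by split => //; rewrite in_itv/= y1 (le_trans y2).
    split; first by apply: uU; rewrite /= in_itv/= y1.
    by rewrite in_itv/= y2 (le_lt_trans au).
- rewrite (sumE (fun p q => `|v p - v q|)).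
  apply: (le_trans tri).
  have h5 : 0 <= e * (w - u) by rewrite mulr_ge0 ?subr_ge0// ltW.
  have -> : e * (w - a) = e * (w - u) + e * (u - a) by ring.
  lra.
Qed.

(** The supremum of the points that a chain reaches is reached, and is b. *)
Let chain_end v U e a b : 0 < e -> open U -> a <= b ->
  (forall x, a <= x <= b -> U x \/ der v x 0) -> chain v U e a b.
Proof.
move=> e0 oU ab hU.
pose S := [set c | a <= c <= b /\ chain v U e a c].
have Sa : S a.
  split; first by rewrite lexx.
  exists 0%N, (fun=> 0), (fun=> 0); split => //; first by rewrite big_ord0.
  by rewrite !subrr normr0 mulr0 big_ord0 addr0.
have hS : has_sup S by split; [exists a|exists b => c [/andP[]]].
have ax : a <= sup S by exact: ub_le_sup hS.2 _ Sa.
have xb : sup S <= b by apply: ge_sup => //; [exists a|move=> c [/andP[]]].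
have [|r r0 hr] := @local_step v U e (sup S) e0 oU; first by apply: hU; rewrite ax.
have [u [/andP[au ub] cu] xu] := sup_adherent r0 hS.
have ux : u <= sup S by apply: ub_le_sup; [exact: hS.2|split => //; rewrite au].
pose w := Num.min (sup S + r / 2) b.
have xw : sup S <= w by rewrite le_min xb andbT; lra.
have wr : w < sup S + r by rewrite gt_min; apply/orP; left; lra.
have wb : w <= b by rewrite ge_min lexx orbT.
have uw := le_trans ux xw.
have cw := chain_step e0 oU au uw (hr u w xu ux xw wr) cu.
have : w <= sup S by apply: ub_le_sup; [exact: hS.2|split => //; rewrite wb (le_trans au)].
move=> wx; suff -> : b = w by [].
apply/eqP; rewrite eq_le wb andbT /w le_min lexx andbT.
move: wx; rewrite /w; have [h|h] := leP (sup S + r / 2) b; last by move=> _; exact: ltW.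
by lra.
Qed.

(** The exceptional null set lies in an open set [U] of small measure. In a chain
from a to b, the steps inside [U] contribute little by absolute continuity, and
the other ones contribute at most e (b - a). *)
Lemma abs_continuous_der0 v a b : a <= b -> abs_continuous a b v ->
  {ae mu, forall x, a < x < b -> der v x 0} -> v a = v b.
Proof.
move=> ab hv [A [mA A0 hA]].
apply/eqP; rewrite eq_sym -subr_eq0 -normr_le0; apply/ler_addgt0Pl => e' e0'; rewrite addr0.
pose e := e' / (b - a + 1).
have ba : 0 < b - a + 1 by rewrite ltr_wpDl// subr_ge0.
have e0 : 0 < e by exact: divr_gt0.
have [r r0 hr] := hv e e0.
pose A' := A `|` [set a] `|` [set b].
have mA' : measurable A' by do ?apply: measurableU => //; exact: measurable_set1.
have A'0 : mu A' = 0.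
  rewrite /A' measureU0.
  - rewrite measureU0; [exact: A0|exact: mA|exact: measurable_set1|exact: lebesgue_measure_set1].
  - by apply: measurableU => //; exact: measurable_set1.
  - exact: measurable_set1.
  - exact: lebesgue_measure_set1.
have finA : (mu A' < +oo)%E by rewrite A'0 ltry.
have [U [oU AU mUA]] := lebesgue_regularity_outer mA' finA r0.
have mU : measurable U by exact: open_measurable.
have Ur : (mu U < r%:E)%E.
  have -> : mu U = (mu A' + mu (U `\` A'))%E.
    rewrite -measureU; [by rewrite setDUK|exact: mA'|exact: measurableD|by rewrite setDIK].
  by rewrite A'0 add0e.
have [x /andP[ax xb]|n [s [t [h1 h2 h3 h4]]]] := @chain_end v U e a b e0 oU ab.
  have [Ax|nAx] := pselect (A' x); first by left; exact: AU.
  right; apply: contrapT => ndv; apply: nAx.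
  move: ax; rewrite le_eqVlt => /predU1P[ea|ax]; first by left; right; rewrite /= ea.
  move: xb; rewrite le_eqVlt => /predU1P[eb|xb]; first by right; rewrite /= eb.
  by left; left; apply: hA => /= H; apply: ndv; apply: H; rewrite ax.
apply: (le_trans h4).
have h5 : \sum_(i < n) (t i - s i) < r.
  rewrite -lte_fin; apply: le_lt_trans h3 (le_lt_trans _ Ur).
  by apply: le_measure; rewrite ?inE//; exact: measurableI.
have h6 : \sum_(i < n) `|v (t i) - v (s i)| < e.
  apply: (hr n (fun i : 'I_n => s i) (fun i : 'I_n => t i)) => //.
    by move=> i; apply: h1.
  move=> i j _ _ [y []]; rewrite /= !in_itv/= => /andP[y1 y2] /andP[y3 y4].
  apply/val_inj; case: (ltngtP i j) => // ij.
    by have := h2 _ _ ij (ltn_ord j) => h; have := lt_le_trans y2 (le_trans h (ltW y3)); rewrite ltxx.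
  by have := h2 _ _ ij (ltn_ord i) => h; have := lt_le_trans y4 (le_trans h (ltW y1)); rewrite ltxx.
have -> : e' = e * (b - a) + e by rewrite /e; field; rewrite gt_eqF.
lra.
Qed.

End AbsoluteContinuity.

(** * From weak solutions to classical ones *)
Section WeakSolutions.
Context {R : realType}.
Local Notation mu := (@lebesgue_measure R).
Implicit Types (u v w g Phi : R -> R) (x : R).

Lemma aeS (P Q : R -> Prop) : {ae mu, forall x, P x} -> (forall x, P x -> Q x) ->
  {ae mu, forall x, Q x}.
Proof. by move=> h PQ; apply: (@filterS _ _ (ae_filter_ringOfSetsType mu) P Q). Qed.

Lemma aeS2 (P1 P2 Q : R -> Prop) : {ae mu, forall x, P1 x} -> {ae mu, forall x, P2 x} ->
  (forall x, P1 x -> P2 x -> Q x) -> {ae mu, forall x, Q x}.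
Proof. by move=> h1 h2 PQ; apply: (@filterS2 _ _ (ae_filter_ringOfSetsType mu) P1 P2 Q). Qed.

Lemma aeS3 (P1 P2 P3 Q : R -> Prop) : {ae mu, forall x, P1 x} -> {ae mu, forall x, P2 x} ->
  {ae mu, forall x, P3 x} ->
  (forall x, P1 x -> P2 x -> P3 x -> Q x) -> {ae mu, forall x, Q x}.
Proof.
by move=> h1 h2 h3 PQ; apply: (@filterS3 _ _ (ae_filter_ringOfSetsType mu) P1 P2 P3 Q).
Qed.

Lemma ae_itv_ex (P : R -> Prop) (p q : R) : p < q -> {ae mu, forall x, P x} ->
  exists x, p < x < q /\ P x.
Proof.
move=> pq [A [mA A0 hA]]; apply: contrapT => h.
have sub : `]p, q[ `<=` A.
  move=> x; rewrite /= in_itv/= => xpq; apply: hA => /= Px; apply: h; exists x; split=> //.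
have : (mu `]p, q[ <= mu A)%E by apply: le_measure; rewrite ?inE.
rewrite lebesgue_measure_itv /= lte_fin pq -EFinB.
have -> : mu A = 0%E by exact: A0.
by rewrite lee_fin subr_le0 leNgt pq.
Qed.

Lemma abs_continuous_ae0 d : abs_continuous 0 1 d ->
  {ae mu, forall x, I01 x -> d x = 0} -> forall x, 0 <= x <= 1 -> d x = 0.
Proof.
move=> ad d0 x x01; apply/eqP; apply: contrapT => /negP dx.
have n0 : 0 < `|d x| by rewrite normr_gt0.
have [r r0 hr] := abs_continuous_cvg ad x01 n0.
pose p := Num.max 0 (x - r / 2); pose q := Num.min 1 (x + r / 2).
case/andP: x01 => x0 x1.
have pq : p < q.
  by rewrite gt_max !lt_min; do ?(apply/andP; split); lra.
have [y [/andP[py yq] dy]] := ae_itv_ex pq d0.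
have [y0 y1] : 0 < y /\ x - r / 2 < y by move: py; rewrite gt_max => /andP.
have [y2 y3] : y < 1 /\ y < x + r / 2 by move: yq; rewrite lt_min => /andP.
have dy0 : d y = 0 by apply: dy; rewrite /I01 /= in_itv/= y0.
have := hr y; rewrite dy0 sub0r normrN ltxx => h.
have // : false.
by apply: h; [apply/andP; split; exact: ltW|rewrite ltr_norml; apply/andP; split; lra].
Qed.

Lemma ac_repr_uniq u1 u2 v1 v2 : ae_eq mu I01 u1 u2 ->
  ac_repr u1 v1 -> ac_repr u2 v2 -> forall x, 0 <= x <= 1 -> v1 x = v2 x.
Proof.
move=> u12 [a1 e1] [a2 e2] x x01; apply/eqP; rewrite -subr_eq0; apply/eqP.
apply: (abs_continuous_ae0 (abs_continuousB a1 a2)) => //.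
apply: (aeS3 e1 e2 u12) => y h1 h2 h3 yI.
by rewrite -h1// -h2// h3// subrr.
Qed.

Lemma der_uniq v x a b : der v x a -> der v x b -> a = b.
Proof. by move=> [_ <-] [_ <-]. Qed.

Lemma near_eq_itv v w p q x : p < x < q -> (forall y, p < y < q -> v y = w y) ->
  \near x, v x = w x.
Proof.
move=> /andP[px xq] h; near=> y; apply: h; apply/andP; split; near: y.
  exact: lt_nbhsr.
exact: lt_nbhsl.
Unshelve. all: by end_near. Qed.

Definition clamp a b x : R := Num.max a (Num.min x b).

Lemma clampE a b x : a <= x <= b -> clamp a b x = x.
Proof. by move=> /andP[ax xb]; rewrite /clamp (min_idPl xb) (max_idPr ax). Qed.

Lemma clamp_itv a b x : a <= b -> a <= clamp a b x <= b.
Proof. by move=> ab; rewrite /clamp le_max lexx/= ge_max ab ge_min lexx orbT. Qed.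

Lemma clamp_lip a b x y : `|clamp a b x - clamp a b y| <= `|x - y|.
Proof.
wlog xy : x y / x <= y.
  move=> h; have [/h//|/ltW yx] := leP x y.
  by rewrite distrC (distrC x); exact: h.
rewrite (distrC x) (distrC (clamp a b x)) (@ger0_norm _ (y - x)) ?subr_ge0//.
have min_lip : Num.min x b <= Num.min y b <= Num.min x b + (y - x).
  by case: (leP x b) => h1; case: (leP y b) => h2; apply/andP; split; lra.
rewrite /clamp; move: (Num.min x b) (Num.min y b) min_lip => s t /andP[st ts].
by rewrite ger0_norm; case: (leP a s) => h1; case: (leP a t) => h2; lra.
Qed.

(** A continuous function on [a, b] is extended by constants, which makes
[primitive] applicable. *)
Lemma clamp_cont v a b : a <= b ->
  (forall x, a <= x <= b -> forall e, 0 < e -> exists2 r, 0 < r &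
     forall y, a <= y <= b -> `|y - x| < r -> `|v y - v x| < e) ->
  continuous (v \o clamp a b).
Proof.
move=> ab hv x; apply/cvgrPdist_lt => e e0.
have [r r0 hr] := hv _ (clamp_itv x ab) e e0.
exists r => //= y; rewrite /ball_ /= => xy; rewrite distrC.
apply: hr; first exact: clamp_itv.
by apply: le_lt_trans (clamp_lip _ _ _ _) _; rewrite distrC.
Qed.

Lemma primitive_ac g G a b : -1 < a -> a <= b -> continuous g ->
  (forall x, -1 < x -> der G x (g x)) -> abs_continuous a b G.
Proof.
move=> a1 ab cg dG.
have cn : {within `[a, b], continuous (fun x => `|g x|)}.
  apply: within_cont => x _; apply: (@cvg_comp _ _ _ g (fun t => `|t|) _ (nbhs (g x))).
    exact: cg.
  exact: norm_continuous.
have [c cab hc] := EVT_max ab cn.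
apply: (@lipschitz_abs_continuous _ _ _ _ `|g c|) => // s t as_ st tb.
apply: (der_bound (df := g) st).
- apply: within_cont => x; rewrite inE/= in_itv/= => /andP[sx _].
  by apply: der_cvg (dG _ _); apply: lt_le_trans a1 (le_trans as_ sx).
- by move=> x /andP[sx _]; apply: dG; apply: lt_trans (lt_le_trans a1 as_) sx.
- move=> x /andP[sx xt]; apply: hc; rewrite in_itv/=.
  by rewrite (le_trans as_ (ltW sx)) (le_trans (ltW xt)).
Qed.

(** The difference of [v] and the primitive [G] is absolutely continuous with
derivative 0 almost everywhere. *)
Lemma ac_primitive v g G a b : -1 < a -> a <= b -> continuous g ->
  (forall x, -1 < x -> der G x (g x)) -> abs_continuous a b v ->
  {ae mu, forall x, a < x < b -> der v x (g x)} ->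
  forall x, a <= x <= b -> v x = v a + (G x - G a).
Proof.
move=> a1 ab cg dG av dv x /andP[ax xb].
have aG := primitive_ac a1 ab cg dG.
have aD : abs_continuous a x (fun y => v y - G y).
  by apply: (@abs_continuousS _ _ a b) (abs_continuousB av aG) => //.
suff : v a - G a = v x - G x by lra.
apply: (abs_continuous_der0 ax aD).
apply: (aeS dv) => y dvx /andP[ay yx].
have dvy : der v y (g y) by apply: dvx; rewrite ay (lt_le_trans yx).
have dGy : der G y (g y) by apply: dG; exact: lt_trans ay.
by have := derB dvy dGy; rewrite subrr.
Qed.

Context (alpha : R) (halpha : 0 <= alpha < 1).
Let a0 : 0 <= alpha. Proof. by case/andP: halpha. Qed.
Let a1 : alpha < 1. Proof. by case/andP: halpha. Qed.

(** The first-order system for a solution and its flux. The derivative of [w] is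
two-sided also at 0 and 1, which is possible because [v] is a continuous
function on the line. *)
Definition classical lam v w := [/\ continuous v,
  forall x, -1 < x -> der w x (- lam * v x),
  forall x, 0 < x < 1 -> der v x (x `^ (- alpha) * w x),
  w 0 = 0 & w 1 = 0].

(** The representative of the flux is a primitive of the continuous function
-lam v, and away from 0 that of the solution is a primitive of x^-alpha w; the
values outside [0, 1] are those of a continuous extension. *)
Lemma eigenpair_classical lam Phi : eigenpair alpha lam Phi ->
  exists v w, classical lam v w /\ ae_eq mu I01 Phi v.
Proof.
move=> [_ _ [g [r [[v rv dv] [w rw dw] er]]] [g' [w' [[v1 rv1 dv1] rw' w'0]]] [v2 rv2 dv2]].
have l01 : 0 <= 1 :> R by [].
have [av ev] := rv; have [aw ew] := rw.
have v1E := ac_repr_uniq (ae_eq_refl _ _ _) rv1 rv.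
have v2E := ac_repr_uniq (ae_eq_refl _ _ _) rv2 rv.
pose vc := v \o clamp 0 1.
have vcE x : 0 <= x <= 1 -> vc x = v x by move=> h; rewrite /vc /= clampE.
have cvc : continuous vc.
  by apply: clamp_cont => // x x01; exact: abs_continuous_cvg av x01.
(* The boundary condition at 0 comes with a weak derivative and a flux of its
   own, which agree with those of the equation almost everywhere. *)
have w'E : forall x, 0 <= x <= 1 -> w' x = w x.
  apply: (ac_repr_uniq _ rw' rw).
  apply: (aeS2 dv dv1) => x d1 d2 xI.
  have {}d1 := d1 xI; have {}d2 := d2 xI; congr (_ * _).
  have {}d2 : der v x (g' x).
    move: xI; rewrite /I01 /= in_itv/= => x01.
    apply: der_near d2; apply: (near_eq_itv x01) => y /andP[y0 y1].
    by apply: v1E; rewrite !ltW.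
  exact: (der_uniq d2 d1).
have w0 : w 0 = 0 by rewrite -w'E ?lexx ?ler01// w'0.
have [V [V0 dV]] := primitive cvc.
pose W x := - lam * V x.
have dW x : -1 < x -> der W x (- lam * vc x) by move=> h; apply: derZ; exact: dV.
have cW : continuous (fun x => - lam * vc x).
  by move=> x; apply: cvgM; [exact: cvg_cst|exact: cvc].
have wW x : 0 <= x <= 1 -> w x = W x.
  move=> x01; have dwc : {ae mu, forall x, 0 < x < 1 -> der w x (- lam * vc x)}.
    apply: (aeS3 dw er ev) => y h1 h2 h3 yI.
    have yJ : I01 y by rewrite /I01 /= in_itv.
    apply: (is_derive_eq (h1 yJ)).
    have := h2 yJ; rewrite (h3 yJ) vcE; last by case/andP: yI => *; rewrite !ltW.
    by rewrite mulNr => <-; rewrite opprK.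
  rewrite (@ac_primitive w _ W 0 1 _ l01 cW dW aw dwc x x01) ?ltrN10//.
  by rewrite w0 add0r /W V0 mulr0 subr0.
(* The factor x^-alpha is singular at 0: the relation v' = x^-alpha w is
   integrated on [e, 1] for each e > 0, with a right-hand side that is extended
   by constants to a continuous function on the line. *)
have loc e : 0 < e -> e < 1 -> exists P, [/\ forall x, -1 < x ->
     der P x ((clamp e 1 x) `^ (- alpha) * W (clamp e 1 x)) &
   forall x, e <= x <= 1 -> v x = v e + (P x - P e)].
  move=> e0 e1; pose D x := x `^ (- alpha) * W x.
  have cD : continuous (D \o clamp e 1).
    apply: clamp_cont; first exact: ltW.
    move=> x /andP[ex x1] eps eps0.
    have x0 : 0 < x by exact: lt_le_trans ex.
    have dD := derM (der_powR (- alpha) x0) (dW x (lt_trans (ltrN10 _) x0)).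
    have /cvgrPdist_lt /(_ _ eps0) [q /= q0 hq] := der_cvg dD.
    exists q => // y _ yx; rewrite distrC; apply: hq; by rewrite /ball_ /= distrC.
  have [P [_ dP]] := primitive cD.
  exists P; split; first exact: dP.
  have e1' : -1 < e by apply: lt_trans e0; exact: ltrN10.
  apply: (ac_primitive e1' (ltW e1) cD dP).
    by apply: (abs_continuousS _ _ av) => //; exact: ltW.
  apply: (aeS2 dv ew) => x h1 h2 /andP[ex x1].
  have x0 : 0 < x by exact: lt_trans ex.
  have xI : I01 x by rewrite /I01 /= in_itv/= x0.
  apply: (is_derive_eq (h1 xI)); rewrite /D /= clampE ?(ltW ex) ?(ltW x1)//.
  rewrite -wW ?(ltW x0) ?(ltW x1)// -(h2 xI) mulrA -powRD ?addNr ?powRr0 ?mul1r//.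
  by rewrite (gt_eqF x0) implybT.
exists vc, W; split; last first.
  apply: (aeS ev) => x h xI; rewrite vcE; first exact: h.
  by move: xI; rewrite /I01 /= in_itv/= => /andP[*]; rewrite !ltW.
split => //; last 2 first.
- by rewrite /W V0 mulr0.
- have h12 : 2^-1 < 1 :> R by lra.
  have h02 : 0 < 2^-1 :> R by lra.
  have [P [dP PE]] := loc 2^-1 h02 h12.
  have l1 : -1 < 1 :> R by lra.
  have d1 := dP 1 l1; rewrite clampE in d1; last by lra.
  rewrite powR1 mul1r in d1.
  have H1 : h^-1 * (v2 (1 + h) - v2 1) @[h --> (0 : R)^'-] --> W 1.
    have [dP1 <-] := d1.
    have := dP1; rewrite /derivable => hc.
    have {}hc : h^-1 *: ((P \o shift 1) (h *: 1) - P 1) @[h --> (0 : R)^'-] --> 'D_1 P 1.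
      exact: cvg_dnbhs_at_left.
    apply: cvg_trans hc; apply: near_eq_cvg; near=> h.
    rewrite /GRing.scale /= mulr1 addrC; congr (_ * _).
    have h0 : h < 0 by near: h; exact: nbhs_left_lt.
    have h2 : - 2^-1 < h by near: h; apply: nbhs_left_gt; lra.
    have i1 : 0 <= 1 + h <= 1 by apply/andP; split; lra.
    have i2 : 0 <= (1 : R) <= 1 by apply/andP; split; lra.
    have i3 : 2^-1 <= 1 + h <= 1 by apply/andP; split; lra.
    have i4 : 2^-1 <= (1 : R) <= 1 by apply/andP; split; lra.
    rewrite (v2E _ i1) (v2E _ i2) (PE _ i3) (PE _ i4) (addrC h 1); ring.
  exact: (cvg_unique _ H1 dv2).
move=> x /andP[x0 x1].
have x20 : 0 < x / 2 by lra.
have x21 : x / 2 < 1 by lra.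
have [P [dP PE]] := loc _ x20 x21.
have h1 : -1 < x by lra.
have := dP x h1; rewrite clampE; last by lra.
move=> dPx; apply: (@der_near _ (fun y => v (x / 2) + (P y - P (x / 2)))).
  apply: (@near_eq_itv _ _ (x / 2) 1); first by lra.
  move=> y /andP[y0 y1].
  have i1 : 0 <= y <= 1 by apply/andP; split; lra.
  have i2 : x / 2 <= y <= 1 by apply/andP; split; lra.
  by rewrite (vcE _ i1) (PE _ i2).
have := derD (der_cst (v (x / 2)) x) (derB dPx (der_cst (P (x / 2)) x)).
by rewrite subr0 add0r.
Unshelve. all: by end_near. Qed.

Lemma bound_compare (f df G dG : R -> R) b : 0 <= b ->
  {within `[0, b], continuous f} -> {within `[0, b], continuous G} ->
  (forall x, 0 < x < b -> der f x (df x)) -> (forall x, 0 < x < b -> der G x (dG x)) ->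
  (forall x, 0 < x < b -> `|df x| <= dG x) -> f 0 = 0 -> G 0 = 0 -> `|f b| <= G b.
Proof.
move=> b0 cf cG hf hG h f0 G0; rewrite ler_norml; apply/andP; split.
- rewrite lerNl -subr_ge0 opprK.
  have -> : 0 = G 0 + f 0 by rewrite G0 f0 addr0.
  apply: (@der_ge0_le _ (fun x => G x + f x) (fun x => dG x + df x)) => //.
  + by move=> x; apply: cvgD; [exact: cG|exact: cf].
  + by move=> x xb; apply: derD; [exact: hG|exact: hf].
  + by move=> x xb; have := h x xb; rewrite ler_norml => /andP[]; lra.
- rewrite -subr_ge0.
  have -> : 0 = G 0 - f 0 by rewrite G0 f0 subr0.
  apply: (@der_ge0_le _ (fun x => G x - f x) (fun x => dG x - df x)) => //.
  + by move=> x; apply: cvgB; [exact: cG|exact: cf].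
  + by move=> x xb; apply: derB; [exact: hG|exact: hf].
  + by move=> x xb; have := h x xb; rewrite ler_norml => /andP[]; lra.
Qed.

Lemma cont_within (f : R -> R) (A : set R) : continuous f -> {within A, continuous f}.
Proof. by move=> cf; apply: within_cont => x _; exact: cf. Qed.

(** Iterating the integral equation, with x^-alpha <= x^-1, gives
|d x| <= M |lam|^k x^k / k! for all k. *)
Lemma ivp_zero lam (d om : R -> R) :
  continuous d -> {within `[0, 1], continuous om} ->
  (forall x, 0 < x < 1 -> der om x (- lam * d x)) ->
  (forall x, 0 < x < 1 -> der d x (x `^ (- alpha) * om x)) ->
  d 0 = 0 -> om 0 = 0 -> forall x, 0 <= x <= 1 -> d x = 0.
Proof.
move=> cd com hom hd d0 om0.
have cn : {within `[0 : R, 1], continuous (fun x => `|d x|)}.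
  apply: cont_within => x; apply: (@cvg_comp _ _ _ d (fun t => `|t|) _ (nbhs (d x))).
    exact: cd.
  exact: norm_continuous.
have [c _ hc] := EVT_max ler01 cn.
pose M : R := `|d c|; pose C (k : nat) : R := M * (`|lam| ^+ k / k`!%:R).
have C0 k : 0 <= C k.
  apply: mulr_ge0; first exact: normr_ge0.
  by apply: divr_ge0 => //; apply: exprn_ge0.
have bnd k : forall x, 0 <= x <= 1 -> `|d x| <= C k * x ^+ k.
  elim: k => [|k IH] x x01.
    by rewrite /C expr0 fact0 divr1 !mulr1; apply: hc; rewrite in_itv.
  have k0 : 0 < k.+1%:R :> R by [].
  have dX (K : R) (n : nat) (y : R) : der (fun y => K * y ^+ n.+1) y (K * n.+1%:R * y ^+ n).
    apply: (is_derive_eq (derZ K (derX n.+1 (der_id y)))).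
    by rewrite mulr1 mulrA.
  have omb y : 0 <= y <= 1 -> `|om y| <= `|lam| * C k / k.+1%:R * y ^+ k.+1.
    move=> /andP[y0 y1].
    apply: (@bound_compare om (fun y => - lam * d y) (fun y => `|lam| * C k / k.+1%:R * y ^+ k.+1)
       (fun y => `|lam| * C k / k.+1%:R * k.+1%:R * y ^+ k)) => //.
    - by apply: continuous_subspaceW com; apply: subset_itvl; rewrite bnd_simp.
    - by apply: cont_within => z; exact: der_cvg (dX _ _ _).
    - by move=> z /andP[z0 zy]; apply: hom; rewrite z0 (lt_le_trans zy).
    - move=> z /andP[z0 zy]; rewrite normrM normrN divfK ?gt_eqF// -mulrA ler_wpM2l//.
      by apply: IH; rewrite ltW//= ltW// (lt_le_trans zy).
    - by rewrite expr0n mulr0.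
  have -> : C k.+1 = `|lam| * C k / k.+1%:R.
    rewrite /C exprS factS natrM; field.
    by rewrite pnatr_eq0 -lt0n fact_gt0 nat1r pnatr_eq0.
  case/andP: x01 => x0 x1.
  apply: (@bound_compare d (fun y => y `^ (- alpha) * om y)
     (fun y => `|lam| * C k / k.+1%:R * y ^+ k.+1)
     (fun y => `|lam| * C k / k.+1%:R * k.+1%:R * y ^+ k)) => //.
  - exact: cont_within.
  - by apply: cont_within => z; exact: der_cvg (dX _ _ _).
  - by move=> z /andP[z0 zy]; apply: hd; rewrite z0 (lt_le_trans zy).
  - move=> z /andP[z0 zx]; have z1 : z < 1 by exact: lt_le_trans x1.
    have K0 : 0 <= `|lam| * C k / k.+1%:R by rewrite divr_ge0// mulr_ge0.
    rewrite normrM ger0_norm ?powR_ge0//.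
    apply: (@le_trans _ _ (z^-1 * (`|lam| * C k / k.+1%:R * z ^+ k.+1))).
      apply: ler_pM; rewrite ?powR_ge0//; last by apply: omb; rewrite !ltW.
      rewrite -(powR_inv1 (ltW z0)); apply: ger_powR; first by rewrite z0 ltW.
      by rewrite lerN2 ltW.
    have zk : 0 <= z ^+ k by rewrite exprn_ge0// ltW.
    rewrite exprS mulrCA mulKf ?(gt_eqF z0)//; apply: (ler_wpM2r zk).
    by rewrite ler_peMr// ler1n.
  - by rewrite expr0n mulr0.
move=> x /andP[x0 x1]; apply/eqP; rewrite -normr_le0.
have cC : C k @[k --> \oo] --> 0.
  by rewrite -(mulr0 M); apply: cvgM; [exact: cvg_cst|exact: cvg_exp_coeff].
apply: (cvgr_to_ge cC); near=> k; apply: le_trans (bnd k x _) _; first by rewrite x0.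
by rewrite ler_piMr// exprn_ile1.
Unshelve. all: by end_near. Qed.

(** The difference with the multiple of [ef] that has the same value at 0 solves
the problem with zero data. *)
Lemma classical_ef lam v w : classical lam v w ->
  forall x, 0 <= x <= 1 -> v x = v 0 * ef alpha lam x /\ w x = v 0 * ew alpha lam x.
Proof.
move=> [cv dw dv w0 w1].
have ew0 : ew alpha lam 0 = 0 by rewrite /ew mulr0 mul0r.
have ce := @ef_cont _ _ halpha lam; have cw := @ew_cont _ _ halpha lam.
have cwv b : {within `[0 : R, b], continuous (fun x => w x - v 0 * ew alpha lam x)}.
  apply: within_cont => x; rewrite inE/= in_itv/= => /andP[x0 _].
  apply: cvgB; first by apply: der_cvg (dw x _); apply: lt_le_trans x0; exact: ltrN10.
  by apply: cvgM; [exact: cvg_cst|exact: cw].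
have H x : 0 <= x <= 1 -> v x - v 0 * ef alpha lam x = 0.
  apply: (@ivp_zero lam (fun x => v x - v 0 * ef alpha lam x)
     (fun x => w x - v 0 * ew alpha lam x)).
  - by move=> y; apply: cvgB; [exact: cv|apply: cvgM; [exact: cvg_cst|exact: ce]].
  - exact: cwv.
  - move=> y /andP[y0 y1]; have y1' : -1 < y by apply: lt_trans y0; exact: ltrN10.
    apply: (is_derive_eq (derB (dw y y1') (derZ (v 0) (ew_der halpha lam y0)))).
    by ring.
  - move=> y /andP[y0 y1].
    have y01 : 0 < y < 1 by rewrite y0.
    apply: (is_derive_eq (derB (dv y y01) (derZ (v 0) (ef_der halpha lam y0)))).
    have -> : ed alpha lam y = y `^ (- alpha) * ew alpha lam y.
      rewrite -(ed_ew halpha lam (ltW y0)) mulrA -powRD ?addNr ?powRr0 ?mul1r//.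
      by rewrite (gt_eqF y0) implybT.
    by ring.
  - by rewrite (ef0 halpha) mulr1 subrr.
  - by rewrite w0 ew0 mulr0 subrr.
have vE x : 0 <= x <= 1 -> v x = v 0 * ef alpha lam x.
  by move=> /H /eqP; rewrite subr_eq0 => /eqP.
move=> x x01; split; first exact: vE.
case/andP: x01 => x0 x1; apply/eqP; rewrite -subr_eq0; apply/eqP.
rewrite -[RHS](_ : w 0 - v 0 * ew alpha lam 0 = 0); last by rewrite w0 ew0 mulr0 subrr.
apply/esym/(@der_eq0 _ (fun x => w x - v 0 * ew alpha lam x)) => //.
- move=> y /andP[y0 yx]; have y1' : -1 < y by apply: lt_trans y0; exact: ltrN10.
  apply: (is_derive_eq (derB (dw y y1') (derZ (v 0) (ew_der halpha lam y0)))).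
  by rewrite vE; [ring|rewrite ltW//= ltW// (lt_le_trans yx)].
Qed.

(** The product v w has the derivative x^-alpha w^2 - lam v^2. If lam < 0, this
is nonnegative, and positive near 0, where v does not vanish; but v w is 0 at
both ends. *)
Lemma classical_lam_ge0 lam v w : classical lam v w -> v 0 != 0 -> 0 <= lam.
Proof.
move=> hc v0; rewrite leNgt; apply/negP => lam0.
have [cv dw dv w0 w1] := hc.
have d x : 0 < x < 1 -> der (fun x => v x * w x) x (x `^ (- alpha) * w x ^+ 2 - lam * v x ^+ 2).
  move=> x01; have x1 : -1 < x by case/andP: x01 => x0 _; apply: lt_trans x0; exact: ltrN10.
  by apply: (is_derive_eq (derM (dv x x01) (dw x x1))); ring.
have cw : {within `[0 : R, 1], continuous w}.
  apply: within_cont => x; rewrite inE/= in_itv/= => /andP[x0 _].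
  by apply: der_cvg (dw x _); apply: lt_le_trans x0; exact: ltrN10.
have cvw x : 0 <= x -> {for x, continuous (fun x => v x * w x)}.
  move=> x0; apply: cvgM; first exact: cv.
  by apply: der_cvg (dw x _); apply: lt_le_trans x0; exact: ltrN10.
have [r r0 hr] : exists2 r, 0 < r & forall x, `|x| < r -> v x != 0.
  have n0 : 0 < `|v 0| by rewrite normr_gt0.
  have /cvgrPdist_lt /(_ _ n0) [r /= r0 hr] := cv 0.
  exists r => // x xr; apply/eqP => vx.
  by have := hr x; rewrite /ball_ /= sub0r normrN vx subr0 ltxx => /(_ xr).
pose b := Num.min (r / 2) 2^-1.
have b0 : 0 < b by rewrite lt_min; apply/andP; split; lra.
have b1 : b <= 2^-1 by rewrite ge_min lexx orbT.
have br : b <= r / 2 by rewrite ge_min lexx.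
have h1 : v 0 * w 0 < v b * w b.
  apply: (der_gt0_lt b0 _ (fun x h => d x _)).
  - by apply: within_cont => x; rewrite inE/= in_itv/= => /andP[x0 _]; exact: cvw.
  - by move=> x /andP[x0 xb]; apply/andP; split; lra.
  - move=> x /andP[x0 xb]; rewrite -mulNr.
    have q1 : 0 <= x `^ (- alpha) * w x ^+ 2 by rewrite mulr_ge0 ?powR_ge0 ?sqr_ge0.
    have q2 : 0 < - lam * v x ^+ 2.
      apply: mulr_gt0; first by rewrite oppr_gt0.
      rewrite lt_neqAle sqr_ge0 andbT eq_sym sqrf_eq0.
      by apply: hr; rewrite gtr0_norm//; lra.
    exact: ltr_wpDl.
have h2 : v b * w b <= v 1 * w 1.
  have b1' : b <= 1 by lra.
  apply: (der_ge0_le b1' _ (fun x h => d x _)).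
  - by apply: within_cont => x; rewrite inE/= in_itv/= => /andP[x0 _]; apply: cvw; lra.
  - by move=> x /andP[x0 xb]; apply/andP; split; lra.
  - move=> x /andP[x0 xb]; rewrite -mulNr.
    apply: addr_ge0; first by rewrite mulr_ge0 ?powR_ge0 ?sqr_ge0.
    by apply: mulr_ge0; [rewrite oppr_ge0 ltW|exact: sqr_ge0].
by move: h1 h2; rewrite w0 w1 !mulr0 => h1 /(lt_le_trans h1); rewrite ltxx.
Qed.

Lemma classical_eigenvalue lam v w : classical lam v w -> v 0 != 0 ->
  exists n, lam = lambda alpha n.
Proof.
move=> hc v0; have lam0 := classical_lam_ge0 hc v0.
have h1 := classical_ef hc (x := 1).
have [_ _ _ _ w1] := hc.
move: lam0; rewrite le_eqVlt => /predU1P[<-|lam0]; first by exists 0%N.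
have [] := h1; first by rewrite ler01 lexx.
move=> _; rewrite w1 => /esym /eqP; rewrite mulf_eq0 (negbTE v0)/=.
rewrite /ew mulr1 mulf_eq0 oppr_eq0 gt_eqF//= => /eqP.
rewrite /eg /es normr1 powR1 mulr1 => G0.
have k0 : 0 < kappa alpha by rewrite /kappa; have := a1; lra.
pose y := Num.sqrt lam / kappa alpha.
have y0 : 0 < y by rewrite divr_gt0// sqrtr_gt0.
have Gy : besG (ord alpha) y = 0.
  rewrite -[RHS]G0 /besG; congr hyp; rewrite /y exprMn sqr_sqrtr ?ltW// /kappa.
  have -> : ord alpha = (2 - alpha)^-1 by [].
  by field; rewrite gt_eqF; have := a1; lra.
have [n jn] := zeros_surj (jzero_zeros halpha) (conj y0 Gy).
exists n.+1; rewrite /lambda jn /y [(_ / kappa alpha) ^+ 2]expr_div_n sqr_sqrtr ?(ltW lam0)//.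
by field; rewrite gt_eqF.
Qed.

End WeakSolutions.

(** * The nodal Poincare inequality *)
Section NodalPoincare.
Context {R : realType} (alpha : R) (halpha : 0 <= alpha < 1).
Local Notation m := (ord alpha).

Let a0 : 0 <= alpha. Proof. by case/andP: halpha. Qed.
Let a1 : alpha < 1. Proof. by case/andP: halpha. Qed.
Let k0 : 0 < kappa alpha. Proof. by rewrite /kappa; have := a1; lra. Qed.

(** The zeros in [0, 1] of the flux of the eigenfunction of index n + 1: node 0
is the end 0, and node (n + 1) is the end 1. *)
Definition node (n k : nat) : R :=
  if k is k'.+1 then (jzero alpha k'.+1 / jzero alpha n.+1) `^ (kappa alpha)^-1 else 0.

Lemma jzero_gt0 n : 0 < jzero alpha n.+1.
Proof. by case: (zeros_pzero (jzero_zeros halpha) n). Qed.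

Lemma jzero_ltE k n : (jzero alpha k.+1 < jzero alpha n.+1) = (k < n)%N.
Proof. exact: (zeros_lt (jzero_zeros halpha)). Qed.

Lemma node_last n : node n n.+1 = 1.
Proof. by rewrite /node divff ?powR1// gt_eqF// jzero_gt0. Qed.

Lemma node_gt0 n k : 0 < node n k.+1.
Proof. by rewrite /node powR_gt0// divr_gt0 ?jzero_gt0. Qed.

Lemma node_ge0 n k : 0 <= node n k.
Proof. by case: k => [|k]; [exact: lexx|exact: ltW (node_gt0 n k)]. Qed.

Lemma node_lt n k : node n k < node n k.+1.
Proof.
case: k => [|k]; first exact: node_gt0.
apply: gt0_ltr_powR; rewrite ?invr_gt0// ?nnegrE.
- by rewrite ltW// divr_gt0 ?jzero_gt0.
- by rewrite ltW// divr_gt0 ?jzero_gt0.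
- by rewrite ltr_pM2r ?invr_gt0 ?jzero_gt0// jzero_ltE.
Qed.

Lemma node_le1 n k : (k <= n.+1)%N -> node n k <= 1.
Proof.
move=> kn; rewrite -(node_last n).
have /nondecreasing_seqP : forall i, node n i <= node n i.+1 by move=> i; exact: ltW (node_lt n i).
by apply.
Qed.

Lemma eg_besG n x : eg alpha (lambda alpha n.+1) x =
  besG m (jzero alpha n.+1 * `|x| `^ kappa alpha).
Proof. by rewrite /eg (es_lambda halpha). Qed.

Lemma node_arg n k : jzero alpha n.+1 * `|node n k.+1| `^ kappa alpha = jzero alpha k.+1.
Proof.
rewrite gtr0_norm ?node_gt0// /node -powRrM mulVf ?gt_eqF//.
rewrite powRr1; last by rewrite ltW// divr_gt0 ?jzero_gt0.
by rewrite mulrC divfK// gt_eqF ?jzero_gt0.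
Qed.

Lemma ew_node n k : ew alpha (lambda alpha n.+1) (node n k) = 0.
Proof.
case: k => [|k]; first by rewrite /ew /node mulr0 mul0r.
rewrite /ew eg_besG node_arg.
by have [_ ->] := zeros_pzero (jzero_zeros halpha) k; rewrite mulr0.
Qed.

Lemma ew_neq0 n k x : node n k < x < node n k.+1 ->
  ew alpha (lambda alpha n.+1) x != 0.
Proof.
move=> /andP[kx xk]; have x0 : 0 < x by apply: le_lt_trans kx; exact: node_ge0.
rewrite /ew; apply: mulf_neq0.
  by rewrite mulf_neq0 ?(gt_eqF x0)// oppr_eq0 gt_eqF// lambda_gt0.
rewrite eg_besG gtr0_norm//.
have xp : 0 < x `^ kappa alpha by exact: powR_gt0.
have j0 := jzero_gt0 n.
have y0 : 0 < jzero alpha n.+1 * x `^ kappa alpha by exact: mulr_gt0.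
have lift y z : 0 <= y -> y < z -> jzero alpha n.+1 * y `^ kappa alpha < jzero alpha n.+1 * z `^ kappa alpha.
  move=> y1 yz; rewrite ltr_pM2l//; apply: gt0_ltr_powR; rewrite ?nnegrE//.
  by rewrite ltW// (le_lt_trans y1).
have up := lift _ _ (ltW x0) xk.
have := node_arg n k; rewrite gtr0_norm ?node_gt0// => e1; rewrite e1 in up.
case: k => [|k] in kx xk e1 up *.
  exact: (zeros_first (jzero_zeros halpha) y0 up).
have lo := lift _ _ (node_ge0 n k.+1) kx.
have := node_arg n k; rewrite gtr0_norm ?node_gt0// => e2; rewrite e2 in lo.
have [_ _ _ h] := zeros_consec (jzero_zeros halpha) k.
by apply: h; rewrite lo up.
Qed.

Lemma ef_node n k : ef alpha (lambda alpha n.+1) (node n k) != 0.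
Proof.
case: k => [|k]; first by rewrite /node (ef0 halpha) oner_eq0.
apply/eqP => f0; have g0 : eg alpha (lambda alpha n.+1) (node n k.+1) = 0.
  by rewrite eg_besG node_arg; have [_ ->] := zeros_pzero (jzero_zeros halpha) k.
apply: (no_common_zero (ord_ge halpha) _ f0 g0).
rewrite (es_lambda halpha) node_arg divr_gt0// exprn_gt0// jzero_gt0 //.
Qed.

Lemma ew_der_ge0 (lam x : R) : 0 <= x -> der (ew alpha lam) x (- lam * ef alpha lam x).
Proof.
by rewrite le_eqVlt => /predU1P[<-|x0]; [exact: ew_der0|exact: ew_der].
Qed.

(** At a common zero, simple for [w], the numerator is quadratically small and
the denominator only linearly. The value of the quotient there is 0 because
the inverse of 0 is 0. *)
Lemma sqr_div_cont (V w : R -> R) (c a b : R) : der V c a -> der w c b -> b != 0 ->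
  V c = 0 -> w c = 0 -> {for c, continuous (fun x => V x ^+ 2 / w x)}.
Proof.
move=> dV dw b0 Vc wc; apply/cvgrPdist_le => e e0.
have nb : 0 < `|b| / 2 by rewrite divr_gt0// normr_gt0.
have [r r0 hr] := derP dw nb.
have [q q0 hq] := derP dV ltr01.
pose K := (`|a| + 1) ^+ 2 / (`|b| / 2).
have K0 : 0 < K by rewrite /K divr_gt0// exprn_gt0// ltr_wpDl.
exists (Num.min (e / K) (Num.min r q)); first by rewrite /= !lt_min r0 q0 divr_gt0.
move=> x; rewrite /= !lt_min distrC => /andP[xe /andP[xr xq]].
rewrite wc invr0 mulr0 sub0r normrN.
have [->|xc] := eqVneq x c; first by rewrite wc invr0 mulr0 normr0 ltW.
have xc0 : 0 < `|x - c| by rewrite normr_gt0 subr_eq0.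
have Vb : `|V x| <= (`|a| + 1) * `|x - c|.
  have := hq x xq; rewrite Vc subr0 mul1r => h.
  have -> : V x = (V x - a * (x - c)) + a * (x - c) by ring.
  by apply: le_trans (ler_normD _ _) _; rewrite normrM; lra.
have wb : `|b| / 2 * `|x - c| <= `|w x|.
  have := hr x xr; rewrite wc subr0 => h.
  have : `|b * (x - c)| <= `|b * (x - c) - w x| + `|w x|.
    by apply: le_trans (ler_normD _ _); rewrite subrK.
  rewrite distrC normrM; lra.
have w0 : 0 < `|w x| by apply: lt_le_trans wb; exact: mulr_gt0.
rewrite normrM normfV normrX ler_pdivrMr//.
apply: (@le_trans _ _ (((`|a| + 1) * `|x - c|) ^+ 2)).
  by rewrite lerXn2r ?nnegrE// mulr_ge0// addr_ge0.
apply: (@le_trans _ _ (e * (`|b| / 2 * `|x - c|))); last by rewrite ler_pM2l.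
have -> : ((`|a| + 1) * `|x - c|) ^+ 2 = K * `|x - c| * (`|b| / 2 * `|x - c|).
  by rewrite /K; field; rewrite normr_eq0.
rewrite (ler_pM2r (mulr_gt0 nb xc0)).
by rewrite mulrC -ler_pdivlMr// ltW.
Qed.

(** Here A 1 - A 0 is int x^alpha v'^2 - lam int v^2, and the primitive V of v
vanishes at the nodes. With f and w the eigenfunction and its flux, the terms
added to A in F vanish at the nodes, and
F' = x^alpha (v' + lam x^-alpha V)^2 + lam (v + lam V f / w)^2 >= 0
between them, by w' = - lam f and f' = x^-alpha w. *)
Lemma nodal_poincare n (v v1 V A : R -> R) :
  let lam := lambda alpha n.+1 in
  continuous v ->
  (forall x : R, 0 < x -> der v x (v1 x)) ->
  (forall x : R, -1 < x -> der V x (v x)) ->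
  (forall k, (k <= n.+1)%N -> V (node n k) = 0) ->
  {within `[0 : R, 1], continuous A} ->
  (forall x : R, 0 < x < 1 -> der A x (x `^ alpha * v1 x ^+ 2 - lam * v x ^+ 2)) ->
  A 0 <= A 1.
Proof.
move=> lam cv dv dV Vn cA dA.
have lam0 : 0 < lam by exact: lambda_gt0.
pose w := ew alpha lam; pose f := ef alpha lam.
pose F (x : R) := A x + lam ^+ 2 * (V x ^+ 2 / w x * f x) + 2 * lam * (V x * v x).
have gtN1 (x : R) : 0 <= x -> -1 < x by move=> h; apply: lt_le_trans h; exact: ltrN10.
have cq (x : R) k : (k <= n)%N -> node n k <= x <= node n k.+1 ->
    {for x, continuous (fun x => V x ^+ 2 / w x)}.
  move=> kn /andP[kx xk]; have x0 := le_trans (node_ge0 n k) kx.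
  have atnode i : (i <= n.+1)%N -> {for node n i, continuous (fun x => V x ^+ 2 / w x)}.
    move=> ik; apply: (sqr_div_cont (dV _ (gtN1 _ (node_ge0 n i))) (ew_der_ge0 _ (node_ge0 n i))).
    - by apply: mulf_neq0; [rewrite oppr_eq0 gt_eqF|exact: ef_node].
    - exact: Vn.
    - exact: ew_node.
  move: kx; rewrite le_eqVlt => /predU1P[<-|kx]; first by apply: atnode; exact: leqW.
  move: xk; rewrite le_eqVlt => /predU1P[->|xk]; first exact: atnode.
  apply: der_cvg (derM (derX 2 (dV _ (gtN1 _ x0))) (derV _ (ew_der_ge0 _ x0))).
  by apply: (@ew_neq0 n k); rewrite kx.
have step k : (k <= n)%N -> A (node n k) <= A (node n k.+1).
  move=> kn.
  have FA i : (i <= n.+1)%N -> F (node n i) = A (node n i).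
    by move=> h; rewrite /F Vn// expr0n /= !(mul0r, mulr0) !addr0.
  rewrite -!FA//; last exact: leqW.
  have n1 := node_le1 (kn : (k.+1 <= n.+1)%N).
  pose F' (x : R) := x `^ alpha * (v1 x + lam * (x `^ alpha)^-1 * V x) ^+ 2 +
     lam * (v x + lam * V x * f x / w x) ^+ 2.
  apply: (@der_ge0_le _ F F') => //.
  - exact: ltW (node_lt n k).
  - apply/subspace_continuousP => x; rewrite /= in_itv/= => /andP[kx xk].
    have x0 := le_trans (node_ge0 n k) kx.
    have x01 : 0 <= x <= 1 by rewrite x0 (le_trans xk).
    have sub : within `[node n k, node n k.+1] (nbhs x) `=>` within `[0, 1] (nbhs x).
      move=> P; rewrite /within /=; apply: filterS => y h.
      rewrite in_itv/= => /andP[h1 h2]; apply: h; rewrite /= in_itv/=.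
      by rewrite (le_trans (node_ge0 n k) h1) (le_trans h2).
    apply: cvgD.
      apply: cvgD.
        have /subspace_continuousP /(_ x) h := cA.
        by apply: cvg_trans (h _) => //; [apply: cvg_app; exact: sub].
      apply: cvgM; first exact: cvg_cst.
      apply: cvgM; apply: cvg_within_filter.
        by apply: (cq _ k) => //; rewrite kx.
      exact: (@ef_cont _ _ halpha).
    apply: cvgM; first exact: cvg_cst.
    apply: cvg_within_filter; apply: cvgM; last exact: cv.
    exact: der_cvg (dV _ (gtN1 _ x0)).
  - move=> x kxk; have /andP[kx xk] := kxk.
    have x0 : 0 < x := le_lt_trans (node_ge0 n k) kx.
    have x1 : x < 1 := lt_le_trans xk n1.
    have w0 : w x != 0 := ew_neq0 kxk.
    have x01 : 0 < x < 1 by rewrite x0.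
    have dVx := dV _ (gtN1 _ (ltW x0)).
    have h := derD (derD (dA x x01) (derZ (lam ^+ 2) (derM (derM (derX 2 dVx)
       (derV w0 (ew_der halpha lam x0))) (ef_der halpha lam x0))))
      (derZ (2 * lam) (derM dVx (dv _ x0))).
    apply: (is_derive_eq h); rewrite /F' -/w -/f.
    have p0 : x `^ alpha != 0 by rewrite gt_eqF// powR_gt0.
    have -> : ed alpha lam x = w x / x `^ alpha.
      by rewrite /w -(ed_ew halpha lam (ltW x0)) mulrC mulKf.
    rewrite /=; move: (x `^ alpha) p0 w0 => p p0 w0.
    by field; rewrite p0 w0.
  - move=> x /andP[kx xk]; rewrite /F' addr_ge0//.
      by rewrite mulr_ge0 ?powR_ge0 ?sqr_ge0.
    by rewrite mulr_ge0 ?sqr_ge0 ?(ltW lam0).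
have all k : (k <= n.+1)%N -> A 0 <= A (node n k).
  by elim: k => [|k IH] kn //; apply: le_trans (IH (ltnW kn)) (step _ _).
by rewrite -[in leRHS](node_last n); exact: all.
Qed.

End NodalPoincare.

(** * Square-integrable functions and bilinear forms *)
Section L2Space.
Context {R : realType}.
Local Notation mu := (@lebesgue_measure R).
Implicit Types (u v w : R -> R) (c : R).

Let mI : measurable (@I01 R).
Proof. exact: measurable_itv. Qed.

Lemma I01P (x : R) : I01 x <-> 0 < x < 1.
Proof. by rewrite /I01 /= in_itv. Qed.

Lemma L2_measurable u : L2 u -> measurable_fun (@I01 R) u.
Proof.
rewrite /L2 /= inE => /andP[]; rewrite inE /= => h _.
exact/(measurable_restrictT u mI).
Qed.

Lemma integrable_I01 (f : R -> R) : mu.-integrable setT (EFin \o f) ->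
  mu.-integrable (@I01 R) (EFin \o f).
Proof. by move=> h; apply: integrableS h. Qed.

Lemma L2_integrable u v : L2 u -> L2 v ->
  mu.-integrable (@I01 R) (EFin \o (fun x => u x * v x)).
Proof.
move=> lu lv; have /Lfun1_integrable h := Lfun2_mul_Lfun1 lu lv.
apply: eq_integrable (integrable_I01 h) => // x xI.
by rewrite /= !patchE xI.
Qed.

(** Boundedness suffices as the interval has finite measure. *)
Lemma L2_bounded u c : measurable_fun (@I01 R) u -> (forall x, I01 x -> `|u x| <= c) -> L2 u.
Proof.
move=> mfu hu; rewrite /L2 /= inE; apply/andP; split.
  by rewrite inE /=; exact/(measurable_restrictT u mI).
rewrite inE /= /finite_norm unlock; apply: poweR_lty.
have muI : (mu (@I01 R) < +oo)%E by rewrite lebesgue_measure_itv /= lte_fin ltr01 oppr0 adde0 ltry.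
apply: (@le_lt_trans _ _ (\int[mu]_(x in @I01 R) (`|c| `^ 2)%:E)%E); last first.
  by rewrite integral_cst// lte_mul_pinfty.
rewrite [leRHS]integral_mkcond; apply: ge0_le_integral => //.
- by move=> x _; exact: poweR_ge0.
- change (measurable_fun setT (EFin \o (fun x => `|(u \_ I01) x| `^ 2))).
  apply/measurable_EFinP; apply: (measurableT_comp (measurable_powR _)) => //.
  by apply: measurableT_comp => //; exact/(measurable_restrictT u mI).
- apply/(measurable_restrictT _ mI); exact: measurable_cst.
- move=> x _.
  change ((`|(u \_ I01) x| `^ 2)%:E <= ((fun=> (`|c| `^ 2)%:E) \_ I01) x)%E.
  rewrite !patchE; case: ifPn => xI; last first.
    by rewrite normr0 powR0 // pnatr_eq0.
  rewrite lee_fin; apply: ge0_ler_powR; rewrite ?nnegrE//.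
  by apply: le_trans (hu x _) (ler_norm _); rewrite inE in xI.
Qed.

Lemma L2_cont u : continuous u -> L2 u.
Proof.
move=> cu.
have cn : {within `[0 : R, 1], continuous (fun x => `|u x|)}.
  apply: cont_within => x; apply: (@cvg_comp _ _ _ u (fun t => `|t|) _ (nbhs (u x))).
    exact: cu.
  exact: norm_continuous.
have [c _ hc] := EVT_max ler01 cn.
apply: (@L2_bounded _ `|u c|).
  by apply: measurable_funTS; exact: continuous_measurable_fun.
by move=> x /I01P /andP[x0 x1]; apply: hc; rewrite in_itv/= !ltW.
Qed.

Lemma L2D u v : L2 u -> L2 v -> L2 (fun x => u x + v x).
Proof.
rewrite /L2 /= => lu lv.
have -> : (fun x => u x + v x) \_ I01 = u \_ I01 + v \_ I01.
  by apply/funext => x; rewrite !fctE !patchE; case: ifP => _; rewrite ?addr0.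
have p1 : (1 <= 2%:E :> \bar R)%E by rewrite lee_fin ler1n.
have [_ h] := Lfun_addr_closed mu p1.
exact: h.
Qed.

Lemma L2Z c u : L2 u -> L2 (fun x => c * u x).
Proof.
rewrite /L2 /= => lu.
have -> : (fun x => c * u x) \_ I01 = c \o* (u \_ I01).
  by apply/funext => x; rewrite /= !patchE; case: ifP => _; rewrite ?mul0r// mulrC.
by apply: Lfun_scale => //; rewrite ler1n.
Qed.

Lemma L2B u v : L2 u -> L2 v -> L2 (fun x => u x - v x).
Proof.
move=> lu lv; have -> : (fun x => u x - v x) = (fun x => u x + (-1) * v x).
  by apply/funext => x; rewrite mulN1r.
by apply: L2D => //; exact: L2Z.
Qed.

Lemma eq_L2 u v : (forall x, I01 x -> u x = v x) -> L2 u -> L2 v.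
Proof.
rewrite /L2 /= => uv; suff -> : u \_ I01 = v \_ I01 by [].
by apply/funext => x; rewrite !patchE; case: ifPn => //; rewrite inE => /uv.
Qed.

Lemma eq_L2dot u1 u2 v1 v2 : (forall x, I01 x -> u1 x = u2 x) ->
  (forall x, I01 x -> v1 x = v2 x) -> L2dot u1 v1 = L2dot u2 v2.
Proof.
move=> hu hv; apply: eq_Rintegral => x; rewrite inE => xI.
by rewrite hu// hv.
Qed.

Lemma L2dotC u v : L2dot u v = L2dot v u.
Proof. by apply: eq_Rintegral => x _; rewrite mulrC. Qed.

Lemma L2dotDl u v w : L2 u -> L2 v -> L2 w ->
  L2dot (fun x => u x + v x) w = L2dot u w + L2dot v w.
Proof.
move=> lu lv lw; rewrite /L2dot -RintegralD//; [|exact: L2_integrable|exact: L2_integrable].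
by apply: eq_Rintegral => x _; rewrite mulrDl.
Qed.

Lemma L2dotZl c u w : L2 u -> L2 w -> L2dot (fun x => c * u x) w = c * L2dot u w.
Proof.
move=> lu lw; rewrite /L2dot -RintegralZl//; last exact: L2_integrable.
by apply: eq_Rintegral => x _; rewrite mulrA.
Qed.

Lemma L2dot_ge0 u : 0 <= L2dot u u.
Proof. by apply: Rintegral_ge0 => x _; rewrite -expr2 sqr_ge0. Qed.

Lemma L2dot_FTC u v (H h : R -> R) : continuous h -> {within `[0 : R, 1], continuous H} ->
  (forall x, 0 < x < 1 -> u x * v x = h x) ->
  (forall x : R, 0 < x < 1 -> der H x (h x)) -> L2dot u v = H 1 - H 0.
Proof.
move=> ch cH huv dH; rewrite -(@FTC _ H h 0 1 ler01 (cont_within ch) cH dH).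
by apply: eq_Rintegral => x; rewrite inE => /I01P xI; exact: huv.
Qed.

(** The L^2 product and the energy form, which live on different classes of
functions, share the orthogonal expansions derived from these rules. *)
Record bilin (P : (R -> R) -> Prop) (B : (R -> R) -> (R -> R) -> R) : Prop := Bilin {
  binD : forall u v, P u -> P v -> P (fun x => u x + v x);
  binZ : forall c u, P u -> P (fun x => c * u x);
  bilC : forall u v, B u v = B v u;
  bilD : forall u v w, P u -> P v -> P w -> B (fun x => u x + v x) w = B u w + B v w;
  bilZ : forall c u w, P u -> P w -> B (fun x => c * u x) w = c * B u w }.

Lemma bilin_L2dot : bilin (@L2 R) L2dot.
Proof.
split; [exact: L2D|exact: L2Z|exact: L2dotC|exact: L2dotDl|exact: L2dotZl].
Qed.

Section Bilin.
Context (P : (R -> R) -> Prop) (B : (R -> R) -> (R -> R) -> R) (hB : bilin P B).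

Lemma bilDr u v w : P u -> P v -> P w -> B w (fun x => u x + v x) = B w u + B w v.
Proof. by move=> pu pv pw; rewrite (bilC hB) (bilD hB)// !(bilC hB w). Qed.

Lemma bilZr c u w : P u -> P w -> B w (fun x => c * u x) = c * B w u.
Proof. by move=> pu pw; rewrite (bilC hB) (bilZ hB)// (bilC hB w). Qed.

Lemma bin_sum n (c : nat -> R) (e : nat -> R -> R) r : P r -> (forall i, P (e i)) ->
  P (fun x => \sum_(i < n) c i * e i x + r x).
Proof.
move=> pr pe; elim: n => [|n IH].
  by under eq_fun do rewrite big_ord0 add0r.
under eq_fun do rewrite big_ord_recr /= -addrA addrCA.
by apply: (binD hB) => //; exact: (binZ hB).
Qed.

Lemma bil_suml n (c : nat -> R) (e : nat -> R -> R) r w : P r -> P w -> (forall i, P (e i)) ->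
  B (fun x => \sum_(i < n) c i * e i x + r x) w = \sum_(i < n) c i * B (e i) w + B r w.
Proof.
move=> pr pw pe; elim: n => [|n IH].
  by rewrite big_ord0 add0r; congr B; apply/funext => x; rewrite big_ord0 add0r.
rewrite big_ord_recr /= -addrA addrCA -IH -(bilZ hB)//.
rewrite -(bilD hB)//; [|exact: (binZ hB)|exact: bin_sum].
by congr B; apply/funext => x; rewrite big_ord_recr /= -addrA addrCA.
Qed.

(** Pythagoras for a form that is diagonal on the [e i]. The diagonal is 1 for
the L^2 product and is made of the eigenvalues for the energy. *)
Lemma bil_quad n (c l : nat -> R) (e : nat -> R -> R) r : P r -> (forall i, P (e i)) ->
  (forall i j, (i < n)%N -> (j < n)%N -> B (e i) (e j) = (i == j)%:R * l i) ->
  (forall i, (i < n)%N -> B (e i) r = 0) ->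
  B (fun x => \sum_(i < n) c i * e i x + r x) (fun x => \sum_(i < n) c i * e i x + r x) =
  \sum_(i < n) c i ^+ 2 * l i + B r r.
Proof.
move=> pr pe he hr; have ps := bin_sum n c pr pe.
rewrite bil_suml//; congr (_ + _).
  apply: eq_bigr => i _; rewrite (bilC hB) bil_suml// (bilC hB r) hr// addr0.
  rewrite (bigD1 i)//= big1 ?addr0 => [|j ji].
    by rewrite he// eqxx mul1r expr2 mulrA.
  by rewrite he// (negbTE ji : (j == i :> nat) = false) mul0r mulr0.
rewrite (bilC hB) bil_suml// big1 ?add0r// => i _.
by rewrite hr ?mulr0.
Qed.

End Bilin.
End L2Space.

(** * Green formula and the tail estimate *)
Section TailEstimate.
Context {R : realType} (alpha : R) (halpha : 0 <= alpha < 1).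
Implicit Types (u v p q : R -> R).
Local Notation lam := (lambda alpha).

Let a0 : 0 <= alpha. Proof. by case/andP: halpha. Qed.

Lemma mul_cont u v : continuous u -> continuous v -> continuous (fun x => u x * v x).
Proof. by move=> cu cv x; apply: cvgM; [exact: cu|exact: cv]. Qed.

Lemma scale_cont (c : R) u : continuous u -> continuous (fun x => c * u x).
Proof. by move=> cu x; apply: cvgM; [exact: cvg_cst|exact: cu]. Qed.

Lemma add_cont u v : continuous u -> continuous v -> continuous (fun x => u x + v x).
Proof. by move=> cu cv x; apply: cvgD; [exact: cu|exact: cv]. Qed.

(** The weight of the energy, with the absolute value for continuity on the
line. *)
Definition wt (x : R) : R := `|x| `^ alpha.

Lemma wt_cont : continuous wt.
Proof.
have [al0|al0] := eqVneq alpha 0; last first.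
  by apply: norm_powR_cont; rewrite lt_neqAle eq_sym al0; exact: a0.
have -> : wt = fun=> 1 by apply/funext => x; rewrite /wt al0 powRr0.
by move=> x; exact: cvg_cst.
Qed.

Definition Dform u v : R := L2dot (fun x => wt x * u x) v.

Lemma bilin_Dform : bilin (fun u => continuous u) Dform.
Proof.
have cL u : continuous u -> L2 u := @L2_cont R u.
have wL u : continuous u -> L2 (fun x => wt x * u x).
  by move=> cu; apply: cL; apply: mul_cont => //; exact: wt_cont.
split.
- exact: add_cont.
- by move=> c u; exact: scale_cont.
- by move=> u v; apply: eq_Rintegral => x _; ring.
- move=> u v w cu cv cw; rewrite /Dform -L2dotDl; [|exact: wL|exact: wL|exact: cL].
  by apply: eq_L2dot => // x _; rewrite mulrDr.
- move=> c u w cu cw; rewrite /Dform -L2dotZl; [|exact: wL|exact: cL].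
  by apply: eq_L2dot => // x _; rewrite mulrCA.
Qed.

(** Turns inequalities between integrals into statements on derivatives. *)
Lemma L2dot_prim u v : continuous u -> continuous v ->
  exists P : R -> R, [/\ P 0 = 0, forall x : R, -1 < x -> der P x (u x * v x) & L2dot u v = P 1].
Proof.
move=> cu cv; have cuv := mul_cont cu cv.
have [P [P0 dP]] := primitive cuv.
have cP : {within `[0 : R, 1], continuous P}.
  apply: within_cont => x; rewrite inE/= in_itv/= => /andP[x0 _].
  by apply: der_cvg (dP _ _); apply: lt_le_trans x0; exact: ltrN10.
have dP' (x : R) : 0 < x < 1 -> der P x (u x * v x).
  by move=> /andP[x0 _]; apply: dP; apply: lt_trans x0; exact: ltrN10.
exists P; split => //.
by rewrite (L2dot_FTC cuv cP (fun x _ => erefl) dP') P0 subr0.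
Qed.

Lemma ew_1 n : ew alpha (lam n) 1 = 0.
Proof.
case: n => [|n]; first by rewrite /ew /= oppr0 !mul0r.
by rewrite -(node_last halpha n) ew_node.
Qed.

Lemma lam_lt i j : (i < j)%N -> lam i < lam j.
Proof.
case: j => // j; case: i => [|i] ij; first exact: lambda_gt0.
rewrite /lambda ltr_pM2l; last first.
  by rewrite exprn_gt0// /kappa divr_gt0//; case/andP: halpha => _ h; lra.
rewrite ltrXn2r ?nnegrE ?ltW ?jzero_gt0//.
by rewrite jzero_ltE.
Qed.

(** Integration by parts against the flux, whose boundary terms vanish at both
ends. Consequently the eigenfunctions diagonalize the energy form. *)
Lemma green n q q1 : continuous q -> continuous q1 -> (forall x : R, 0 < x -> der q x (q1 x)) ->
  Dform (ed alpha (lam n)) q1 = lam n * L2dot (ef alpha (lam n)) q.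
Proof.
move=> cq cq1 dq.
have cE := @ef_cont _ _ halpha (lam n); have cW := @ew_cont _ _ halpha (lam n).
have [P [P0 dP PE]] := L2dot_prim cW cq1.
have [Q [Q0 dQ QE]] := L2dot_prim cE cq.
have -> : Dform (ed alpha (lam n)) q1 = L2dot (ew alpha (lam n)) q1.
  apply: eq_L2dot => // x /I01P /andP[x0 _].
  by rewrite /wt gtr0_norm// (ed_ew halpha)// ltW.
rewrite PE QE.
pose H x := ew alpha (lam n) x * q x - P x + lam n * Q x.
have H0 : H 0 = 0 by rewrite /H P0 Q0 /ew mulr0 !mul0r mulr0 subr0 addr0.
have H1 : H 1 = lam n * Q 1 - P 1 by rewrite /H ew_1 mul0r sub0r addrC.
have : H 0 = H 1.
  apply: (@der_eq0 _ H 0 1 ler01).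
    apply: within_cont => x; rewrite inE/= in_itv/= => /andP[x0 _].
    have x1 : -1 < x by apply: lt_le_trans x0; exact: ltrN10.
    apply: cvgD; last by apply: cvgM; [exact: cvg_cst|exact: der_cvg (dQ _ x1)].
    by apply: cvgB; [apply: cvgM; [exact: cW|exact: cq]|exact: der_cvg (dP _ x1)].
  move=> x /andP[x0 _]; have x1 : -1 < x by apply: lt_trans x0; exact: ltrN10.
  apply: (is_derive_eq (derD (derB (derM (ew_der halpha (lam n) x0) (dq x x0)) (dP x x1)) (derZ (lam n) (dQ x x1)))).
  by ring.
rewrite H0 H1 => /esym/eqP; rewrite subr_eq0 => /eqP -> //.
Qed.

Lemma ef_sq_gt0 n : 0 < L2dot (ef alpha (lam n)) (ef alpha (lam n)).
Proof.
have cE := @ef_cont _ _ halpha (lam n).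
have [P [P0 dP PE]] := L2dot_prim cE cE; rewrite PE -P0.
have gt1 (x : R) : 0 <= x -> -1 < x by move=> x0; apply: lt_le_trans x0; exact: ltrN10.
have /cvgrPdist_lt /(_ 1 ltr01) [r /= r0 hr] := cE 0.
pose b := Num.min (r / 2) 2^-1.
have b0 : 0 < b by rewrite lt_min; apply/andP; split; lra.
have b1 : b <= 2^-1 by rewrite ge_min lexx orbT.
have br : b <= r / 2 by rewrite ge_min lexx.
apply: (@lt_le_trans _ _ (P b)).
  apply: (der_gt0_lt b0 _ (fun x h => dP x _)).
  - apply: within_cont => x; rewrite inE/= in_itv/= => /andP[x0 _].
    exact: der_cvg (dP _ (gt1 _ x0)).
  - by move=> x /andP[x0 _]; apply: gt1; exact: ltW.
  - move=> x /andP[x0 xb]; rewrite -expr2 lt_neqAle sqr_ge0 andbT eq_sym sqrf_eq0.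
    apply/eqP => e0; have := hr x; rewrite /ball_ /= sub0r normrN gtr0_norm// e0 (ef0 halpha).
    by rewrite subr0 normr1 ltxx => h; have // : false by apply: h; lra.
have b1' : b <= 1 by lra.
apply: (der_ge0_le b1' _ (fun x h => dP x _)).
- apply: within_cont => x; rewrite inE/= in_itv/= => /andP[x0 _].
  by apply: der_cvg (dP _ (gt1 _ _)); lra.
- by move=> x /andP[x0 _]; lra.
- by move=> x _; rewrite -expr2 sqr_ge0.
Qed.

Definition enrm n : R := L2norm (ef alpha (lam n)).
Definition ee n (x : R) : R := (enrm n)^-1 * ef alpha (lam n) x.
Definition ee' n (x : R) : R := (enrm n)^-1 * ed alpha (lam n) x.

Lemma enrm_gt0 n : 0 < enrm n.
Proof. by rewrite /enrm /L2norm sqrtr_gt0 ef_sq_gt0. Qed.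

Lemma ee_cont n : continuous (ee n).
Proof. by apply: scale_cont; exact: ef_cont. Qed.

Lemma ee'_cont n : continuous (ee' n).
Proof. by apply: scale_cont; exact: ed_cont. Qed.

Lemma ee_der n (x : R) : 0 < x -> der (ee n) x (ee' n x).
Proof. by move=> x0; apply: derZ; exact: ef_der. Qed.

Lemma green_ee n q q1 : continuous q -> continuous q1 -> (forall x : R, 0 < x -> der q x (q1 x)) ->
  Dform (ee' n) q1 = lam n * L2dot (ee n) q.
Proof.
move=> cq cq1 dq; rewrite (bilZ bilin_Dform) ?(green n cq cq1 dq)//; last exact: ed_cont.
rewrite (bilZ bilin_L2dot); [ring|by apply: L2_cont; exact: ef_cont|exact: L2_cont].
Qed.

(** The energy form is symmetric and, by Green's formula, equal to both
lam_i <e_i, e_j> and lam_j <e_i, e_j>; the eigenvalues are distinct. *)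
Lemma ee_orthonormal i j : L2dot (ee i) (ee j) = (i == j)%:R.
Proof.
have [<-|ij] := eqVneq i j.
  have cL := L2_cont (@ef_cont _ _ halpha (lam i)).
  rewrite (bilZ bilin_L2dot)//; last by apply: (L2Z _ cL).
  rewrite (bilZr bilin_L2dot)//.
  have -> : L2dot (ef alpha (lam i)) (ef alpha (lam i)) = enrm i ^+ 2.
    by rewrite sqr_sqrtr// L2dot_ge0.
  by rewrite /=; field; rewrite gt_eqF// enrm_gt0.
have h1 := green_ee i (@ee_cont j) (@ee'_cont j) (@ee_der j).
have h2 := green_ee j (@ee_cont i) (@ee'_cont i) (@ee_der i).
rewrite (bilC bilin_Dform) (L2dotC (ee j)) in h2.
have : (lam i - lam j) * L2dot (ee i) (ee j) = 0 by rewrite mulrBl -h1 -h2 subrr.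
move/eqP; rewrite mulf_eq0 subr_eq0 => /orP[/eqP l|/eqP-> //].
move: ij; rewrite neq_ltn => /orP[/lam_lt|/lam_lt]; by rewrite l ltxx.
Qed.

Lemma der_sum n (c : nat -> R) (F f : nat -> R -> R) (x : R) :
  (forall i, (i < n)%N -> der (F i) x (f i x)) ->
  der (fun y => \sum_(i < n) c i * F i y) x (\sum_(i < n) c i * f i x).
Proof.
elim: n => [|n IH] h.
  under [X in is_derive _ _ X _]eq_fun do rewrite big_ord0.
  by rewrite big_ord0; exact: der_cst.
under [X in is_derive _ _ X _]eq_fun do rewrite big_ord_recr /=.
rewrite big_ord_recr /=; apply: derD; last by apply: derZ; exact: h.
by apply: IH => i ni; apply: h; exact: leqW.
Qed.

Lemma nontrivial_kernel n (M : nat -> nat -> R) :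
  exists c : nat -> R, (exists2 i, (i < n.+2)%N & c i != 0) /\
    forall k, (k < n.+1)%N -> \sum_(i < n.+2) c i * M i k = 0.
Proof.
pose A : 'M[R]_(n.+2, n.+1) := \matrix_(i, k) M i k.
have kz : kermx A != 0.
  rewrite -mxrank_eq0 mxrank_ker subn_eq0 -ltnNge.
  exact: leq_trans (rank_leq_col A) _.
have /rowV0Pn[v vA v0] := kz; move/sub_kermxP: vA => vA.
exists (fun i => v 0 (inord i)); split.
  have [i vi] : exists i, v 0 i != 0.
    apply: contrapT => h; case/eqP: v0; apply/rowP => i; rewrite mxE.
    by apply/eqP; apply: contrapT => /negP vi; apply: h; exists i.
  by exists i => //; rewrite inord_val.
move=> k kn; have := congr1 (fun u : 'rV_n.+1 => u 0 (Ordinal kn)) vA.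
rewrite !mxE => vk; rewrite -[RHS]vk; apply: eq_bigr => i _.
by rewrite inord_val mxE.
Qed.

(** Let v = sum_i c_i e_i + c r be a nonzero combination with mean zero on the
pieces. Its two quadratic forms are diagonal, so the nodal inequality says
sum_i c_i^2 (lam_(n+1) - lam_i) <= c^2 (energy of r - lam_(n+1) |r|^2). The
left-hand side is nonnegative and vanishes only if all c_i do, so c is not 0
and the right-hand factor is nonnegative. *)
Lemma tail_estimate n p p1 : continuous p -> continuous p1 ->
  (forall x : R, 0 < x -> der p x (p1 x)) ->
  let r x := \sum_(i < n.+1) - L2dot p (ee i) * ee i x + p x in
  lam n.+1 * L2dot r r <= Dform p1 p1.
Proof.
move=> cp cp1 dp; pose b i := L2dot p (ee i).
pose r (x : R) := \sum_(i < n.+1) - b i * ee i x + p x; rewrite /= -/b -/r.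
pose r1 (x : R) := \sum_(i < n.+1) - b i * ee' i x + p1 x.
have Bc := bilin_Dform; have Bl := @bilin_L2dot R.
have cr : continuous r := bin_sum Bc n.+1 (fun i => - b i) cp (fun i => @ee_cont i).
have cr1 : continuous r1 := bin_sum Bc n.+1 (fun i => - b i) cp1 (fun i => @ee'_cont i).
have dr (x : R) : 0 < x -> der r x (r1 x).
  move=> x0.
  exact: derD (@der_sum n.+1 (fun i => - b i) ee ee' x (fun i _ => ee_der i x0)) (dp x x0).
have Le i : L2 (ee i) by apply: L2_cont; exact: ee_cont.
have Lr : L2 r by exact: L2_cont.
have Lp : L2 p by exact: L2_cont.
have er i : (i < n.+1)%N -> L2dot (ee i) r = 0.
  move=> ni; rewrite L2dotC (bil_suml Bl n.+1 (fun i => - b i) Lp (Le i) Le).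
  rewrite (bigD1 (Ordinal ni))//= big1 ?addr0 => [|j ji].
    by rewrite ee_orthonormal eqxx mulr1 addrC subrr.
  by rewrite ee_orthonormal (negbTE (ji : (j != i :> nat))) mulr0.
have er1 i : (i < n.+1)%N -> Dform (ee' i) r1 = 0.
  by move=> ni; rewrite (green_ee i cr cr1 dr) er// mulr0.
have ee1 i j : Dform (ee' i) (ee' j) = (i == j)%:R * lam i.
  by rewrite (green_ee i (@ee_cont j) (@ee'_cont j) (@ee_der j)) ee_orthonormal mulrC.
(* By Green's formula r1 is orthogonal to the ee' i for the energy, so the
   projection does not increase the energy. *)
have Dr : Dform r1 r1 <= Dform p1 p1.
  have -> : p1 = (fun x => \sum_(i < n.+1) b i * ee' i x + r1 x).
    apply/funext => x; rewrite /r1 addrA -big_split /= big1 ?add0r// => i _.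
    by rewrite mulNr subrr.
  rewrite (bil_quad (l := lam) Bc b cr1 ee'_cont)//.
  rewrite lerDr sumr_ge0// => i _; rewrite mulr_ge0 ?sqr_ge0//.
  by case: (nat_of_ord i) => [|k] //; rewrite ltW// lambda_gt0.
have [|Nr] := leP (L2dot r r) 0.
  move=> h; apply: le_trans Dr; have -> : L2dot r r = 0.
    by apply/eqP; rewrite eq_le h L2dot_ge0.
  rewrite mulr0; apply: Rintegral_ge0 => x _; rewrite -mulrA -expr2.
  by rewrite mulr_ge0 ?powR_ge0 ?sqr_ge0.
(* The n + 2 functions e_0, ..., e_n, r have a nontrivial combination v whose
   integral V from 0 vanishes at the n + 1 positive nodes: v has mean zero on
   each piece. *)
pose vs i := if (i < n.+1)%N then ee i else r.
pose vs1 i := if (i < n.+1)%N then ee' i else r1.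
have cvs i : continuous (vs i) by rewrite /vs; case: ifP => _; [exact: ee_cont|].
have cvs1 i : continuous (vs1 i) by rewrite /vs1; case: ifP => _; [exact: ee'_cont|].
have dvs i (x : R) : 0 < x -> der (vs i) x (vs1 i x).
  by rewrite /vs /vs1; case: ifP => _ x0; [exact: ee_der|exact: dr].
have [W hW] := choice (fun i => primitive (cvs i)).
have [c [[i0 i0n ci0] hc]] := nontrivial_kernel n (fun i k => W i (node alpha n k.+1)).
pose V (x : R) := \sum_(i < n.+2) c i * W i x.
pose v (x : R) := \sum_(i < n.+2) c i * vs i x.
pose v1 (x : R) := \sum_(i < n.+2) c i * vs1 i x.
have cz : continuous (fun _ : R => 0 : R) by move=> x; exact: cvg_cst.
have cv : continuous v.
  have -> : v = fun x => \sum_(i < n.+2) c i * vs i x + 0.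
    by apply/funext => x; rewrite addr0.
  exact: (bin_sum Bc n.+2 c cz cvs).
have cv1 : continuous v1.
  have -> : v1 = fun x => \sum_(i < n.+2) c i * vs1 i x + 0.
    by apply/funext => x; rewrite addr0.
  exact: (bin_sum Bc n.+2 c cz cvs1).
have dv (x : R) : 0 < x -> der v x (v1 x) by move=> x0; exact: (@der_sum n.+2 c vs vs1 x (fun i _ => dvs i x x0)).
have dV (x : R) : -1 < x -> der V x (v x).
  by move=> x1; exact: (@der_sum n.+2 c W vs x (fun i _ => (hW i).2 x x1)).
have Vn k : (k <= n.+1)%N -> V (node alpha n k) = 0.
  case: k => [|k] kn; last exact: hc.
  by rewrite /V big1// => i _; have [-> _] := hW i; rewrite mulr0.
have [P [P0 dP PE]] := L2dot_prim (mul_cont wt_cont cv1) cv1.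
have [Q [Q0 dQ QE]] := L2dot_prim cv cv.
have gt1 (x : R) : 0 <= x -> -1 < x by move=> x0; apply: lt_le_trans x0; exact: ltrN10.
have : P 0 - lam n.+1 * Q 0 <= P 1 - lam n.+1 * Q 1.
  apply: (@nodal_poincare _ _ halpha n v v1 V (fun x => P x - lam n.+1 * Q x)) => //.
    apply: within_cont => x; rewrite inE/= in_itv/= => /andP[x0 _].
    by apply: der_cvg (derB (dP _ (gt1 _ x0)) (derZ _ (dQ _ (gt1 _ x0)))).
  move=> x /andP[x0 _].
  apply: (is_derive_eq (derB (dP _ (gt1 _ (ltW x0))) (derZ (lam n.+1) (dQ _ (gt1 _ (ltW x0)))))).
  by rewrite /wt gtr0_norm//; ring.
rewrite P0 Q0 mulr0 subr0 subr_ge0 -PE -QE -/(Dform v1 v1) => key.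
have vE : v = fun x => \sum_(i < n.+1) c i * ee i x + c n.+1 * r x.
  apply/funext => x; rewrite /v big_ord_recr /= /vs ltnn; congr (_ + _).
  by apply: eq_bigr => i _; rewrite ltn_ord.
have v1E : v1 = fun x => \sum_(i < n.+1) c i * ee' i x + c n.+1 * r1 x.
  apply/funext => x; rewrite /v1 big_ord_recr /= /vs1 ltnn; congr (_ + _).
  by apply: eq_bigr => i _; rewrite ltn_ord.
have Lcr : L2 (fun x => c n.+1 * r x) by exact: L2Z.
have Ccr1 : continuous (fun x => c n.+1 * r1 x) by exact: scale_cont.
have qv : L2dot v v = \sum_(i < n.+1) c i ^+ 2 + c n.+1 ^+ 2 * L2dot r r.
  rewrite vE (bil_quad (l := fun=> 1) Bl c Lcr Le).
  - congr (_ + _); first by apply: eq_bigr => i _; rewrite mulr1.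
    by rewrite (bilZ Bl)// (bilZr Bl)//; ring.
  - by move=> i j _ _; rewrite ee_orthonormal mulr1.
  - by move=> i ni; rewrite (bilZr Bl)// er// mulr0.
have qD : Dform v1 v1 = \sum_(i < n.+1) c i ^+ 2 * lam i + c n.+1 ^+ 2 * Dform r1 r1.
  rewrite v1E (bil_quad (l := lam) Bc c Ccr1 ee'_cont).
  - congr (_ + _).
    by rewrite (bilZ Bc)// (bilZr Bc)//; ring.
  - by move=> i j _ _; exact: ee1.
  - by move=> i ni; rewrite (bilZr Bc) ?er1 ?mulr0//; exact: ee'_cont.
rewrite qv qD in key.
have {}key : \sum_(i < n.+1) c i ^+ 2 * (lam n.+1 - lam i) <=
    c n.+1 ^+ 2 * (Dform r1 r1 - lam n.+1 * L2dot r r).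
  have -> : \sum_(i < n.+1) c i ^+ 2 * (lam n.+1 - lam i) =
     lam n.+1 * \sum_(i < n.+1) c i ^+ 2 - \sum_(i < n.+1) c i ^+ 2 * lam i.
    by rewrite mulr_sumr -sumrB; apply: eq_bigr => i _; ring.
  lra.
have pos (i : 'I_n.+1) : 0 <= c i ^+ 2 * (lam n.+1 - lam i).
  by rewrite mulr_ge0 ?sqr_ge0// subr_ge0 ltW// lam_lt.
have [cn|cn] := eqVneq (c n.+1) 0.
  (* Without r, the left-hand side of key is a sum of nonnegative terms that
     is at most 0, so all the coefficients would vanish. *)
  exfalso; move: key; rewrite cn expr0n /= mul0r => key.
  have s0 : \sum_(i < n.+1) c i ^+ 2 * (lam n.+1 - lam i) == 0.
    by rewrite eq_le key sumr_ge0.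
  move: i0n ci0; rewrite ltnS leq_eqVlt => /predU1P[->|i0n]; first by rewrite cn eqxx.
  move: s0; rewrite psumr_eq0 => [/allP /(_ (Ordinal i0n))|i _]; last exact: pos.
  rewrite mem_index_enum /= => /(_ isT); rewrite mulf_eq0 sqrf_eq0 => /orP[->//|].
  by rewrite subr_eq0 (gt_eqF (lam_lt i0n)).
apply: le_trans Dr; rewrite -subr_ge0.
have c2 : 0 < c n.+1 ^+ 2 by rewrite lt_neqAle sqr_ge0 andbT eq_sym sqrf_eq0.
by rewrite -(pmulr_rge0 _ c2); apply: le_trans key; apply: sumr_ge0.
Qed.

End TailEstimate.

(** * Density of continuously differentiable functions *)
Section Density.
Context {R : realType}.
Local Notation mu := (@lebesgue_measure R).
Implicit Types (u v p q : R -> R).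

Let mI : measurable (@I01 R).
Proof. exact: measurable_itv. Qed.

Definition nsq u : R := L2dot u u.

Lemma integrable_cst01 (c : R) : mu.-integrable (@I01 R) (EFin \o (fun=> c)).
Proof.
have h : {within `[0 : R, 1], continuous (fun=> c : R)}.
  by apply: within_cont => x _; exact: cvg_cst.
by apply: integrableS (cont_integrable h) => //; exact: subset_itv_oo_cc.
Qed.

Lemma dct0 (f : nat -> R -> R) (g : R -> R) :
  (forall n, measurable_fun (@I01 R) (f n)) ->
  mu.-integrable (@I01 R) (EFin \o g) ->
  (forall n x, I01 x -> `|f n x| <= g x) ->
  (forall x, I01 x -> f n x @[n --> \oo] --> 0) ->
  \int[mu]_(x in @I01 R) f n x @[n --> \oo] --> 0.
Proof.
move=> mf ig fg f0.
have [|||||_ _] := @dominated_convergence _ _ R mu (@I01 R) mI (fun n x => (f n x)%:E)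
  (cst 0%E) (EFin \o g).
- by move=> n; apply/measurable_EFinP; exact: mf.
- exact: measurable_cst.
- by apply: aeW => x xI; apply/cvg_EFin; [near=> n|exact: f0].
- exact: ig.
- by apply: aeW => x n xI; rewrite /= lee_fin; exact: fg.
rewrite integral0 => h.
exact: (fine_cvg h).
Unshelve. all: by end_near. Qed.

Lemma clamp_continuous (a b : R) : continuous (clamp a b).
Proof.
move=> x; apply/cvgrPdist_lt => e e0; exists e => // y /= xy.
exact: le_lt_trans (clamp_lip _ _ _ _) xy.
Qed.

Lemma measurable_clamp (a b : R) u : measurable_fun (@I01 R) u ->
  measurable_fun (@I01 R) (fun x => clamp a b (u x)).
Proof.
move=> mfu; apply: measurableT_comp => //.
exact: continuous_measurable_fun (@clamp_continuous a b).
Qed.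

Lemma nsq_int u : L2 u -> mu.-integrable (@I01 R) (EFin \o (fun x => u x * u x)).
Proof. by move=> lu; exact: L2_integrable. Qed.

(** By the parallelogram identity. *)
Lemma nsqD u v : L2 u -> L2 v -> nsq (fun x => u x + v x) <= 2 * nsq u + 2 * nsq v.
Proof.
move=> lu lv; have Bl := @bilin_L2dot R.
have h : nsq (fun x => u x - v x) + nsq (fun x => u x + v x) = 2 * nsq u + 2 * nsq v.
  have -> : (fun x => u x - v x) = (fun x => u x + (-1) * v x).
    by apply/funext => x; rewrite mulN1r.
  have lv' : L2 (fun x => -1 * v x) by exact: L2Z.
  rewrite /nsq !(bilD Bl)//; [|exact: L2D|exact: L2D].
  by rewrite !(bilDr Bl)// !(bilZ Bl)// !(bilZr Bl)// (L2dotC v u); ring.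
by rewrite -h lerDr L2dot_ge0.
Qed.

Lemma L2_int1 u : L2 u -> mu.-integrable (@I01 R) (EFin \o u).
Proof.
move=> lu; have c1 : L2 (fun=> 1 : R) by apply: L2_cont => x; exact: cvg_cst.
by apply: eq_integrable (L2_integrable lu c1) => // x _; rewrite /= mulr1.
Qed.

Lemma approx_bounded u (e : R) : L2 u -> 0 < e ->
  exists N : R, 0 < N /\ nsq (fun x => u x - clamp (- N) N (u x)) < e.
Proof.
move=> lu e0; have mfu := L2_measurable lu.
pose f n x := (u x - clamp (- n.+1%:R) n.+1%:R (u x)) * (u x - clamp (- n.+1%:R) n.+1%:R (u x)).
have small (N y : R) : 0 <= N -> `|y - clamp (- N) N y| <= `|y|.
  move=> N0; rewrite /clamp; case: (leP y N) => h; [case: (leP (- N) y) => h2|case: (leP (- N) N) => h2];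
    rewrite ler_norml; case: (ger0P y) => h3; apply/andP; split; lra.
have : \int[mu]_(x in @I01 R) f n x @[n --> \oo] --> 0.
  apply: (@dct0 f (fun x => u x * u x)).
  - move=> n; have mc := @measurable_clamp (- n.+1%:R) n.+1%:R _ mfu.
    by apply: measurable_funM; apply: measurable_funB.
  - exact: nsq_int.
  - move=> n x xI; rewrite /f normrM -[leRHS]ger0_norm -?expr2 ?sqr_ge0//.
    by rewrite expr2 normrM; apply: ler_pM => //; exact: small.
  - move=> x xI; apply: cvg_near_cst; exists (Num.truncn `|u x|) => // n /= nx.
    have h : `|u x| < n.+1%:R.
      have /andP[_ h] := truncn_itv (normr_ge0 (u x)).
      by apply: lt_le_trans h _; rewrite ler_nat ltnS.
    rewrite /f clampE ?subrr ?mulr0//.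
    by move: h; rewrite ltr_norml => /andP[h1 h2]; rewrite !ltW.
move/cvgrPdist_lt => /(_ e e0) [n _ /(_ n (leqnn n))] /=; rewrite sub0r normrN => h.
exists n.+1%:R; split=> //; apply: le_lt_trans h; exact: ler_norm.
Qed.

(** After truncation, an approximation in L^1 by continuous functions suffices:
between functions bounded by N, the squared L^2 distance is at most 2 N times
the L^1 distance. *)
Lemma approx_continuous u (e : R) : L2 u -> 0 < e ->
  exists g (N : R), [/\ continuous g, 0 < N, forall x, `|g x| <= N & nsq (fun x => u x - g x) < e].
Proof.
move=> lu e0; have e4 : 0 < e / 4 by rewrite divr_gt0.
have [N [N0 hN]] := approx_bounded lu e4.
have NN : - N <= N by lra.
have mfu := L2_measurable lu.
pose w x := clamp (- N) N (u x).
have mw : measurable_fun (@I01 R) w by exact: measurable_clamp.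
have cN y : `|clamp (- N) N y| <= N by rewrite ler_norml clamp_itv.
have Lw : L2 w by apply: (@L2_bounded _ _ N) => // x _; exact: cN.
have iw := L2_int1 Lw.
have muI : (mu (@I01 R) < +oo)%E by rewrite lebesgue_measure_itv /= lte_fin ltr01 oppr0 adde0 ltry.
have [G [cG iG hG]] := approximation_continuous_integrable mI muI iw.
have d0 : 0 < e / (8 * N) by rewrite divr_gt0// mulr_gt0.
have iwG n : mu.-integrable (@I01 R) (EFin \o (fun x => `|w x - G n x|)).
  exact: (integrable_norm (L2_int1 (L2B Lw (L2_cont (cG n))))).
have [n hn] : exists n, \int[mu]_(x in @I01 R) `|w x - G n x| < e / (8 * N).
  have : \int[mu]_(x in @I01 R) `|w x - G n x| @[n --> \oo] --> 0 by exact: (fine_cvg hG).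
  move/cvgrPdist_lt => /(_ _ d0) [n _ /(_ n (leqnn n))].
  rewrite /= sub0r normrN => h; exists n; apply: le_lt_trans h; exact: ler_norm.
pose g x := clamp (- N) N (G n x).
have cg : continuous g.
  move=> x; apply: (@cvg_comp _ _ _ (G n) (clamp (- N) N) _ (nbhs (G n x))).
    exact: cG.
  exact: clamp_continuous.
exists g, N; split => //; first by move=> x; exact: cN.
have Lg := L2_cont cg.
have ug : (fun x => u x - g x) = (fun x => (u x - w x) + (w x - g x)).
  by apply/funext => x; ring.
have Lwg : L2 (fun x => w x - g x) by exact: L2B.
have wg : nsq (fun x => w x - g x) <= e / 4.
  apply: (@le_trans _ _ (\int[mu]_(x in @I01 R) (2 * N * `|w x - G n x|))).
    apply: le_Rintegral => //; first exact: nsq_int.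
      have h := integrableZl _ (2 * N) (iwG n); apply: eq_integrable (h _) => //.
    move=> x xI; rewrite -expr2 -real_normK ?num_real// expr2; apply: ler_pM => //.
      apply: le_trans (ler_normB _ _) _.
      have := cN (u x); have := cN (G n x); rewrite -/(w x) -/(g x); lra.
    have wE : w x = clamp (- N) N (w x) by rewrite (@clampE _ _ _ (w x))// clamp_itv.
    by rewrite {1}wE; exact: clamp_lip.
  rewrite RintegralZl//.
  have : 2 * N * (\int[mu]_(x in @I01 R) `|w x - G n x|) <= 2 * N * (e / (8 * N)).
    by rewrite ler_pM2l ?mulr_gt0// ltW.
  by have -> : 2 * N * (e / (8 * N)) = e / 4 by field; rewrite gt_eqF.
rewrite ug; apply: le_lt_trans (nsqD _ Lwg) _; first exact: L2B.
lra.
Qed.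

(** The averages of [g] over [x, x + 1/n] are differentiable for x > 0, and by
the mean value theorem they are values of [g] near [x]: they converge pointwise
and are bounded by [N]. The primitive of [g] is known to the right of -1 only;
the positive part makes the averages continuous on the whole line. *)
Lemma approx_C1 g (N e : R) : continuous g -> (forall x, `|g x| <= N) -> 0 < e ->
  exists p p1 : R -> R, [/\ continuous p, continuous p1,
    forall x : R, 0 < x -> der p x (p1 x) & nsq (fun x => g x - p x) < e].
Proof.
move=> cg gN e0; have [G [_ dG]] := primitive cg.
pose pos (x : R) := Num.max 0 x.
have posE x : 0 <= x -> pos x = x by move=> x0; rewrite /pos (max_idPr x0).
have pos0 x : 0 <= pos x by rewrite /pos le_max lexx.
have cpos : continuous pos.
  by move=> x; apply: continuous_max; [exact: cvg_cst|exact: cvg_id].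
have gt1 (x : R) : 0 <= x -> -1 < x by move=> x0; apply: lt_le_trans x0; exact: ltrN10.
pose p n (x : R) : R := n.+1%:R * (G (pos x + n.+1%:R^-1) - G (pos x)).
pose p1 n (x : R) : R := n.+1%:R * (g (x + n.+1%:R^-1) - g x).
have n0 n : 0 < n.+1%:R^-1 :> R by rewrite invr_gt0.
have cp n : continuous (p n).
  move=> x; apply: cvgM; first exact: cvg_cst.
  apply: cvgB.
    apply: (@cvg_comp _ _ _ (fun x : R => pos x + n.+1%:R^-1) G _ (nbhs (pos x + n.+1%:R^-1))).
      by apply: cvgD; [exact: cpos|exact: cvg_cst].
    by apply: der_cvg (dG _ (gt1 _ _)); rewrite addr_ge0// ltW.
  apply: (@cvg_comp _ _ _ pos G _ (nbhs (pos x))); first exact: cpos.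
  exact: der_cvg (dG _ (gt1 _ (pos0 x))).
have cs n : continuous (fun x : R => g (x + n.+1%:R^-1)).
  move=> x; apply: (@cvg_comp _ _ _ (fun x : R => x + n.+1%:R^-1) g _ (nbhs (x + n.+1%:R^-1))).
    by apply: cvgD; [exact: cvg_id|exact: cvg_cst].
  exact: cg.
have cp1 n : continuous (p1 n).
  by move=> x; apply: cvgM; [exact: cvg_cst|apply: cvgB; [exact: cs|exact: cg]].
have dp n (x : R) : 0 < x -> der (p n) x (p1 n x).
  move=> x0; apply: (@der_near _ (fun x : R => n.+1%:R * (G (x + n.+1%:R^-1) - G x))).
    near=> y; rewrite /p posE// ltW//; near: y; exact: lt_nbhsr.
  apply: derZ; apply: derB; last exact: dG (gt1 _ (ltW x0)).
  by apply: shift_der; apply: dG; apply: gt1; rewrite addr_ge0// ltW.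
have mean n (x : R) : 0 <= x -> exists2 y, x <= y <= x + n.+1%:R^-1 & p n x = g y.
  move=> x0; have xn : x <= x + n.+1%:R^-1 by rewrite lerDl ltW.
  have h1 y : y \in `]x, x + n.+1%:R^-1[%R -> der G y (g y).
    by rewrite in_itv/= => /andP[xy _]; apply: dG; apply: gt1; rewrite ltW// (le_lt_trans x0).
  have [|y yI e1] := MVT_segment xn h1.
    apply: within_cont => y; rewrite inE/= in_itv/= => /andP[xy _].
    by apply: der_cvg (dG _ (gt1 _ _)); exact: le_trans xy.
  exists y; first by move: yI; rewrite in_itv.
  rewrite /p posE// e1 [x + _ - x]addrAC subrr add0r mulrCA mulfV ?mulr1//.
have : \int[mu]_(x in @I01 R) ((g x - p n x) * (g x - p n x)) @[n --> \oo] --> 0.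
  apply: (@dct0 (fun n x => (g x - p n x) * (g x - p n x)) (fun=> (2 * N) ^+ 2)).
  - move=> n; apply: measurable_funTS; apply: continuous_measurable_fun.
    have cgp : continuous (fun x => g x - p n x) by move=> x; apply: cvgB; [exact: cg|exact: cp].
    exact: mul_cont.
  - exact: integrable_cst01.
  - move=> n x /I01P /andP[x0 _]; have [y _ ->] := mean n x (ltW x0).
    rewrite normrM expr2; have h : `|g x - g y| <= 2 * N.
      by apply: le_trans (ler_normB _ _) _; have := gN x; have := gN y; lra.
    exact: ler_pM.
  - move=> x /I01P /andP[x0 _].
    have h : (g x - p n x) @[n --> \oo] --> 0.
      apply/cvgrPdist_lt => d d0.
      have /cvgrPdist_lt /(_ _ d0) [r /= r0 hr] := cg x.
      exists (Num.truncn r^-1) => // n /= nr.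
      have [y /andP[xy yx] ->] := mean n x (ltW x0).
      rewrite sub0r normrN; apply: hr; rewrite /ball_ /= distrC ger0_norm ?subr_ge0//.
      have r1 : 0 < r^-1 by rewrite invr_gt0.
      have /andP[_ h] := truncn_itv (ltW r1).
      have h2 : r^-1 < n.+1%:R by apply: lt_le_trans h _; rewrite ler_nat ltnS.
      have h3 : n.+1%:R^-1 < r by rewrite -[r]invrK ltf_pV2 ?posrE.
      by apply: le_lt_trans h3; rewrite lerBlDl.
    by rewrite -(mulr0 0); apply: cvgM.
move/cvgrPdist_lt => /(_ e e0) [n _ /(_ n (leqnn n))] /=; rewrite sub0r normrN => h.
exists (p n), (p1 n); split; [exact: cp|exact: cp1|exact: dp|].
apply: le_lt_trans h; exact: ler_norm.
Unshelve. all: by end_near. Qed.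

Lemma L2_dense u (e : R) : L2 u -> 0 < e ->
  exists p p1 : R -> R, [/\ continuous p, continuous p1,
    forall x : R, 0 < x -> der p x (p1 x) & nsq (fun x => u x - p x) < e].
Proof.
move=> lu e0; have e4 : 0 < e / 4 by rewrite divr_gt0.
have [g [N [cg N0 gN hg]]] := approx_continuous lu e4.
have [p [p1 [cp cp1 dp hp]]] := approx_C1 cg gN e4.
exists p, p1; split => //.
have -> : (fun x => u x - p x) = (fun x => (u x - g x) + (g x - p x)).
  by apply/funext => x; ring.
have Lg := L2_cont cg; have Lp := L2_cont cp.
apply: le_lt_trans (nsqD (L2B lu Lg) (L2B Lg Lp)) _; lra.
Qed.

End Density.

(** * Completeness of the eigenfunctions *)
Section Completeness.
Context {R : realType} (alpha : R) (halpha : 0 <= alpha < 1).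
Implicit Types (u p : R -> R).
Local Notation lam := (lambda alpha).
Local Notation ee := (ee alpha).

Let Le i : L2 (ee i).
Proof. by apply: L2_cont; exact: ee_cont. Qed.

(** The difference of the two remainders lies in the span of the e_i, to which
the first one is orthogonal. *)
Lemma best_approx n u (c : nat -> R) : L2 u ->
  nsq (fun x => \sum_(i < n) - L2dot u (ee i) * ee i x + u x) <=
  nsq (fun x => \sum_(i < n) - c i * ee i x + u x).
Proof.
move=> lu; have Bl := @bilin_L2dot R; pose b i := L2dot u (ee i).
pose r x := \sum_(i < n) - b i * ee i x + u x.
have Lr : L2 r := bin_sum Bl n (fun i => - b i) lu Le.
have er i : (i < n)%N -> L2dot (ee i) r = 0.
  move=> ni; rewrite L2dotC (bil_suml Bl n (fun i => - b i) lu (Le i) Le).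
  rewrite (bigD1 (Ordinal ni))//= big1 ?addr0 => [|j ji].
    by rewrite (ee_orthonormal halpha) eqxx mulr1 addrC subrr.
  by rewrite (ee_orthonormal halpha) (negbTE (ji : (j != i :> nat))) mulr0.
have -> : (fun x => \sum_(i < n) - c i * ee i x + u x) =
    (fun x => \sum_(i < n) (b i - c i) * ee i x + r x).
  apply/funext => x; rewrite /r addrA -big_split /=; congr (_ + _).
  by apply: eq_bigr => i _; ring.
rewrite /nsq (bil_quad (l := fun=> 1) Bl (fun i => b i - c i) Lr Le) //.
  by rewrite lerDr sumr_ge0// => i _; rewrite mulr1 sqr_ge0.
by move=> i j _ _; rewrite (ee_orthonormal halpha) mulr1.
Qed.

Lemma lam_big n : kappa alpha ^+ 2 * n%:R <= lam n.+1.
Proof.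
rewrite /lambda; have k0 : 0 <= kappa alpha ^+ 2 by exact: sqr_ge0.
rewrite ler_wpM2l//; have := zeros_big (ord_ge halpha) (jzero_zeros halpha) n.
have p2 : 2 <= pi :> R by exact: pi_ge2.
move=> h; have h1 : n%:R <= jzero alpha n.+1.
  by apply: le_trans h; rewrite ler_peMr//; lra.
apply: (@le_trans _ _ (n%:R ^+ 2)); last by rewrite lerXn2r ?nnegrE// (le_trans _ h1).
by rewrite -natrX ler_nat; case: n {h h1} => // n; rewrite expnS expn1 leq_pmulr.
Qed.

(** The remainder of u is at most that of a C^1 approximation p plus u - p, and
the tail estimate bounds the former by the energy of p over lam_(n+1). *)
Lemma ee_complete u : L2 u ->
  nsq (fun x => \sum_(i < n) - L2dot u (ee i) * ee i x + u x) @[n --> \oo] --> 0.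
Proof.
move=> lu; apply/cvgrPdist_lt => e e0; have e4 : 0 < e / 4 by rewrite divr_gt0.
have [p [p1 [cp cp1 dp hp]]] := L2_dense lu e4.
have Lp := L2_cont cp.
have k2 : 0 < kappa alpha ^+ 2.
  by rewrite exprn_gt0// /kappa divr_gt0//; case/andP: halpha => _ h; lra.
pose D := Dform alpha p1 p1.
have D0 : 0 <= D.
  apply: Rintegral_ge0 => x _; rewrite -mulrA -expr2.
  by rewrite mulr_ge0 ?powR_ge0 ?sqr_ge0.
pose N := (Num.truncn (4 * D / e / kappa alpha ^+ 2)).+1.
exists N.+1 => // -[|n] //= Nn.
rewrite sub0r normrN ger0_norm ?L2dot_ge0//.
apply: le_lt_trans (best_approx n.+1 (fun i => L2dot p (ee i)) lu) _.
pose r x := \sum_(i < n.+1) - L2dot p (ee i) * ee i x + p x.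
have Lr : L2 r := bin_sum (@bilin_L2dot R) n.+1 (fun i => - L2dot p (ee i)) Lp Le.
have -> : (fun x => \sum_(i < n.+1) - L2dot p (ee i) * ee i x + u x) =
   (fun x => (u x - p x) + r x) by apply/funext => x; rewrite /r; ring.
apply: le_lt_trans (nsqD (L2B lu Lp) Lr) _.
have h := tail_estimate halpha n cp cp1 dp; rewrite /= -/r -/D in h.
have ln : 4 * D / e < lam n.+1.
  apply: lt_le_trans (lam_big n); rewrite [ltRHS]mulrC -ltr_pdivrMr//.
  have h0 : 0 <= 4 * D / e / kappa alpha ^+ 2.
    by rewrite divr_ge0 ?(ltW k2)// divr_ge0 ?(ltW e0)// mulr_ge0.
  have /andP[_ h2] := truncn_itv h0.
  by apply: lt_le_trans h2 _; rewrite ler_nat.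
have l0 : 0 < lam n.+1 by exact: lambda_gt0.
have : nsq r <= e / 4.
  rewrite -(ler_pM2l l0); apply: (le_trans h).
  move: ln; rewrite ltr_pdivrMr// => ln; lra.
lra.
Qed.

End Completeness.

(** * Eigenpairs and gaps *)
Section Spectrum.
Context {R : realType} (alpha : R) (halpha : 0 <= alpha < 1).
Local Notation mu := (@lebesgue_measure R).
Local Notation lam := (lambda alpha).

Let k0 : 0 < kappa alpha.
Proof. by rewrite /kappa divr_gt0//; case/andP: halpha => _ h; lra. Qed.

Lemma L2normZ (c : R) (u : R -> R) : 0 <= c -> L2 u ->
  L2norm (fun x => c * u x) = c * L2norm u.
Proof.
move=> c0 lu; rewrite /L2norm (bilZ (@bilin_L2dot R))//; last exact: L2Z.
rewrite (bilZr (@bilin_L2dot R))// mulrA -expr2 sqrtrM ?sqr_ge0//.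
by rewrite sqrtr_sqr ger0_norm.
Qed.

Lemma eq_L2norm (u v : R -> R) : (forall x, I01 x -> u x = v x) -> L2norm u = L2norm v.
Proof. by move=> h; rewrite /L2norm (eq_L2dot h h). Qed.

(** [Phi_] and [ee] normalize functions that are positive multiples of each
other. *)
Lemma Phi_ee n (x : R) : I01 x -> Phi_ alpha n x = ee alpha n x.
Proof.
move=> /I01P /andP[x0 x1]; rewrite /ee /enrm.
case: n => [|n]; rewrite /Phi_.
  rewrite /= ef_lam0 mulr1.
  have -> : L2norm (ef alpha 0) = 1.
    rewrite /L2norm (_ : L2dot _ _ = 1) ?sqrtr1//.
    have c1 : continuous (fun _ : R => 1 : R) by move=> y; exact: cvg_cst.
    have ci : {within `[0 : R, 1], continuous (fun y : R => y)}.
      by apply: cont_within => y; exact: cvg_id.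
    have e1 (y : R) : 0 < y < 1 -> ef alpha 0 y * ef alpha 0 y = 1.
      by rewrite !ef_lam0 mulr1.
    by rewrite (L2dot_FTC c1 ci e1 (fun y _ => der_id y)) subr0.
  by rewrite invr1.
have C0 := phi_const_gt0 halpha n.
have Lf : L2 (ef alpha (lam n.+1)) by apply: L2_cont; exact: ef_cont.
have -> : L2norm (phi alpha n.+1) = phi_const alpha n * L2norm (ef alpha (lam n.+1)).
  rewrite -(L2normZ (ltW C0) Lf); apply: eq_L2norm => y /I01P /andP[y0 _].
  exact: (phi_ef halpha n y0).
by rewrite (phi_ef halpha)// invfM mulrACA mulVf ?mul1r// gt_eqF.
Qed.

Lemma Phi_basis : orthonormal_basis (Phi_ alpha).
Proof.
have LPhi n : L2 (Phi_ alpha n).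
  apply: (@eq_L2 _ (ee alpha n)) => [x xI|]; first by rewrite Phi_ee.
  by apply: L2_cont; exact: ee_cont.
split => //.
- move=> i j; rewrite -(ee_orthonormal halpha i j); apply: eq_L2dot => x xI; exact: Phi_ee.
- move=> u lu.
  have h := ee_complete halpha lu.
  have hs : Num.sqrt (nsq (fun x => \sum_(i < n) - L2dot u (ee alpha i) * ee alpha i x + u x))
      @[n --> \oo] --> 0.
    rewrite -[X in _ --> X]sqrtr0; apply: (@cvg_comp _ _ _ _ Num.sqrt _ (nbhs (0 : R))).
      exact: h.
    exact: sqrt_continuous.
  apply: cvg_trans hs; apply: near_eq_cvg; near=> n.
  rewrite /= /nsq -/(L2norm _); apply: eq_L2norm => x xI.
  rewrite addrC; congr (_ + _); rewrite -sumrN; apply: eq_bigr => i _.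
  have -> : L2dot u (Phi_ alpha i) = L2dot u (ee alpha i).
    by apply: eq_L2dot => // y yI; exact: Phi_ee.
  by rewrite Phi_ee// mulNr.
Unshelve. all: by end_near. Qed.

Lemma sqrt_lambda n : Num.sqrt (lam n.+1) = kappa alpha * jzero alpha n.+1.
Proof.
rewrite /lambda -exprMn sqrtr_sqr ger0_norm// mulr_ge0 ?(ltW k0)//.
exact: ltW (jzero_gt0 halpha n).
Qed.

Lemma gapE n : gap alpha n.+1 = kappa alpha * (jzero alpha n.+2 - jzero alpha n.+1).
Proof. by rewrite /gap !sqrt_lambda mulrBr. Qed.

Lemma gap_step n : gap alpha n.+2 <= gap alpha n.+1.
Proof.
rewrite !gapE ler_pM2l//.
exact: (zgap_mono (ord_ge halpha) (jzero_zeros halpha) n).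
Qed.

Lemma gap_noninc i j : (1 <= i <= j)%N -> gap alpha j <= gap alpha i.
Proof.
case: i => // i; case: j => // j /andP[_]; rewrite ltnS => ij.
have /nonincreasing_seqP h : forall n, gap alpha n.+2 <= gap alpha n.+1 := gap_step.
exact: (h _ _ ij).
Qed.

Lemma gap_dec i j : 0 < alpha -> (1 <= i < j)%N -> gap alpha j < gap alpha i.
Proof.
move=> al0; case: i => // i; case: j => // j /andP[_ ij].
apply: (@le_lt_trans _ _ (gap alpha i.+2)); first by apply: gap_noninc.
rewrite !gapE ltr_pM2l//.
exact: (zgap_mono_lt (ord_ge halpha) (jzero_zeros halpha) i (ord_gt halpha al0)).
Qed.

Lemma gap_cvg : gap alpha n @[n --> \oo] --> (2 - alpha) / 2 * pi.
Proof.
rewrite -cvg_shiftS /=.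
under eq_fun do rewrite gapE.
apply: cvgM; first exact: cvg_cst.
exact: (zgap_cvg (ord_ge halpha) (jzero_zeros halpha)).
Qed.

Lemma C1_ac (u u1 : R -> R) : continuous u -> continuous u1 ->
  (forall x : R, 0 < x -> der u x (u1 x)) -> abs_continuous 0 1 u.
Proof.
move=> cu cu1 du.
have cn : {within `[0 : R, 1], continuous (fun x => `|u1 x|)}.
  apply: cont_within => x; apply: (@cvg_comp _ _ _ u1 (fun t => `|t|) _ (nbhs (u1 x))).
    exact: cu1.
  exact: norm_continuous.
have [c _ hc] := EVT_max ler01 cn.
apply: (@lipschitz_abs_continuous _ _ _ _ `|u1 c|) => // s t s0 st t1.
apply: (der_bound (df := u1) st); first exact: cont_within.
- by move=> x /andP[sx _]; apply: du; exact: le_lt_trans sx.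
- move=> x /andP[sx xt]; apply: hc; rewrite in_itv/=.
  by rewrite (le_trans s0 (ltW sx)) (le_trans (ltW xt)).
Qed.

(** The continuous functions [ef], [ew] and [ed] serve as representatives of the
solution, of its flux and of its derivative. *)
Lemma eigenpair_ef n (k : R) (Phi : R -> R) : L2 Phi -> k != 0 ->
  ae_eq mu I01 Phi (fun x => k * ef alpha (lam n) x) -> eigenpair alpha (lam n) Phi.
Proof.
move=> LPhi kn0 PhiE.
have cE := @ef_cont _ _ halpha (lam n); have cW := @ew_cont _ _ halpha (lam n).
have cD := @ed_cont _ _ halpha (lam n).
pose v x := k * ef alpha (lam n) x; pose g x := k * ed alpha (lam n) x.
pose w x := k * ew alpha (lam n) x; pose r x := k * (- lam n * ef alpha (lam n) x).
have cv : continuous v by exact: scale_cont.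
have cg : continuous g by exact: scale_cont.
have cw : continuous w by exact: scale_cont.
have cr : continuous r by apply: scale_cont; exact: scale_cont.
have dv (x : R) : 0 < x -> der v x (g x) by move=> x0; apply: derZ; exact: ef_der.
have dw (x : R) : 0 < x -> der w x (r x) by move=> x0; apply: derZ; exact: ew_der.
have rv : ac_repr Phi v by split => //; exact: (C1_ac cv cg dv).
have gw x : I01 x -> x `^ alpha * g x = w x.
  by move=> /I01P /andP[x0 _]; rewrite /g mulrCA (ed_ew halpha)// ltW.
have rw : ac_repr (fun x => x `^ alpha * g x) w.
  split; first exact: (C1_ac cw cr dw).
  by apply: aeW => x xI; exact: gw.
have hv : has_deriv Phi g.
  exists v => //; apply: aeW => x /I01P /andP[x0 _]; exact: dv.
have hw : has_deriv (fun x => x `^ alpha * g x) r.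
  exists w => //; apply: aeW => x /I01P /andP[x0 _]; exact: dw.
have ha2 : 0 <= alpha / 2 < 1 by case/andP: halpha => h1 h2; apply/andP; split; lra.
split.
- split.
    split => //; exists g => //.
    apply: (@eq_L2 _ (fun x => wt (alpha / 2) x * g x)).
      by move=> x /I01P /andP[x0 _]; rewrite /wt gtr0_norm.
    by apply: L2_cont; apply: mul_cont => //; exact: wt_cont.
  exists g => //; split.
    by apply: (@eq_L2 _ w) => [x xI|]; [rewrite gw|exact: L2_cont].
  exists r => //; apply: (@eq_L2 _ r); last exact: L2_cont.
  by move=> x _; rewrite mul0r powRr0 mul1r.
- move=> Phi0.
  have v0 : v 0 = 0.
    apply: (abs_continuous_ae0 rv.1); last by rewrite lexx ler01.
    apply: (aeS2 rv.2 Phi0) => x h1 h2 xI.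
    by rewrite -h1// h2.
  by move: v0; rewrite /v (ef0 halpha) mulr1 => /eqP; rewrite (negbTE kn0).
- exists g, r; split => //.
  apply: (aeS PhiE) => x h xI; rewrite h// /r; ring.
- by exists g, w; split => //; rewrite /w /ew mulr0 mul0r mulr0.
- exists v => //.
  have ed1 : ed alpha (lam n) 1 = 0.
    by have := ed_ew halpha (lam n) ler01; rewrite powR1 mul1r ew_1.
  have [d1 d1E] := dv 1 ltr01.
  have g1 : g 1 = 0 by rewrite /g ed1 mulr0.
  have hc : h^-1 *: ((v \o shift (1 : R)) (h *: (1 : R)) - v 1) @[h --> (0 : R)^'-] --> g 1.
    rewrite -d1E; apply: cvg_dnbhs_at_left; exact: d1.
  rewrite g1 in hc; apply: cvg_trans hc; apply: near_eq_cvg; near=> h.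
  by rewrite /GRing.scale /= mulr1 (addrC h 1).
Unshelve. all: by end_near. Qed.

Lemma eigenpairP (l : R) (Phi : R -> R) : L2 Phi ->
  eigenpair alpha l Phi <-> exists (n : nat) (rho : R),
    [/\ rho != 0, l = lam n & ae_eq mu I01 Phi (fun x => rho * Phi_ alpha n x)].
Proof.
move=> LPhi; split.
- move=> ep; have [_ nz _ _ _] := ep.
  have [v [w [hc PhiE]]] := eigenpair_classical ep.
  have vE := classical_ef halpha hc.
  have v0 : v 0 != 0.
    apply/eqP => v0; apply: nz; apply: (aeS PhiE) => x h xI; rewrite h//.
    move/I01P: xI => /andP[x0 x1].
    by have [|-> _] := vE x; [rewrite !ltW|rewrite v0 mul0r].
  have [n ln] := classical_eigenvalue halpha hc v0.
  exists n, (v 0 * enrm alpha n); split => //.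
    by rewrite mulf_neq0// gt_eqF// enrm_gt0.
  apply: (aeS PhiE) => x h xI; rewrite h// Phi_ee//.
  move/I01P: (xI) => /andP[x0 x1].
  have [|-> _] := vE x; first by rewrite !ltW.
  by rewrite ln /ee -mulrA mulVKf// gt_eqF// enrm_gt0.
- move=> [n [rho [rho0 -> PhiE]]].
  apply: (@eigenpair_ef n (rho / enrm alpha n)) => //.
    by rewrite mulf_neq0// invr_eq0 gt_eqF// enrm_gt0.
  apply: (aeS PhiE) => x h xI; rewrite h// Phi_ee// /ee; ring.
Qed.

End Spectrum.

Theorem proposition3p1 (R : realType) (alpha : R) (halpha : 0 <= alpha < 1) :
  [/\ (forall (lam : R) (Phi : R -> R), L2 Phi ->
         eigenpair alpha lam Phi <->
         exists (n : nat) (rho : R),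
           [/\ rho != 0, lam = lambda alpha n &
               ae_eq (@lebesgue_measure R) I01
                 Phi (fun x => rho * Phi_ alpha n x)]),
      orthonormal_basis (Phi_ alpha),
      (forall m n : nat, (1 <= m <= n)%N -> gap alpha n <= gap alpha m),
      (0 < alpha ->
         forall m n : nat, (1 <= m < n)%N -> gap alpha n < gap alpha m) &
      gap alpha n @[n --> \oo] --> (2 - alpha) / 2 * pi].
Proof.
split.
- by move=> lam Phi; exact: eigenpairP.
- exact: Phi_basis.
- by move=> m n; exact: gap_noninc.
- by move=> al0 m n; exact: gap_dec.
- exact: gap_cvg.
Qed.
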